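(* Let $p,q,n$ be positive integers with $p\le q$, $\gcd(p,q)=1$. The analytic moduli space (the set of analytic equivalence classes) of germs at $0\in\mathbb{C}^2$ of quasi-homogeneous curves of type $(p,q,n)$ is given as follows. (i) If $(p,q)=(1,1)$, it is $$\frac{\operatorname{Symm}(\mathbb{P}^1_\Delta(n))}{\operatorname{PSL}(2,\mathbb{C})},$$ where $[\lambda]$ corresponds to the class of the curve $C_\lambda$; that is, every curve of type $(1,1,n)$ is analytically equivalent to some $C_\lambda$, and $C_\lambda$ and $C_\mu$ are analytically equivalent if and only if $[\lambda]=[\mu]$. (ii) If $p=1$ and $q>1$, it is $$\mathbb{Z}_2\times\frac{\operatorname{Symm}(\mathbb{C}_\Delta(n))}{\operatorname{Aff}(\mathbb{C})},$$ where $(m,[\lambda])$ corresponds to the class of the curve $C_{m,\lambda}$. (iii) If $1<p<q$, it is $$\mathbb{Z}_2\times\mathbb{Z}_2\times\frac{\operatorname{Symm}(\mathbb{C}^*_\Delta(n))}{\operatorname{GL}(1,\mathbb{C})},$$ where $(m,k,[\lambda])$ corresponds to the class of the curve $C_{m,k,\lambda}$. In (ii) and (iii), as in (i), ''corresponds'' means that the stated assignment is a well-defined bijection onto the set of analytic equivalence classes of curves of the given type.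
   Context: Two germs of curves $C,C'$ at $0\in\mathbb{C}^2$ are analytically equivalent if there is a germ of biholomorphism $\Phi$ of $(\mathbb{C}^2,0)$ with $\Phi(C)=C'$. A germ of curve is quasi-homogeneous if, in some local holomorphic coordinates, it is the zero set of a reduced quasi-homogeneous polynomial $\sum_{ai+bj=d}a_{ij}x^iy^j$ with $a,b,d$ positive integers. For a manifold $M$, $M_\Delta(n)=\{(x_1,\dots,x_n)\in M^n : x_i\ne x_j \text{ for } i\neq j\}$. The symmetric group $S_n$ acts on $M_\Delta(n)$ by permuting coordinates and $\operatorname{Symm}(M_\Delta(n))$ denotes the quotient. If a group $G$ acts on $M$, it acts diagonally on $M_\Delta(n)$, hence on $\operatorname{Symm}(M_\Delta(n))$; the class of $\lambda\in M_\Delta(n)$ in $\operatorname{Symm}(M_\Delta(n))/G$ is denoted $[\lambda]$. Here $\operatorname{PSL}(2,\mathbb{C})$ acts on $\mathbb{P}^1=\mathbb{C}\cup\{\infty\}$ by Möbius transformations, $\operatorname{Aff}(\mathbb{C})$ acts on $\mathbb{C}$ by $z\mapsto az+b$ ($a\ne0$), and $\operatorname{GL}(1,\mathbb{C})$ acts on $\mathbb{C}^*$ by $z\mapsto az$ ($a\neq 0$). $\mathbb{Z}_2=\{0,1\}$ is used as an index set. Types and normal forms (up to local analytic change of coordinates): - Type $(1,1,n)$: for $\lambda=(\lambda_1,\dots,\lambda_n)\in\mathbb{P}^1_\Delta(n)$, $C_\lambda$ is the zero set of $f_\lambda=\prod_{j=1}^n(y-\lambda_jx)$ if all $\lambda_j\neq\infty$,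 and of $f_\lambda=x\prod_{j\ne i}(y-\lambda_jx)$ if $\lambda_i=\infty$. A curve is of type $(1,1,n)$ if it is equivalent to one of these. - Type $(1,q,n)$, $q\ge 2$: for $m\in\{0,1\}$ and $\lambda\in\mathbb{C}_\Delta(n)$, $C_{m,\lambda}$ is the zero set of $x^m\prod_{j=1}^n(y-\lambda_jx^q)$. A curve is of type $(1,q,n)$ if it is equivalent to one of these. - Type $(p,q,n)$, $2\le p<q$, $\gcd(p,q)=1$: for $m,k\in\{0,1\}$ and $\lambda\in\mathbb{C}^*_\Delta(n)$, $C_{m,k,\lambda}$ is the zero set of $x^my^k\prod_{j=1}^n(y^p-\lambda_jx^q)$. A curve is of type $(p,q,n)$ if it is equivalent to one of these. *)

(* Defs.v *)
From HB Require Import structures.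
From mathcomp Require Import all_boot all_order all_algebra all_fingroup.
From mathcomp Require Import all_classical all_reals all_analysis.
From mathcomp Require Import complex.

Set Implicit Arguments.
Unset Strict Implicit.
Unset Printing Implicit Defensive.

Import Order.TTheory GRing.Theory Num.Theory.
Import numFieldNormedType.Exports.

Local Open Scope classical_set_scope.
Local Open Scope ring_scope.

(* The ascription to numClosedFieldType makes [Cplx R] a normed space over
   itself, so that [differentiable] below means complex differentiable. *)
Definition Cplx (R : realType) : numClosedFieldType := R[i].

Definition holomorphic_on (R : realType) (W : normedModType (Cplx R))
    (U : set (Cplx R * Cplx R)) (f : Cplx R * Cplx R -> W) : Prop :=
  open U /\ forall z, U z -> differentiable f z.

(* Germs of sets at the origin are handled through representatives: a subset of
   C^2 stands for its germ, and the notions below only see this germ. *)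
Definition curve_germ (R : realType) (A : set (Cplx R * Cplx R)) : Prop :=
  exists (U : set (Cplx R * Cplx R)) (f : Cplx R * Cplx R -> Cplx R),
    [/\ U (0, 0), holomorphic_on U f, f (0, 0) = 0,
        ~ (\forall z \near ((0, 0) : Cplx R * Cplx R), f z = 0)
      & forall z, U z -> (A z <-> f z = 0)].

Definition biholomorphism (R : realType) (U V : set (Cplx R * Cplx R))
    (Phi : Cplx R * Cplx R -> Cplx R * Cplx R) : Prop :=
  [/\ holomorphic_on U Phi, set_bij U V Phi
    & exists Psi : Cplx R * Cplx R -> Cplx R * Cplx R,
        holomorphic_on V Psi /\ forall z, U z -> Psi (Phi z) = z].

Definition an_equiv (R : realType) (A B : set (Cplx R * Cplx R)) : Prop :=
  exists (U V : set (Cplx R * Cplx R))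
         (Phi : Cplx R * Cplx R -> Cplx R * Cplx R),
    [/\ U (0, 0), biholomorphism U V Phi, Phi (0, 0) = (0, 0)
      & Phi @` (A `&` U) = B `&` V].

Definition an_class (R : realType) (A : set (Cplx R * Cplx R)) :
    set (set (Cplx R * Cplx R)) :=
  [set B | curve_germ B /\ an_equiv A B].

(* A polynomial in x and y is an element P of {poly {poly C}}, the outer variable
   being y: the coefficient of x^i y^j is P`_j`_i. *)
Definition zero_set (R : realType) (P : {poly {poly Cplx R}}) :
    set (Cplx R * Cplx R) :=
  [set z | P.[z.2%:P].[z.1] = 0].

Definition quasi_homogeneous_poly (R : realType)
    (P : {poly {poly Cplx R}}) : Prop :=
  exists a b d : nat, [/\ (0 < a)%N, (0 < b)%N, (0 < d)%N
    & forall i j : nat, P`_j`_i != 0 -> (a * i + b * j = d)%N].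

Definition reduced_poly (R : realType) (P : {poly {poly Cplx R}}) : Prop :=
  P != 0 /\
  forall g h : {poly {poly Cplx R}}, P = g ^+ 2 * h -> g \is a GRing.unit.

Definition quasi_homogeneous (R : realType)
    (A : set (Cplx R * Cplx R)) : Prop :=
  exists P : {poly {poly Cplx R}},
    [/\ quasi_homogeneous_poly P, reduced_poly P & an_equiv A (zero_set P)].

(* M_Delta(n), for a subset M of an ambient type T. *)
Definition conf (T : Type) (M : set T) (n : nat) : set ('I_n -> T) :=
  [set l : 'I_n -> T | injective l /\ forall i, M (l i)].
Arguments conf {T} M n _.

Definition sym_orbit (T : Type) (n : nat) (l : 'I_n -> T) : set ('I_n -> T) :=
  [set l \o s | s in [set: {perm 'I_n}]].

Definition Symm (T : Type) (M : set T) (n : nat) : set (set ('I_n -> T)) :=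
  [set sym_orbit l | l in conf M n].
Arguments Symm {T} M n _.

Definition diag_act (T : Type) (n : nat) (g : T -> T) (O : set ('I_n -> T)) :
    set ('I_n -> T) :=
  [set g \o l | l in O].

(* A group acting on M is given by the set G of its transformations. *)
Definition act_orbit (T : Type) (n : nat) (G : set (T -> T))
    (O : set ('I_n -> T)) : set (set ('I_n -> T)) :=
  [set diag_act g O | g in G].

Definition Symm_quot (T : Type) (M : set T) (n : nat) (G : set (T -> T)) :
    set (set (set ('I_n -> T))) :=
  [set act_orbit G O | O in Symm M n].
Arguments Symm_quot {T} M n G _.

Definition conf_class (T : Type) (n : nat) (G : set (T -> T)) (l : 'I_n -> T) :
    set (set ('I_n -> T)) :=
  act_orbit G (sym_orbit l).

(* P^1 = C + {oo}, with oo = None. *)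
Definition P1 (R : realType) : Type := option (Cplx R).

Definition mobius (R : realType) (a b c d : Cplx R) (z : P1 R) : P1 R :=
  match z with
  | Some t => if c * t + d == 0 then None else Some ((a * t + b) / (c * t + d))
  | None => if c == 0 then None else Some (a / c)
  end.

Definition PSL2 (R : realType) : set (P1 R -> P1 R) :=
  [set g | exists a b c d : Cplx R, a * d - b * c = 1 /\ g = mobius a b c d].
Arguments PSL2 : clear implicits.

Definition Aff (R : realType) : set (Cplx R -> Cplx R) :=
  [set g | exists a b : Cplx R, a != 0 /\ g = (fun z => a * z + b)].
Arguments Aff : clear implicits.

Definition GL1 (R : realType) : set (Cplx R -> Cplx R) :=
  [set g | exists a : Cplx R, a != 0 /\ g = (fun z => a * z)].
Arguments GL1 : clear implicits.

Definition Cstar (R : realType) : set (Cplx R) := [set z | z != 0].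
Arguments Cstar : clear implicits.

(* The slope oo contributes the line x = 0. *)
Definition line_factor (R : realType) (l : P1 R) (z : Cplx R * Cplx R) :
    Cplx R :=
  if l is Some t then z.2 - t * z.1 else z.1.

Definition curve_11 (R : realType) (n : nat) (l : 'I_n -> P1 R) :
    set (Cplx R * Cplx R) :=
  [set z | \prod_(j < n) line_factor (l j) z = 0].

Definition curve_1q (R : realType) (q n : nat) (m : 'I_2)
    (l : 'I_n -> Cplx R) : set (Cplx R * Cplx R) :=
  [set z | z.1 ^+ m * \prod_(j < n) (z.2 - l j * z.1 ^+ q) = 0].

Definition curve_pq (R : realType) (p q n : nat) (m k : 'I_2)
    (l : 'I_n -> Cplx R) : set (Cplx R * Cplx R) :=
  [set z | z.1 ^+ m * z.2 ^+ k *
           \prod_(j < n) (z.2 ^+ p - l j * z.1 ^+ q) = 0].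

Definition of_type (R : realType) (p q n : nat) (A : set (Cplx R * Cplx R)) :
    Prop :=
  if p == 1%N then
    if q == 1%N then
      exists2 l : 'I_n -> P1 R, conf setT n l & an_equiv A (curve_11 l)
    else
      exists (m : 'I_2) (l : 'I_n -> Cplx R),
        conf setT n l /\ an_equiv A (curve_1q q m l)
  else
    exists (m k : 'I_2) (l : 'I_n -> Cplx R),
      conf (Cstar R) n l /\ an_equiv A (curve_pq p q m k l).

Definition moduli (R : realType) (p q n : nat) :
    set (set (set (Cplx R * Cplx R))) :=
  [set an_class A | A in
     [set A | [/\ curve_germ A, quasi_homogeneous A & of_type p q n A]]].
Arguments moduli : clear implicits.

(* Main.v *)
Require Import Defs.
From HB Require Import structures.
From mathcomp Require Import all_boot all_order all_algebra all_fingroup.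
From mathcomp Require Import all_classical all_reals all_analysis.
From mathcomp Require Import complex separable ring lra.

Set Implicit Arguments.
Unset Strict Implicit.
Unset Printing Implicit Defensive.

Import Order.TTheory GRing.Theory Num.Theory.
Import numFieldNormedType.Exports.

Local Open Scope classical_set_scope.
Local Open Scope ring_scope.

(** A holomorphic map is strictly differentiable: by Goursat's theorem and a
    Cauchy estimate, if E is holomorphic in y and |E| <= e r on a polydisc of
    radius r, then E is Lipschitz in y with constant O(e) on a smaller polydisc.

    For (p,q) = (1,1) the differential at 0 of an equivalence preserves the union
    of the lines, hence acts on slopes by a Moebius transformation.

    For p < q the branches other than x = 0 are parametrized by (t^p, t^q z), with
    z a root of Q_l = w^k prod_j (w^p - l_j).  Let (X, Y) be an equivalence with
    differential [[a, b], [c, d]].  Comparing tangent cones gives m = m' and, apart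
    from the trivial case of one smooth branch tangent to y = 0, also c = 0.  Along
    an ultrafilter refining t -> 0 each Y(t^p, t^q z) / t^q converges to some root
    of Q_(a^q l'), and by strict differentiability differences of these limits are
    d times differences of the z: so z |-> g0 + d z maps the roots of Q_l to roots
    of Q_(a^q l').  No Taylor expansion of Y(x, 0) is needed, as g0 absorbs it.
    For p = 1 this is the affine relation.  For p > 1 both root sets are invariant
    under the p-th roots of unity, so their barycentres vanish; counting roots
    gives k = k' and comparing barycentres gives g0 = 0. *)

(** * Integrals of real functions *)

Section RealIntegral.
Variable R : realType.
Implicit Types (phi psi F : R -> R) (a b c : R).

(** For p < q the obstacle is one of scale: two branches over the same x = t^p are only O(t^q)
    apart, while a first-order expansion at 0 has error o(t^p) on them and so cannot tell them
    apart. Strict differentiability in y has an error relative to |y - y'| alone, hence o(t^q).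

    A second obstacle is that Y / t^q is not known to converge, or even to be bounded, as t -> 0:
    only a product of factors is known to tend to 0, and which factor is small may vary with t.
    Along an ultrafilter one fixed factor tends to 0, which gives boundedness and convergence at
    once; using the same ultrafilter for all z allows the limits to be subtracted.

    Every consequence of an equivalence is first obtained in one direction, as an inequality or an
    inclusion. The inverse equivalence turns inequalities of indices into equalities, and finiteness
    turns inclusions of configurations into permutations. *)

Lemma ex_primitive phi a : continuous phi ->
  exists F, forall x, a < x -> is_derive x 1 F (phi x).
Proof.
move=> cphi.
exists (fun x => \int[lebesgue_measure]_(t in `[a, x]) phi t) => x ax.
(* The right end x + 1 only makes x an interior point of the interval. *)
have [||dF <-] := @continuous_FTC1_closed R phi a x (x + 1) _ _ ax (cphi x).
- by rewrite ltrDl.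
- apply: continuous_compact_integrable; first exact: segment_compact.
  exact: continuous_subspaceT.
by rewrite derive1E; exact: derivableP.
Qed.

Definition rint phi a b : R := \int[lebesgue_measure]_(x in `[a, b]) phi x.

Lemma rint_FTC phi F a b : continuous phi -> a <= b ->
  (forall x, a <= x <= b -> is_derive x 1 F (phi x)) ->
  rint phi a b = F b - F a.
Proof.
move=> cphi; rewrite le_eqVlt => /predU1P[<- _|ab dF].
  by rewrite subrr /rint set_itv1 Rintegral_set1.
have cF x : a <= x <= b -> F y @[y --> x] --> F x.
  move=> /dF [d _]; exact/differentiable_continuous/derivable1_diffP.
rewrite /rint /Rintegral (@continuous_FTC2 R phi F a b) //.
- exact: continuous_subspaceT.
- split.
  + move=> x; rewrite in_itv /= => /andP[ax xb].
    by have [] := dF x; rewrite ?(ltW ax) ?(ltW xb).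
  + by apply: cvg_at_right_filter; apply: cF; rewrite lexx ltW.
  + by apply: cvg_at_left_filter; apply: cF; rewrite lexx ltW.
- move=> x; rewrite in_itv /= => /andP[ax xb].
  by rewrite derive1E; apply: derive_val; apply: dF; rewrite (ltW ax) (ltW xb).
Qed.

Lemma ex_rint_FTC phi a : continuous phi ->
  exists F, forall b c, a <= b -> b <= c ->
    rint phi b c = F c - F b /\
    forall x, b <= x <= c -> is_derive x 1 F (phi x).
Proof.
(* Starting the primitive at a - 1 gives it a two-sided derivative at the end point a itself. *)
move=> cphi; have [F dF] := ex_primitive (a - 1) cphi.
exists F => b c ab bc.
have d x : b <= x <= c -> is_derive x 1 F (phi x).
  by case/andP=> bx _; apply: dF; rewrite (lt_le_trans _ (le_trans ab bx)) // gtrBl.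
by split=> //; exact: rint_FTC.
Qed.

Lemma rint_chasles phi a b c : continuous phi -> a <= b -> b <= c ->
  rint phi a c = rint phi a b + rint phi b c.
Proof.
move=> cphi ab bc; have [F dF] := ex_rint_FTC a cphi.
have [-> _] := dF a c (lexx _) (le_trans ab bc).
have [-> _] := dF a b (lexx _) ab.
have [-> _] := dF b c ab bc.
by ring.
Qed.

(** The mean value theorem for a primitive of [phi]; the estimates of integrals below rest on it. *)
Lemma rint_mean phi a b : continuous phi -> a <= b ->
  exists2 c, a <= c <= b & rint phi a b = phi c * (b - a).
Proof.
move=> cphi ab; have [F dF] := ex_rint_FTC a cphi.
have [-> d] := dF a b (lexx _) ab.
have d1 x : x \in `]a, b[ -> is_derive x 1 F (phi x).
  by rewrite in_itv /= => /andP[/ltW ax /ltW xb]; apply: d; rewrite ax.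
have cF : {within `[a, b], continuous F}.
  apply: derivable_within_continuous => x; rewrite in_itv /= => axb.
  by case: (d x axb).
have [c cab e] := MVT_segment ab d1 cF.
by exists c => //; move: cab; rewrite in_itv.
Qed.

Lemma rintD phi psi a b : continuous phi -> continuous psi -> a <= b ->
  rint (fun x => phi x + psi x) a b = rint phi a b + rint psi a b.
Proof.
move=> cphi cpsi ab.
have [F dF] := ex_rint_FTC a cphi; have [-> d] := dF a b (lexx _) ab.
have [G dG] := ex_rint_FTC a cpsi; have [-> d'] := dG a b (lexx _) ab.
have cs : continuous (fun x => phi x + psi x).
  by move=> x; apply: cvgD; [exact: cphi|exact: cpsi].
have ds x : a <= x <= b -> is_derive x 1 (F + G) (phi x + psi x).
  by move=> axb; apply: is_deriveD; [exact: d|exact: d'].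
by rewrite (rint_FTC cs ab ds) !fctE; ring.
Qed.

Lemma rint_affine (k m : R) a b : a <= b ->
  rint (fun x => k + m * x) a b = k * (b - a) + m * (b ^+ 2 - a ^+ 2) / 2.
Proof.
move=> ab.
have cs : continuous (fun x => k + m * x).
  move=> x; apply: cvgD; first exact: cvg_cst.
  by apply: cvgM; [exact: cvg_cst|exact: cvg_id].
pose F : R -> R := fun x => k * x + m / 2 * x ^+ 2.
have ds x : a <= x <= b -> is_derive x 1 F (k + m * x).
  by move=> _; apply: is_derive_eq; rewrite /GRing.scale /=; field.
by rewrite (rint_FTC cs ab ds) /F; field.
Qed.

End RealIntegral.

(** * Contour integrals and Goursat's theorem *)

Section ContourIntegral.
Import ComplexField.Normc.
Local Open Scope complex_scope.
Variable R : realType.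
Local Notation C := (Cplx R).
Implicit Types (x y s a b : R) (z w c d : C) (g h : C -> C).

Lemma normcD z w : normc (z + w) <= normc z + normc w.
Proof. exact: (@le_normcD R z w). Qed.

Lemma normcNE z : normc (- z) = normc z.
Proof. exact: (@normcN R z). Qed.

Lemma normcME z w : normc (z * w) = normc z * normc w.
Proof. exact: normcM. Qed.

Lemma normcVE z : normc z^-1 = (normc z)^-1.
Proof. exact: normcV. Qed.

Lemma normc_ge0 z : 0 <= normc z.
Proof. by case: z => a b; exact: sqrtr_ge0. Qed.

Lemma normc_eq0 z : normc z = 0 -> z = 0.
Proof. exact: eq0_normc. Qed.

Lemma normc_gt0 z : z != 0 -> 0 < normc z.
Proof.
move=> z0; rewrite lt_neqAle normc_ge0 andbT eq_sym.
by apply: contra_neq z0 => /normc_eq0.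
Qed.

Lemma normc0E : normc (0 : C) = 0.
Proof. exact: normc0. Qed.

Lemma ler_abs_Re z : `|complex.Re z| <= normc z.
Proof.
case: z => a b /=; rewrite -sqrtr_sqr ler_sqrt ?addr_ge0 ?sqr_ge0 //.
by rewrite lerDl sqr_ge0.
Qed.

Lemma ler_abs_Im z : `|complex.Im z| <= normc z.
Proof.
case: z => a b /=; rewrite -sqrtr_sqr ler_sqrt ?addr_ge0 ?sqr_ge0 //.
by rewrite lerDr sqr_ge0.
Qed.

Lemma normc_ReIm z : normc z <= `|complex.Re z| + `|complex.Im z|.
Proof.
case: z => a b /=.
rewrite -[leRHS]ger0_norm ?addr_ge0 // -sqrtr_sqr ler_sqrt ?sqr_ge0 //.
by rewrite sqrrD !real_normK ?num_real // addrAC lerDl mulrn_wge0 // mulr_ge0.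
Qed.

Lemma normc_real a : normc (a%:C : C) = `|a|.
Proof. by rewrite /= expr0n addr0 sqrtr_sqr. Qed.

(** Continuity is asked on the whole plane because primitives are taken of functions continuous on
    the whole line; an integrand known only on a square is extended first. *)
Definition ccont g := forall z (e : R), 0 < e ->
  exists2 d : R, 0 < d & forall w, normc (w - z) < d -> normc (g w - g z) < e.

Lemma continuous_Re_line g (l : R -> C) : ccont g ->
  (forall s t : R, normc (l s - l t) = `|s - t|) ->
  continuous (fun t : R => complex.Re (g (l t))).
Proof.
move=> cg il t; apply/cvgrPdist_lt => e e0.
have [d d0 H] := cg (l t) e e0.
near=> s; rewrite distrC.
apply: le_lt_trans (H (l s) _).
  by apply: le_trans (ler_abs_Re _); case: (g _) => ? ?; case: (g _).
by rewrite il distrC; near: s; apply: cvgr_dist_lt.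
Unshelve. all: by end_near. Qed.

Lemma continuous_Im_line g (l : R -> C) : ccont g ->
  (forall s t : R, normc (l s - l t) = `|s - t|) ->
  continuous (fun t : R => complex.Im (g (l t))).
Proof.
move=> cg il t; apply/cvgrPdist_lt => e e0.
have [d d0 H] := cg (l t) e e0.
near=> s; rewrite distrC.
apply: le_lt_trans (H (l s) _).
  by apply: le_trans (ler_abs_Im _); case: (g _) => ? ?; case: (g _).
by rewrite il distrC; near: s; apply: cvgr_dist_lt.
Unshelve. all: by end_near. Qed.

Definition horiz y (t : R) : C := t +i* y.
Definition vert x (t : R) : C := x +i* t.

Lemma horiz_isom y (s t : R) : normc (horiz y s - horiz y t) = `|s - t|.
Proof. by rewrite /= subrr expr0n addr0 sqrtr_sqr. Qed.

Lemma vert_isom x (s t : R) : normc (vert x s - vert x t) = `|s - t|.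
Proof. by rewrite /= subrr expr0n add0r sqrtr_sqr. Qed.

(** Meant for unit-speed [l]; the factor dz/dt, which is 1 or i, is supplied by [square_int]. *)
Definition cint g (l : R -> C) a b : C :=
  rint (fun t => complex.Re (g (l t))) a b +i*
  rint (fun t => complex.Im (g (l t))) a b.

(** The counterclockwise integral of g dz along the boundary of the square of side s with lower left
    corner x + iy. *)
Definition square_int g x y s : C :=
  cint g (horiz y) x (x + s) + 'i * cint g (vert (x + s)) y (y + s)
  - cint g (horiz (y + s)) x (x + s) - 'i * cint g (vert x) y (y + s).

Section Line.
Variable l : R -> C.
Hypothesis il : forall s t : R, normc (l s - l t) = `|s - t|.

Lemma cint_chasles g a b (c : R) : ccont g -> a <= b -> b <= c ->
  cint g l a c = cint g l a b + cint g l b c.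
Proof.
move=> cg ab bc; rewrite /cint.
rewrite (rint_chasles (continuous_Re_line cg il) ab bc).
by rewrite (rint_chasles (continuous_Im_line cg il) ab bc).
Qed.

Lemma cintD g h a b : ccont g -> ccont h -> a <= b ->
  cint (fun z => g z + h z) l a b = cint g l a b + cint h l a b.
Proof.
move=> cg ch ab; rewrite /cint.
transitivity ((rint (fun t => complex.Re (g (l t))) a b
               + rint (fun t => complex.Re (h (l t))) a b)
           +i* (rint (fun t => complex.Im (g (l t))) a b
               + rint (fun t => complex.Im (h (l t))) a b) : C); last by [].
rewrite -!rintD //; try by [exact: continuous_Re_line|exact: continuous_Im_line].
by congr (rint _ _ _ +i* rint _ _ _); apply: funext => t;
   case: (g _) => ? ?; case: (h _).
Qed.

(** Real and imaginary parts are bounded separately, hence the factor 2 in place of the sharp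
    constant 1. *)
Lemma cint_bound g a b (M : R) : ccont g -> a <= b ->
  (forall t, a <= t <= b -> normc (g (l t)) <= M) ->
  normc (cint g l a b) <= 2 * M * (b - a).
Proof.
move=> cg ab gM; apply: le_trans (normc_ReIm _) _ => /=.
have [t tab ->] := rint_mean (continuous_Re_line cg il) ab.
have [t' tab' ->] := rint_mean (continuous_Im_line cg il) ab.
rewrite !normrM (ger0_norm (_ : 0 <= b - a)) ?subr_ge0 // -mulrDl.
rewrite ler_wpM2r ?subr_ge0 // mulr2n mulrDl mul1r lerD //.
  exact: le_trans (ler_abs_Re _) (gM _ tab).
exact: le_trans (ler_abs_Im _) (gM _ tab').
Qed.
End Line.

(** Each inner edge is traversed twice, in opposite directions, so that only the outer boundary
    remains. *)
Lemma square_int_split g x y s : ccont g -> 0 <= s ->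
  square_int g x y (s + s) = square_int g x y s + square_int g (x + s) y s + square_int g x (y + s) s
                     + square_int g (x + s) (y + s) s.
Proof.
move=> cg s0; rewrite /square_int !addrA.
rewrite (cint_chasles (horiz_isom y) (a := x) (b := x + s) (c := x + s + s)) ?lerDl //.
rewrite (cint_chasles (vert_isom (x + s + s)) (a := y) (b := y + s) (c := y + s + s)) ?lerDl //.
rewrite (cint_chasles (horiz_isom (y + s + s)) (a := x) (b := x + s) (c := x + s + s)) ?lerDl //.
rewrite (cint_chasles (vert_isom x) (a := y) (b := y + s) (c := y + s + s)) ?lerDl //.
by ring.
Qed.

Lemma square_intD g h x y s : ccont g -> ccont h -> 0 <= s ->
  square_int (fun z => g z + h z) x y s = square_int g x y s + square_int h x y s.
Proof.
move=> cg ch s0; rewrite /square_int.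
rewrite !cintD ?lerDl //; try by [exact: horiz_isom | exact: vert_isom].
by ring.
Qed.

Definition in_square x y s z :=
  (x <= complex.Re z <= x + s) && (y <= complex.Im z <= y + s).

Lemma in_square_sub x y s x' y' s' z : in_square x' y' s' z ->
  [/\ x <= x', y <= y', x' + s' <= x + s & y' + s' <= y + s] -> in_square x y s z.
Proof.
move=> /andP[/andP[h1 h2] /andP[h3 h4]] [k1 k2 k3 k4]; rewrite /in_square.
by rewrite (le_trans k1) // (le_trans h2) // (le_trans k2) // (le_trans h4).
Qed.

Lemma in_square_center s z : in_square (- s) (- s) (s + s) z =
  (`|complex.Re z| <= s) && (`|complex.Im z| <= s).
Proof. by rewrite /in_square addKr !ler_norml. Qed.

(** Four sides, each with the factor 2 of [cint_bound], give 8. The bound on g is asked on the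
    boundary only, since g may be large inside. *)
Lemma square_int_bound g x y s (M : R) : ccont g -> 0 <= s ->
  (forall z, in_square x y s z ->
     [|| complex.Re z == x, complex.Re z == x + s,
         complex.Im z == y | complex.Im z == y + s] -> normc (g z) <= M) ->
  normc (square_int g x y s) <= 8 * M * s.
Proof.
move=> cg s0 gM.
have ni z : normc ('i * z) = normc z.
  by rewrite normcME /= expr0n expr1n add0r sqrtr1 mul1r.
have H u : u = y \/ u = y + s -> normc (cint g (horiz u) x (x + s)) <= 2 * M * s.
  move=> uE; rewrite -[X in _ <= _ * X](addKr x s) [X in _ * X]addrC.
  apply: (cint_bound (horiz_isom u)) => //; rewrite ?lerDl // => t txs.
  apply: gM; rewrite /in_square /= ?txs; last by case: uE => ->; rewrite eqxx !orbT.
  by case: uE => ->; rewrite lexx lerDl s0.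
have V u : u = x \/ u = x + s -> normc (cint g (vert u) y (y + s)) <= 2 * M * s.
  move=> uE; rewrite -[X in _ <= _ * X](addKr y s) [X in _ * X]addrC.
  apply: (cint_bound (vert_isom u)) => //; rewrite ?lerDl // => t txs.
  apply: gM; rewrite /in_square /= ?txs; last by case: uE => ->; rewrite eqxx ?orbT.
  by case: uE => ->; rewrite lexx lerDl s0.
rewrite /square_int; apply: le_trans (normcD _ _) _; rewrite normcNE ni.
apply: le_trans (lerD (normcD _ _) (V _ (or_introl erefl))) _.
rewrite normcNE.
apply: le_trans (lerD (lerD (normcD _ _) (H _ (or_intror erefl))) (lexx _)) _.
rewrite ni.
have := H _ (or_introl erefl); have := V _ (or_intror erefl).
by lra.
Qed.

Lemma ccontD g h : ccont g -> ccont h -> ccont (fun z => g z + h z).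
Proof.
move=> cg ch z e e0.
have e2 : 0 < e / 2 by rewrite divr_gt0.
have [d1 d10 H1] := cg z _ e2; have [d2 d20 H2] := ch z _ e2.
exists (Num.min d1 d2) => [|w]; first by rewrite lt_min d10.
rewrite lt_min => /andP[/H1 h1 /H2 h2].
rewrite opprD addrACA; apply: le_lt_trans (normcD _ _) _.
by move: h1 h2; lra.
Qed.

Lemma ccont_affine c d : ccont (fun z => c + d * z).
Proof.
move=> z e e0; exists (e / (normc d + 1)) => [|w].
  by rewrite divr_gt0 // ltr_pwDr // normc_ge0.
rewrite opprD addrACA subrr add0r -mulrBr normcME.
rewrite ltr_pdivlMr ?ltr_pwDr ?normc_ge0 // => lt.
apply: le_lt_trans lt; rewrite mulrC ler_wpM2l ?normc_ge0 //.
by rewrite lerDl.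
Qed.

Lemma square_int_affine c d x y s : 0 <= s -> square_int (fun z => c + d * z) x y s = 0.
Proof.
move=> s0; rewrite /square_int /cint; case: c => c1 c2; case: d => d1 d2 /=.
have E : forall a (f : R -> R) (k m : R), f =1 (fun t => k + m * t) ->
    rint f a (a + s) = k * s + m * ((a + s) ^+ 2 - a ^+ 2) / 2.
  move=> a f k m /funext ->; rewrite rint_affine ?lerDl //.
  by rewrite [X in k * X](_ : _ = s) // addrC addKr.
rewrite (E x _ (c1 - d2 * y) d1); last by move=> t; ring.
rewrite (E x _ (c2 + d1 * y) d2); last by move=> t; ring.
rewrite (E y _ (c1 + d1 * (x + s)) (- d2)); last by move=> t; ring.
rewrite (E y _ (c2 + d2 * (x + s)) d1); last by move=> t; ring.
rewrite (E x _ (c1 - d2 * (y + s)) d1); last by move=> t; ring.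
rewrite (E x _ (c2 + d1 * (y + s)) d2); last by move=> t; ring.
rewrite (E y _ (c1 + d1 * x) (- d2)); last by move=> t; ring.
rewrite (E y _ (c2 + d2 * x) d1); last by move=> t; ring.
by simpc; congr (_ +i* _); ring.
Qed.

(** Goursat's nested squares as an induction principle: a square violating [P] has a quarter
    violating [P], and the successive quarters shrink to a point of the square, where the local
    hypothesis is contradicted. *)
Lemma square_bisection (P : R -> R -> R -> Prop) x y s : 0 < s ->
  (forall x y s, 0 < s -> P x y s -> P (x + s) y s -> P x (y + s) s ->
     P (x + s) (y + s) s -> P x y (s + s)) ->
  (forall z, in_square x y s z -> exists2 d : R, 0 < d & forall x' y' s' : R,
     0 < s' < d -> in_square x' y' s' z -> 
     [/\ x <= x', y <= y', x' + s' <= x + s & y' + s' <= y + s] -> P x' y' s') ->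
  P x y s.
Proof.
move=> s0 Padd Ploc; apply: contrapT => nP.
pose T := (R * R * R)%type.
pose good (t : T) := 0 < t.2 /\ ~ P t.1.1 t.1.2 t.2.
pose sub (t t' : T) := [/\ t.1.1 <= t'.1.1, t.1.2 <= t'.1.2,
   t'.1.1 + t'.2 <= t.1.1 + t.2, t'.1.2 + t'.2 <= t.1.2 + t.2 & t'.2 + t'.2 = t.2].
have step (t : T) : exists t', good t -> good t' /\ sub t t'.
  case: (pselect (good t)) => [[]|ng]; last by exists t.
  case: t => -[a b] r /= r0 nPt.
  pose h := r / 2; have h0 : 0 < h by rewrite divr_gt0.
  have rE : h + h = r by rewrite /h; field.
  apply: contrapT => nex; apply: nPt; rewrite -rE.
  have Q a' b' : (a' = a \/ a' = a + h) -> (b' = b \/ b' = b + h) -> P a' b' h.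
    move=> aE bE; apply: contrapT => nQ; apply: nex; exists (a', b', h) => _.
    split; first by [].
    by case: aE => ->; case: bE => ->; split => //=; move: h0 rE; lra.
  by apply: Padd => //; apply: Q; auto.
have [f fP] := choice step.
pose u n := iter n f (x, y, s).
have ug n : good (u n) by elim: n => [//|n /fP[]].
have us n : sub (u n) (u n.+1) by have [] := fP _ (ug n).
have usub n m : (n <= m)%N -> [/\ (u n).1.1 <= (u m).1.1, (u n).1.2 <= (u m).1.2,
   (u m).1.1 + (u m).2 <= (u n).1.1 + (u n).2 &
   (u m).1.2 + (u m).2 <= (u n).1.2 + (u n).2].
  elim: m => [|m IH]; first by rewrite leqn0 => /eqP ->.
  rewrite leq_eqVlt => /predU1P[<- //|]; rewrite ltnS => /IH[A1 A2 A3 A4].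
  have [B1 B2 B3 B4 _] := us m.
  by split; [exact: le_trans A1 B1|exact: le_trans A2 B2|
             exact: le_trans B3 A3|exact: le_trans B4 A4].
(* The supremum of the lower ends lies in all the nested intervals; this is used for each
   coordinate. *)
have lim (p : nat -> R) (q : nat -> R) : (forall n m, p n <= q m) ->
    exists X, forall n, p n <= X <= q n.
  move=> pq; exists (sup (range p)) => n.
  have hs : has_sup (range p).
    by split; [exists (p 0%N), 0%N|exists (q 0%N) => _ [m _ <-]].
  apply/andP; split; first by apply: ub_le_sup; [case: hs|exists n].
  by apply: ge_sup; [exists (p 0%N), 0%N|move=> _ [m _ <-]].
have [X Xb] : exists X, forall n, (u n).1.1 <= X <= (u n).1.1 + (u n).2.
  apply: lim => n m; have [p1 _ p2 _] := usub _ _ (leq_maxl n m).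
  have [q1 _ q2 _] := usub _ _ (leq_maxr n m).
  have [r0 _] := ug (maxn n m).
  by move: p1 q2 r0; lra.
have [Y Yb] : exists Y, forall n, (u n).1.2 <= Y <= (u n).1.2 + (u n).2.
  apply: lim => n m; have [_ p1 _ p2] := usub _ _ (leq_maxl n m).
  have [_ q1 _ q2] := usub _ _ (leq_maxr n m).
  have [r0 _] := ug (maxn n m).
  by move: p1 q2 r0; lra.
have zQ n : in_square (u n).1.1 (u n).1.2 (u n).2 (X +i* Y) by rewrite /in_square /= Xb Yb.
have [d d0 H] := Ploc _ (zQ 0%N).
(* The sides halve at each step, but decay like s / (n + 1) is enough to get below d. *)
have sz n : (u n).2 * n.+1%:R <= s.
  elim: n => [|n IH]; first by rewrite mulr1.
  have [_ _ _ _ e] := us n; have [r0 _] := ug n.+1.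
  apply: le_trans IH; rewrite -e mulrDl -[in leLHS]natr1 mulrDr mulr1 lerD2l.
  by rewrite ler_peMr ?(ltW r0) // ler1n.
have [n nd] : exists n, (u n).2 < d.
  exists (Num.bound (s / d)).
  have := archi_boundP (_ : 0 <= s / d); rewrite divr_ge0 ?(ltW s0) ?(ltW d0) //.
  move=> /(_ isT); rewrite ltr_pdivrMr // => lt.
  rewrite -(ltr_pM2r (_ : 0 < (Num.bound (s / d)).+1%:R)) ?ltr0n //.
  apply: le_lt_trans (sz _) _; apply: lt_le_trans lt _.
  by rewrite mulrC ler_pM2l // ler_nat.
have [r0 nPn] := ug n; apply: nPn; apply: H; first by rewrite r0.
  exact: zQ.
exact: (usub 0%N n (leq0n _)).
Qed.

(** Only points of [S] are tested, so that an integrand altered outside the square still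
    qualifies. *)
Definition cdiff_at (S : C -> Prop) g z := exists d : C, forall e : R, 0 < e ->
  exists2 r : R, 0 < r & forall w, S w -> normc (w - z) < r ->
    normc (g w - g z - d * (w - z)) <= e * normc (w - z).

(** The integral is shown to be at most e times the area for every e > 0. This bound is additive
    under bisection, and on a small square g differs by a small multiple of |w - z| from an affine
    function, whose contour integral vanishes. *)
Lemma goursat g x y s : 0 < s -> ccont g ->
  (forall z, in_square x y s z -> cdiff_at (fun w => in_square x y s w) g z) ->
  square_int g x y s = 0.
Proof.
move=> s0 cg dg; apply: normc_eq0; apply/eqP; rewrite eq_le normc_ge0 andbT.
apply/ler_addgt0Pl => e' e'0; rewrite addr0.
pose e := e' / s ^+ 2; have e0 : 0 < e by rewrite divr_gt0 ?exprn_gt0.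
suff : normc (square_int g x y s) <= e * s ^+ 2.
  by rewrite /e divfK // expf_neq0 // gt_eqF.
apply: (square_bisection (P := fun x y s => normc (square_int g x y s) <= e * s ^+ 2)) => //.
  move=> a b r r0 P1 P2 P3 P4; rewrite square_int_split ?(ltW r0) //.
  apply: le_trans (normcD _ _) _; apply: le_trans (lerD (normcD _ _) P4) _.
  apply: le_trans (lerD (lerD (normcD _ _) P3) (lexx _)) _.
  apply: le_trans (lerD (lerD (lerD P1 P2) (lexx _)) (lexx _)) _.
  by rewrite le_eqVlt; apply/orP; left; apply/eqP; ring.
move=> z zQ; have [d dz] := dg z zQ.
(* 16 is the 8 of [square_int_bound] times the 2 of |w - z| <= 2 t, valid on a square of side t
   containing z. *)
have e16 : 0 < e / 16 by rewrite divr_gt0.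
have [r r0 H] := dz _ e16.
exists (r / 2) => [|a b t /andP[t0 tr] zt [xa yb at_ bt]]; first by rewrite divr_gt0.
pose B w := (d * z - g z) + (- d) * w.
have -> : square_int g a b t = square_int (fun w => g w + B w) a b t.
  by rewrite square_intD ?square_int_affine ?(ltW t0) ?addr0 //; exact: ccont_affine.
have -> : e * t ^+ 2 = 8 * (e / 16 * (2 * t)) * t by field.
apply: square_int_bound; rewrite ?(ltW t0) //.
  by apply: ccontD => //; exact: ccont_affine.
move=> w wt _.
have -> : g w + B w = g w - g z - d * (w - z) by rewrite /B; ring.
have wz : normc (w - z) <= 2 * t.
  apply: le_trans (normc_ReIm _) _.
  move: wt zt; rewrite /in_square; case: (w) => w1 w2; case: (z) => z1 z2 /=.
  move=> /andP[/andP[? ?] /andP[? ?]] /andP[/andP[? ?] /andP[? ?]].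
  by rewrite mulr2n mulrDl mul1r lerD // ler_norml; apply/andP; split; lra.
apply: le_trans (H w _ _) _.
- exact: (in_square_sub wt).
- by apply: le_lt_trans wz _; rewrite mulrC -ltr_pdivlMr.
by rewrite ler_pM2l.
Qed.

End ContourIntegral.

(** * The value at the centre of a square, from the contour integral of h(z)/z *)

Section CauchyEstimate.
Import ComplexField.Normc.
Local Open Scope complex_scope.
Variable R : realType.
Local Notation C := (Cplx R).
Implicit Types (x y s a b e r : R) (z w c d : C) (f g h : C -> C).

Lemma posC (e : C) : 0 < e -> exists2 r : R, 0 < r & e = r%:C.
Proof.
case: e => a b; rewrite ltcE /= => /andP[/eqP -> a0].
by exists a.
Qed.

Lemma nbhs_normcP z (A : set C) :
  nbhs z A <-> exists2 r : R, 0 < r & forall w, normc (w - z) < r -> A w.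
Proof.
split=> [/nbhs_ballP[e /= /posC[r r0 ->] rA]|[r r0 rA]].
  exists r => // w wz; apply: rA.
  by rewrite -ball_normE /ball_ /= distrC; rewrite ltcR.
apply/nbhs_ballP; exists (r%:C : C); first by rewrite /= ltcR.
move=> w; rewrite -ball_normE /ball_ /= distrC => wz; apply: rA.
by rewrite -ltcR.
Qed.

Lemma cvg_normcP (T : Type) (F : set_system T) (FF : Filter F) (g : T -> C) c :
  (g @ F --> c) <-> forall e : R, 0 < e -> \forall t \near F, normc (g t - c) < e.
Proof.
split=> [gc e e0|H].
  have : nbhs c [set w | normc (w - c) < e] by apply/nbhs_normcP; exists e.
  by move/gc.
move=> A /nbhs_normcP[r r0 rA].
by apply: filterS (H r r0) => t /rA.
Qed.

Lemma continuous_normcP g z : {for z, continuous g} <->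
  forall e : R, 0 < e -> exists2 d : R, 0 < d &
    forall w, normc (w - z) < d -> normc (g w - g z) < e.
Proof.
have E := @cvg_normcP C (nbhs z) _ g (g z).
split=> [/E cg e e0|cg]; first exact: (nbhs_normcP _ _).1 (cg e e0).
apply/E => e /cg[d d0 H].
by apply: (nbhs_normcP _ _).2; exists d.
Qed.

Lemma ccontP g : ccont g <-> continuous g.
Proof. by split=> cg z; apply/continuous_normcP; exact: cg. Qed.

Lemma derivable_normc f z : derivable f z 1 ->
  forall e, 0 < e -> exists2 r : R, 0 < r & forall w, normc (w - z) < r ->
    normc (f w - f z - 'D_1 f z * (w - z)) <= e * normc (w - z).
Proof.
move=> df e e0.
have : (fun h : C => h^-1 *: (f (h *: 1 + z) - f z)) @ 0^' --> 'D_1 f z.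
  exact: df.
move=> /cvg_normcP/(_ e e0); rewrite near_withinE => /nbhs_normcP[r r0 H].
exists r => // w wz; have [->|wz0] := eqVneq w z.
  by rewrite !subrr mulr0 subrr normc0E mulr0.
have wz1 : w - z != 0 by rewrite subr_eq0.
have := H (w - z); rewrite subr0 => /(_ wz wz1).
rewrite /GRing.scale /= mulr1 subrK => /ltW le.
rewrite (_ : _ - _ = ((w - z)^-1 * (f w - f z) - 'D_1 f z) * (w - z)); last first.
  by field.
by rewrite normcME ler_wpM2r ?normc_ge0.
Qed.


Lemma ccontM g h : ccont g -> ccont h -> ccont (fun z => g z * h z).
Proof. by move=> /ccontP cg /ccontP ch; apply/ccontP => z; exact: (cvgM (cg z) (ch z)). Qed.

Lemma normc_dist z w : `|normc z - normc w| <= normc (z - w).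
Proof.
rewrite ler_norml; apply/andP; split.
  by have := normcD (w - z) z; rewrite subrK -(normcNE (w - z)) opprB; lra.
by have := normcD (z - w) w; rewrite subrK; lra.
Qed.

(* Continuous on all of C, and equal to 1/z for |z| >= e. *)
Definition cutinv e z : C :=
  conjc z * ((Num.max (normc z) e)^-1)%:C * ((Num.max (normc z) e)^-1)%:C.

Lemma ccont_cutinv e : 0 < e -> ccont (cutinv e).
Proof.
move=> e0.
have cc : ccont (fun z => conjc z).
  move=> z d d0; exists d => // w; rewrite -rmorphB /=.
  by case: (w - z) => a b /=; rewrite sqrrN.
have cm : ccont (fun z => ((Num.max (normc z) e)^-1)%:C).
  (* The function 1 / max(|z|, e) is Lipschitz with constant 1 / e^2. *)
  move=> z d d0; exists (d * e ^+ 2) => [|w wz]; first by rewrite mulr_gt0 ?exprn_gt0.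
  rewrite -rmorphB normc_real.
  set p := Num.max (normc w) e; set q := Num.max (normc z) e.
  have pe : e <= p by rewrite le_max lexx orbT.
  have qe : e <= q by rewrite le_max lexx orbT.
  have p0 := lt_le_trans e0 pe; have q0 := lt_le_trans e0 qe.
  have pq : `|q - p| <= normc (w - z).
    apply: le_trans (normc_dist w z); rewrite distrC /p /q.
    rewrite ler_norml /Num.max.
    case: (ltP (normc w) e) => h1; case: (ltP (normc z) e) => h2.
    - by rewrite subrr lerNl oppr0 normr_ge0.
    - rewrite ltr0_norm; last by lra.
      by apply/andP; split; lra.
    - rewrite gtr0_norm; last by lra.
      by apply/andP; split; lra.
    - by rewrite -ler_norml.
  rewrite (_ : p^-1 - q^-1 = (q - p) / (p * q)); last by field; rewrite ?gt_eqF.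
  rewrite normrM normfV ltr_pdivrMr ?normr_gt0 ?mulf_neq0 ?gt_eqF //.
  apply: le_lt_trans pq _; apply: lt_le_trans wz _.
  rewrite ler_pM2l // gtr0_norm ?mulr_gt0 // expr2.
  by apply: ler_pM => //; exact: ltW.
exact: ccontM (ccontM cc cm) cm.
Qed.

Lemma normc_sqr z : normc z ^+ 2 = complex.Re z ^+ 2 + complex.Im z ^+ 2.
Proof. by case: z => a b /=; rewrite sqr_sqrtr // addr_ge0 ?sqr_ge0. Qed.

Lemma cutinvE e z : 0 < e -> e <= normc z -> cutinv e z = z^-1.
Proof.
move=> e0 ez; rewrite /cutinv max_l //.
have z0 : normc z != 0 by rewrite gt_eqF // (lt_le_trans e0).
have zn0 : z != 0 by apply: contra_neq z0 => ->; rewrite normc0E.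
have zz : z * conjc z = (normc z)%:C * (normc z)%:C.
  rewrite -rmorphM /= -expr2 normc_sqr.
  by case: (z) => a b /=; simpc; congr (_ +i* _); ring.
apply: (mulfI zn0); rewrite mulrA mulrA zz mulfV // fmorphV.
have zc0 : (normc z)%:C != 0 :> C by rewrite (inj_eq (@complexI R)).
by field.
Qed.

Lemma normc_cutinv e z : 0 < e -> normc (cutinv e z) <= e^-1.
Proof.
move=> e0; rewrite /cutinv !normcME !normc_real.
have -> : normc (conjc z) = normc z by case: (z) => a b /=; rewrite sqrrN.
set m := Num.max _ _.
have me : e <= m by rewrite le_max lexx orbT.
have m0 := lt_le_trans e0 me.
have mz : normc z <= m by rewrite le_max lexx.
rewrite ger0_norm ?invr_ge0 ?(ltW m0) //.
apply: (@le_trans _ _ m^-1); last by rewrite lef_pV2.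
by rewrite ler_piMl ?invr_ge0 ?(ltW m0) // ler_pdivrMr // mul1r.
Qed.

(** The exact value is 2 pi i, but 4 suffices and needs no arctangent. On each side, of length 2 e,
    the part of the integrand that contributes to the imaginary part is e / (t^2 + e^2) up to sign,
    which is at least 1 / (2 e); so each side contributes at least 1. *)
Lemma square_int_cutinv e : 0 < e -> 4 <= normc (square_int (cutinv e) (- e) (- e) (e + e)).
Proof.
have lin (i1 i2 i3 i4 : R) : 1 <= i1 -> 1 <= i2 -> i3 <= -1 -> i4 <= -1 ->
    4 <= i1 + i2 - i3 - i4 by lra.
move=> e0; apply: le_trans (ler_abs_Im _); apply: le_trans (ler_norm _).
have cc := ccont_cutinv e0.
have e1 : - e <= - e + (e + e) by lra.
have kE a b : e <= `|a| \/ e <= `|b| ->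
    cutinv e (a +i* b) = (a / (a ^+ 2 + b ^+ 2)) +i* (- (b / (a ^+ 2 + b ^+ 2))).
  move=> h; rewrite cutinvE //.
  case: h => h; first exact: (le_trans h (ler_abs_Re (a +i* b))).
  exact: (le_trans h (ler_abs_Im (a +i* b))).
have ee : e <= `|e| by rewrite ler_norm.
have ee' : e <= `|- e| by rewrite normrN ler_norm.
have -> : square_int (cutinv e) (- e) (- e) (e + e) =
   cint (cutinv e) (horiz (- e)) (- e) e + 'i * cint (cutinv e) (vert e) (- e) e
  - cint (cutinv e) (horiz e) (- e) e - 'i * cint (cutinv e) (vert (- e)) (- e) e.
  by rewrite /square_int (_ : - e + (e + e) = e) //; ring.
have ImE z1 z2 z3 z4 : complex.Im (z1 + 'i * z2 - z3 - 'i * z4) =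
    complex.Im z1 + complex.Re z2 - complex.Im z3 - complex.Re z4.
  by case: z1 z2 z3 z4 => [? ?] [? ?] [? ?] [? ?] /=; ring.
rewrite ImE {ImE}.
have H (phi : R -> R) : continuous phi ->
    (forall t, - e <= t <= e -> phi t = e / (t ^+ 2 + e ^+ 2)) -> 1 <= rint phi (- e) e.
  move=> cphi phiE; have [|t te ->] := rint_mean cphi (_ : - e <= e); first by lra.
  rewrite phiE // mulrAC ler_pdivlMr; last by rewrite ltr_wpDl ?sqr_ge0 ?exprn_gt0.
  have : t ^+ 2 <= e ^+ 2 by case/andP: te => ? ?; nra.
  by lra.
have H' (phi : R -> R) : continuous phi ->
    (forall t, - e <= t <= e -> phi t = - (e / (t ^+ 2 + e ^+ 2))) -> rint phi (- e) e <= - 1.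
  move=> cphi phiE; have [|t te ->] := rint_mean cphi (_ : - e <= e); first by lra.
  rewrite phiE // lerNr mulNr opprK mulrAC ler_pdivlMr; last by rewrite ltr_wpDl ?sqr_ge0 ?exprn_gt0.
  have : t ^+ 2 <= e ^+ 2 by case/andP: te => ? ?; nra.
  by lra.
have K1 := H _ (continuous_Im_line cc (horiz_isom (- e))).
have K2 := H _ (continuous_Re_line cc (vert_isom e)).
have K3 := H' _ (continuous_Im_line cc (horiz_isom e)).
have K4 := H' _ (continuous_Re_line cc (vert_isom (- e))).
have {}K1 : 1 <= rint (fun t => complex.Im (cutinv e (horiz (- e) t))) (- e) e.
  by apply: K1 => t _; rewrite kE /= ?mulNr ?opprK ?sqrrN //; right.
have {}K2 : 1 <= rint (fun t => complex.Re (cutinv e (vert e t))) (- e) e.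
  by apply: K2 => t _; rewrite kE /= 1?addrC //; left.
have {}K3 : rint (fun t => complex.Im (cutinv e (horiz e t))) (- e) e <= -1.
  by apply: K3 => t _; rewrite kE /= ?mulNr //; right.
have {}K4 : rint (fun t => complex.Re (cutinv e (vert (- e) t))) (- e) e <= -1.
  by apply: K4 => t _; rewrite kE /= ?mulNr ?sqrrN 1?addrC //; left.
exact: lin.
Qed.

(** In the 4 by 4 grid of cells of side q, the twelve cells of the outer ring contribute nothing,
    and the four inner ones form the concentric square of half the side. *)
Lemma square_int_shrink g (q : R) : ccont g -> 0 <= q ->
  (forall a b, - (q + q) <= a <= q -> - (q + q) <= b <= q ->
     [\/ a = - (q + q), a = q, b = - (q + q) | b = q] -> square_int g a b q = 0) ->
  square_int g (- (q + q)) (- (q + q)) ((q + q) + (q + q)) =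
  square_int g (- q) (- q) (q + q).
Proof.
move=> cg q0 F.
have qq0 : 0 <= q + q by rewrite addr_ge0.
have lo : - (q + q) <= - (q + q) <= q by apply/andP; split; lra.
have li : - (q + q) <= - q <= q by apply/andP; split; lra.
have lz : - (q + q) <= 0 <= q by apply/andP; split; lra.
have lq : - (q + q) <= q <= q by apply/andP; split; lra.
have S a b : square_int g a b (q + q) = square_int g a b q + square_int g (a + q) b q + square_int g a (b + q) q
   + square_int g (a + q) (b + q) q by exact: square_int_split.
rewrite (@square_int_split R g _ _ (q + q) cg qq0) addNr !S !add0r.
have -> : - (q + q) + q = - q by ring.
rewrite addNr.
rewrite !(F (- (q + q)) _ lo) //; try by [constructor 1].
rewrite !(F _ (- (q + q))) //; try by [constructor 3].
rewrite !(F q _ lq) //; try by [constructor 2].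
rewrite !(F _ q) //; try by [constructor 4].
by ring.
Qed.

Lemma half_pow_gt0 r n : 0 < r -> 0 < r / 2 ^+ n.
Proof. by move=> r0; rewrite divr_gt0 // exprn_gt0. Qed.

Lemma half_pow_le r n m : 0 < r -> (n <= m)%N -> r / 2 ^+ m <= r / 2 ^+ n.
Proof.
by move=> r0 nm; rewrite ler_pM2l // lef_pV2 ?posrE ?exprn_gt0 // ler_eXn2l // ltr1n.
Qed.

Lemma half_pow_lt r (d : R) : 0 < r -> 0 < d -> exists n, r / 2 ^+ n < d.
Proof.
move=> r0 d0; exists (Num.bound (r / d)).
have := archi_boundP (_ : 0 <= r / d); rewrite divr_ge0 ?(ltW r0) ?(ltW d0) //.
move=> /(_ isT); rewrite ltr_pdivrMr // => lt.
rewrite ltr_pdivrMr ?exprn_gt0 //; apply: lt_trans lt _.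
by rewrite mulrC ltr_pM2l // -natrX ltr_nat ltn_expl.
Qed.

(** A 1-Lipschitz retraction of the line onto [-r, r]; applied to both coordinates it extends a
    function continuous on the centred square to the whole plane. *)
Definition clamp r (t : R) := if t < - r then - r else if r < t then r else t.

Lemma clampP r t : [\/ t < - r /\ clamp r t = - r, r < t /\ clamp r t = r |
  [/\ - r <= t, t <= r & clamp r t = t]].
Proof.
rewrite /clamp; case: ltP => ?; first by constructor 1.
by case: ltP => ?; [constructor 2|constructor 3].
Qed.

Lemma clampE r t : 0 < r -> - r <= t <= - r + (r + r) -> clamp r t = t.
Proof. by move=> r0 /andP[? ?]; case: (clampP r t) => [[? ->]|[? ->]|[? ? ->]] //; lra. Qed.

Lemma clampI r t : 0 < r -> - r <= clamp r t <= - r + (r + r).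
Proof.
by move=> r0; case: (clampP r t) => [[? ->]|[? ->]|[? ? ->]]; apply/andP; split; lra.
Qed.

Lemma clampL r s t : 0 < r -> `|clamp r s - clamp r t| <= `|s - t|.
Proof.
move=> r0; case: (ger0P (s - t)) => ?; rewrite ler_norml;
case: (clampP r s) => [[? ->]|[? ->]|[? ? ->]];
case: (clampP r t) => [[? ->]|[? ->]|[? ? ->]]; apply/andP; split; lra.
Qed.

(* The contour integral of h(z)/z over a square centred at 0 is unchanged when the
   square is halved, by Goursat on the twelve subsquares that avoid 0. *)
Lemma center_bound_norm h r (M : R) : 0 < r ->
  (forall z, in_square (- r) (- r) (r + r) z -> {for z, continuous h}) ->
  (forall z, in_square (- r) (- r) (r + r) z -> z != 0 -> derivable h z 1) ->
  (forall z, in_square (- r) (- r) (r + r) z -> r <= normc z -> normc (h z) <= M) ->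
  h 0 = 1 -> 1 <= 4 * M.
Proof.
move=> r0 ch dh hM h01.
(* The balance of constants: i0 is the integral of 1/z, at least 4; i1 is the outer integral, at
   most 8 (M / r) (2 r) = 16 M; i2 is the inner error, at most 8 (e' / 4) (1 / e) (2 e) = 4 e'. *)
have fin (e' i0 i1 i2 : R) : 4 <= i0 -> i1 <= 16 * M -> i2 <= 4 * e' ->
    i0 <= i1 + i2 -> 1 <= 4 * M + e' by lra.
have inside (rho a : R) : rho <= r -> - rho <= a -> a <= rho / 2 ->
    - r <= a /\ a + rho / 2 <= r by split; lra.
pose H z := h (clamp r (complex.Re z) +i* clamp r (complex.Im z)).
have HE z : in_square (- r) (- r) (r + r) z -> H z = h z.
  by case: z => a b; rewrite /in_square /H /= => /andP[/(clampE r0) -> /(clampE r0) ->].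
have cH : ccont H.
  move=> z e e0.
  pose z' : C := clamp r (complex.Re z) +i* clamp r (complex.Im z).
  have z'Q : in_square (- r) (- r) (r + r) z' by rewrite /in_square /= !clampI //.
  have [d d0 Hd] := (continuous_normcP h z').1 (ch _ z'Q) e e0.
  exists (d / 2) => [|w wz]; first by rewrite divr_gt0.
  apply: Hd; apply: le_lt_trans (normc_ReIm _) _.
  have := ler_abs_Re (w - z); have := ler_abs_Im (w - z).
  have := clampL (complex.Re w) (complex.Re z) r0.
  have := clampL (complex.Im w) (complex.Im z) r0.
  have -> : complex.Re (w - z) = complex.Re w - complex.Re z.
    by case: (w) (z) => [? ?] [? ?].
  have -> : complex.Im (w - z) = complex.Im w - complex.Im z.
    by case: (w) (z) => [? ?] [? ?].
  by move: wz => /=; lra.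
apply/ler_addgt0Pr => e' e'0.
have Q0 : in_square (- r) (- r) (r + r) 0 by rewrite /in_square /=; apply/andP; split; lra.
have e4 : 0 < e' / 4 by rewrite divr_gt0.
have [d d0 hd] := (continuous_normcP h 0).1 (ch 0 Q0) _ e4.
have d20 : 0 < d / 2 by rewrite divr_gt0.
have [N Nd] := half_pow_lt r0 d20.
(* The radius is r halved N times, so that N steps of shrinking reach it, and it is small enough
   that |h - 1| < e' / 4 on the final square. *)
have [e [[e0 er ed eN] eE]] : exists e, [/\ 0 < e, e <= r, e < d / 2 &
    forall n, (n <= N)%N -> e <= r / 2 ^+ n] /\ e = r / 2 ^+ N.
  exists (r / 2 ^+ N); split=> //; split=> //; first exact: half_pow_gt0.
    by have := half_pow_le r0 (leq0n N); rewrite expr0 divr1.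
  by move=> n; exact: half_pow_le.
pose g z := H z * cutinv e z.
have ck := ccont_cutinv e0.
have cg : ccont g by exact: ccontM.
have gz a b t : 0 < t -> - r <= a -> - r <= b -> a + t <= r -> b + t <= r ->
    (forall z, in_square a b t z -> e <= normc z) -> square_int g a b t = 0.
  move=> t0 ra rb ar br ez; apply: goursat => // z zQ.
  have rr : - r + (r + r) = r by ring.
  have sub w : in_square a b t w -> in_square (- r) (- r) (r + r) w.
    by move=> wQ; apply: (in_square_sub wQ); rewrite rr.
  have gE w : in_square a b t w -> g w = h w * w^-1.
    by move=> wQ; rewrite /g HE ?cutinvE //; [exact: ez|exact: sub].
  have zn0 : z != 0.
    by apply: contraTneq (ez _ zQ) => ->; rewrite normc0E -ltNge.
  have dg : derivable (fun w => h w * w^-1) z 1.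
    apply: derivableM; first by apply: dh => //; exact: sub.
    by apply: derivableV => //; exact: derivable_id.
  exists ('D_1 (fun w => h w * w^-1) z) => u u0.
  have [p p0 Hp] := derivable_normc dg u0.
  by exists p => // w wQ wz; rewrite !gE //; exact: Hp.
have step rho : 0 < rho -> rho <= r -> e <= rho / 2 ->
    square_int g (- rho) (- rho) (rho + rho) =
    square_int g (- (rho / 2)) (- (rho / 2)) (rho / 2 + rho / 2).
  move=> rho0 rhor erho.
  have F a b : - rho <= a <= rho / 2 -> - rho <= b <= rho / 2 ->
      [\/ a = - rho, a = rho / 2, b = - rho | b = rho / 2] ->
      square_int g a b (rho / 2) = 0.
    move=> /andP[a1 a2] /andP[b1 b2] ab.
    have [a3 a4] := inside _ _ rhor a1 a2; have [b3 b4] := inside _ _ rhor b1 b2.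
    apply: (gz _ _ _ _ a3 b3 a4 b4); first by rewrite divr_gt0.
    move=> z; rewrite /in_square => /andP[/andP[? ?] /andP[? ?]].
    apply: le_trans erho _.
    case: ab => abE; subst.
    - by apply: le_trans (ler_abs_Re z); rewrite -normrN; apply: le_trans (ler_norm _); lra.
    - by apply: le_trans (ler_abs_Re z); apply: le_trans (ler_norm _); lra.
    - by apply: le_trans (ler_abs_Im z); rewrite -normrN; apply: le_trans (ler_norm _); lra.
    - by apply: le_trans (ler_abs_Im z); apply: le_trans (ler_norm _); lra.
  have rE : rho = rho / 2 + rho / 2 by field.
  rewrite [in LHS]rE; apply: square_int_shrink; rewrite -?rE ?divr_ge0 ?(ltW rho0) //.
have tel n : (n <= N)%N ->
    square_int g (- r) (- r) (r + r) = square_int g (- (r / 2 ^+ n)) (- (r / 2 ^+ n)) (r / 2 ^+ n + r / 2 ^+ n).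
  elim: n => [|n IH] nN; first by rewrite expr0 divr1.
  have hE : r / 2 ^+ n.+1 = r / 2 ^+ n / 2 by rewrite exprSr invfM mulrA.
  rewrite (IH (ltnW nN)) hE; apply: step; first exact: half_pow_gt0.
    by have := half_pow_le r0 (leq0n n); rewrite expr0 divr1.
  by rewrite -hE; exact: eN.
have outer : normc (square_int g (- r) (- r) (r + r)) <= 16 * M.
  have -> : 16 * M = 8 * (M * r^-1) * (r + r) by field; rewrite gt_eqF.
  apply: square_int_bound => //; first by rewrite addr_ge0 // ltW.
  move=> z zQ zb.
  have rz : r <= normc z.
    case/or4P: zb => /eqP zE.
    - by apply: le_trans (ler_abs_Re z); rewrite zE normrN ler_norm.
    - apply: le_trans (ler_abs_Re z); apply: le_trans (ler_norm _); rewrite zE; lra.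
    - by apply: le_trans (ler_abs_Im z); rewrite zE normrN ler_norm.
    - apply: le_trans (ler_abs_Im z); apply: le_trans (ler_norm _); rewrite zE; lra.
  rewrite /g HE // cutinvE //; last exact: le_trans rz.
  rewrite normcME normcVE; apply: ler_pM; rewrite ?invr_ge0 ?normc_ge0 //.
    exact: hM.
  by rewrite lef_pV2 // posrE // (lt_le_trans r0).
(* On the final square g splits as 1/z, whose integral is bounded below, plus this small
   remainder. *)
pose E z := (H z - 1) * cutinv e z.
have cE : ccont E.
  apply: ccontM => //; apply: ccontD => //.
  by move=> z p p0; exists 1 => // w _; rewrite subrr normc0E.
have inner : normc (square_int E (- e) (- e) (e + e)) <= 4 * e'.
  have -> : 4 * e' = 8 * (e' / 4 * e^-1) * (e + e) by field; rewrite gt_eqF.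
  apply: square_int_bound => //; first by rewrite addr_ge0 // ltW.
  move=> z zQ _; rewrite /E normcME; apply: ler_pM; rewrite ?normc_ge0 //.
    move: zQ; rewrite in_square_center => /andP[z1 z2].
    rewrite HE; last by rewrite in_square_center (le_trans z1) // (le_trans z2).
    rewrite -h01; apply/ltW/hd; rewrite subr0.
    apply: le_lt_trans (normc_ReIm _) _; apply: le_lt_trans (lerD z1 z2) _.
    rewrite [ltRHS]splitr; exact: ltrD.
  exact: normc_cutinv.
have ee0 : 0 <= e + e by rewrite addr_ge0 // ltW.
have gE : g = (fun z => cutinv e z + E z).
  by apply: funext => z; rewrite /g /E; ring.
have tri : normc (square_int (cutinv e) (- e) (- e) (e + e)) <=
    normc (square_int g (- r) (- r) (r + r)) + normc (square_int E (- e) (- e) (e + e)).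
  rewrite (tel N (leqnn N)) -eE gE (@square_intD R _ _ (- e) (- e) (e + e) ck cE ee0).
  have := normcD (square_int (cutinv e) (- e) (- e) (e + e) + square_int E (- e) (- e) (e + e))
               (- square_int E (- e) (- e) (e + e)).
  by rewrite addrK normcNE.
exact: fin (square_int_cutinv e0) outer inner tri.
Qed.

End CauchyEstimate.

(** * Cauchy estimates *)

Section CauchyLipschitz.
Import ComplexField.Normc.
Local Open Scope complex_scope.
Variable R : realType.
Local Notation C := (Cplx R).
Implicit Types (x y s a b e r : R) (z w c d m : C) (f g h : C -> C).

(** A maximum principle with constant 4 in place of 1, obtained by normalizing h(0) to 1. *)
Lemma center_bound h r (M : R) : 0 < r ->
  (forall z, in_square (- r) (- r) (r + r) z -> {for z, continuous h}) ->
  (forall z, in_square (- r) (- r) (r + r) z -> z != 0 -> derivable h z 1) ->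
  (forall z, in_square (- r) (- r) (r + r) z -> r <= normc z -> normc (h z) <= M) ->
  normc (h 0) <= 4 * M.
Proof.
move=> r0 ch dh hM.
have [->|h00] := eqVneq (h 0) 0.
  rewrite normc0E mulr_ge0 //; apply: le_trans (hM r%:C _ _).
  - exact: normc_ge0.
  - by rewrite /in_square /=; apply/andP; split; apply/andP; split; lra.
  - by rewrite normc_real ler_norm.
have n0 := normc_gt0 h00.
suff : 1 <= 4 * (M / normc (h 0)) by rewrite mulrA ler_pdivlMr // mul1r.
apply: (@center_bound_norm R (fun z => h z / h 0) r _ r0).
- by move=> z /ch cz; exact: cvgM cz (cvg_cst _).
- by move=> z zQ z0; apply: derivableM; [exact: dh|exact: derivable_cst].
- move=> z zQ zr; rewrite normcME normcVE ler_wpM2r ?invr_ge0 ?(ltW n0) //.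
  exact: hM.
- exact: mulfV.
Qed.

Lemma derivable_continuous f z : derivable f z 1 -> {for z, continuous f}.
Proof. by move=> df; exact/differentiable_continuous/derivable1_diffP. Qed.

(* [center_bound] for the difference quotient of f at m, which is continuous but
   not known to be differentiable at m. *)
Lemma deriv_bound f m r (M : R) : 0 < r ->
  (forall z, in_square (- r) (- r) (r + r) z -> derivable f (z + m) 1) ->
  (forall z, in_square (- r) (- r) (r + r) z -> normc (f (z + m)) <= M) ->
  normc ('D_1 f m) <= 8 * (M / r).
Proof.
move=> r0 df fM.
have Q0 : in_square (- r) (- r) (r + r) (0 : C).
  by rewrite /in_square /=; apply/andP; split; apply/andP; split; lra.
pose k z := (f (z + m) - f m) / z.
pose h z := if z == 0 then 'D_1 f m else k z.
have -> : 'D_1 f m = h 0 by rewrite /h eqxx.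
(* On |z| >= r the difference quotient is at most 2 M / r, and [center_bound] costs a factor 4. *)
have -> : 8 * (M / r) = 4 * (2 * M / r) by ring.
have hk z : z != 0 -> \near z, h z = k z.
  move=> z0; near=> w; rewrite /h ifN_eq //; near: w.
  apply: (nbhs_normcP _ _).2; exists (normc z); first exact: normc_gt0.
  move=> w; apply: contraTneq => ->.
  by rewrite sub0r normcNE ltxx.
have dh z : in_square (- r) (- r) (r + r) z -> z != 0 -> derivable h z 1.
  move=> zQ z0; have dk : derivable k z 1.
    apply: derivableM; last by apply: derivableV => //; exact: derivable_id.
    apply: derivableB; last exact: derivable_cst.
    by apply/derivable1_diffP/differentiable_comp;
       [apply: differentiableD => //; exact: differentiable_cst |
        exact/derivable1_diffP/df].
  apply: near_eq_derivable dk.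
  by apply: filterS (hk z z0) => w ->.
apply: (@center_bound h r (2 * M / r) r0).
- move=> z zQ; have [z0|z0] := eqVneq z 0; last first.
    exact: (derivable_continuous (dh z zQ z0)).
  rewrite z0; apply/continuous_normcP => e e0.
  have e2 : 0 < e / 2 by rewrite divr_gt0.
  have := df _ Q0; rewrite add0r => /derivable_normc/(_ _ e2)[d d0 Hd].
  exists d => // w; rewrite subr0 => wd.
  have [->|w0] := eqVneq w 0; first by rewrite subrr normc0E.
  have -> : h 0 = 'D_1 f m by rewrite /h eqxx.
  have -> : h w = k w by rewrite /h ifN_eq.
  have := Hd (w + m); rewrite addrK => /(_ wd) le.
  have wn := normc_gt0 w0.
  rewrite -(ltr_pM2r wn) -normcME.
  rewrite (_ : _ * w = f (w + m) - f m - 'D_1 f m * w); last by rewrite /k; field.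
  by apply: le_lt_trans le _; rewrite ltr_pM2r //; lra.
- exact: dh.
- move=> z zQ rz; rewrite /h ifN_eq; last first.
    by apply: contraTneq rz => ->; rewrite normc0E -ltNge.
  rewrite /k normcME normcVE; apply: ler_pM; rewrite ?invr_ge0 ?normc_ge0 //.
    apply: le_trans (normcD _ _) _; rewrite normcNE mulr2n mulrDl mul1r lerD ?fM //.
    by have := fM _ Q0; rewrite add0r.
  by rewrite lef_pV2 // posrE // (lt_le_trans r0).
Unshelve. all: by end_near. Qed.

Lemma is_derive_norm (phi : R -> R) (t l : R) :
  (forall e, 0 < e -> exists2 d : R, 0 < d & forall s, `|s - t| < d ->
     `|phi s - phi t - l * (s - t)| <= e * `|s - t|) ->
  is_derive t 1 phi l.
Proof.
move=> H.
have L : (fun h : R => h^-1 *: (phi (h *: 1 + t) - phi t)) @ 0^' --> l.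
  apply/cvgrPdist_le => e e0; have [d d0 Hd] := H e e0.
  rewrite near_withinE; apply/nbhs_ballP; exists d => // h.
  rewrite /ball /= sub0r normrN => hd h0.
  have := Hd (h + t); rewrite addrK => /(_ hd) le.
  rewrite /GRing.scale /= mulr1 -(ler_pM2r (_ : 0 < `|h|)) ?normr_gt0 // -normrM.
  apply: le_trans le; rewrite -normrN.
  by rewrite le_eqVlt; apply/orP; left; apply/eqP; congr (`|_|); field.
by split; [apply/cvg_ex; exists l|exact: cvg_lim].
Qed.

(** Around a point of the half disc, the square of half-side rho / 4 stays in the disc, so
    [deriv_bound] gives |f'| <= 32 M / rho there. The mean value theorem on the segment from w to z,
    applied to real and imaginary parts separately, doubles this to 64. *)
Lemma cauchy_lipschitz f (rho M : R) z w : 0 < rho ->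
  (forall z, normc z <= rho -> derivable f z 1) ->
  (forall z, normc z <= rho -> normc (f z) <= M) ->
  normc z <= rho / 2 -> normc w <= rho / 2 ->
  normc (f z - f w) <= 64 * (M / rho) * normc (z - w).
Proof.
move=> rho0 df fM zr wr.
pose l (t : R) : C := w + t%:C * (z - w).
have lr (t : R) : 0 <= t <= 1 -> normc (l t) <= rho / 2.
  move=> /andP[t0 t1]; rewrite (_ : l t = (1 - t)%:C * w + t%:C * z); last first.
    by rewrite /l rmorphB rmorph1; ring.
  apply: le_trans (normcD _ _) _; rewrite !normcME !normc_real.
  rewrite !ger0_norm ?subr_ge0 //.
  have := ler_wpM2l t0 zr; have := ler_wpM2l (_ : 0 <= 1 - t) wr.
  by rewrite subr_ge0 => /(_ t1); lra.
have db m : normc m <= rho / 2 -> normc ('D_1 f m) <= 32 * (M / rho).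
  move=> mr; have r4 : 0 < rho / 4 by rewrite divr_gt0.
  have sub u : in_square (- (rho / 4)) (- (rho / 4)) (rho / 4 + rho / 4) u -> normc (u + m) <= rho.
    rewrite /in_square => /andP[/andP[? ?] /andP[? ?]].
    apply: le_trans (normcD _ _) _.
    have := normc_ReIm u.
    have : `|complex.Re u| <= rho / 4 by rewrite ler_norml; apply/andP; split; lra.
    have : `|complex.Im u| <= rho / 4 by rewrite ler_norml; apply/andP; split; lra.
    by lra.
  have -> : 32 * (M / rho) = 8 * (M / (rho / 4)) by field; rewrite gt_eqF.
  by apply: deriv_bound => // u /sub ?; [exact: df|exact: fM].
pose K := 32 * (M / rho) * normc (z - w).
have lD s t : l s - l t = (s - t)%:C * (z - w) by rewrite /l rmorphB; ring.
have D (t : R) : 0 <= t <= 1 -> forall e, 0 < e -> exists2 d : R, 0 < d & forall s, `|s - t| < d ->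
     normc (f (l s) - f (l t) - 'D_1 f (l t) * (z - w) * (s - t)%:C) <= e * `|s - t|.
  move=> t01 e e0.
  (* The added 1 keeps the divisions meaningful when z = w. *)
  have n1 : 0 < normc (z - w) + 1 by rewrite ltr_wpDl // normc_ge0.
  have lt1 : normc (l t) <= rho by have := lr t t01; lra.
  have e'0 : 0 < e / (normc (z - w) + 1) by rewrite divr_gt0.
  have [d d0 Hd] := derivable_normc (df _ lt1) e'0.
  exists (d / (normc (z - w) + 1)) => [|s st]; first by rewrite divr_gt0.
  have nE : normc (l s - l t) = `|s - t| * normc (z - w).
    by rewrite lD normcME normc_real.
  have := Hd (l s); rewrite nE => H.
  rewrite -mulrA [_ * _%:C]mulrC -lD; apply: le_trans (H _) _.
    move: st; rewrite ltr_pdivlMr //; apply: le_lt_trans.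
    by rewrite ler_wpM2l // lerDl.
  have q : e / (normc (z - w) + 1) * normc (z - w) <= e.
    by rewrite mulrAC ler_pdivrMr // ler_pM2l // lerDl.
  by rewrite [X in _ * X]mulrC mulrA ler_wpM2r.
have ReD (u v : C) : complex.Re (u - v) = complex.Re u - complex.Re v.
  by case: u v => [? ?] [? ?].
have ImD (u v : C) : complex.Im (u - v) = complex.Im u - complex.Im v.
  by case: u v => [? ?] [? ?].
have ReM (u : C) (a : R) : complex.Re (u * a%:C) = complex.Re u * a.
  by case: u => ? ? /=; rewrite mulr0 subr0.
have ImM (u : C) (a : R) : complex.Im (u * a%:C) = complex.Im u * a.
  by case: u => ? ? /=; rewrite mulr0 add0r.
have l0 : l 0 = w by rewrite /l rmorph0 mul0r addr0.
have l1 : l 1 = z by rewrite /l rmorph1 mul1r addrC subrK.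
have KE m : normc m <= rho / 2 -> normc ('D_1 f m * (z - w)) <= K.
  by move=> mr; rewrite normcME ler_wpM2r ?normc_ge0 // db.
have dRe (t : R) : 0 <= t <= 1 ->
    is_derive t 1 (fun t => complex.Re (f (l t))) (complex.Re ('D_1 f (l t) * (z - w))).
  move=> t01; apply: is_derive_norm => e /(D t t01 e)[d d0 Hd].
  exists d => // s /Hd; apply: le_trans.
  by rewrite -ReM -!ReD; exact: ler_abs_Re.
have dIm (t : R) : 0 <= t <= 1 ->
    is_derive t 1 (fun t => complex.Im (f (l t))) (complex.Im ('D_1 f (l t) * (z - w))).
  move=> t01; apply: is_derive_norm => e /(D t t01 e)[d d0 Hd].
  exists d => // s /Hd; apply: le_trans.
  by rewrite -ImM -!ImD; exact: ler_abs_Im.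
have mv (phi dphi : R -> R) : (forall t : R, 0 <= t <= 1 -> is_derive t 1 phi (dphi t)) ->
    (forall t : R, 0 <= t <= 1 -> `|dphi t| <= K) -> `|phi 1 - phi 0| <= K.
  move=> dp bp.
  have d1 (t : R) : t \in `]0, 1[ -> is_derive t 1 phi (dphi t).
    by rewrite in_itv /= => /andP[/ltW t0 /ltW t1]; apply: dp; rewrite t0.
  have cp : {within `[0, 1], continuous phi}.
    by apply: derivable_within_continuous => t; rewrite in_itv /= => /dp[].
  have [c c01 ->] := MVT_segment ler01 d1 cp.
  by rewrite subr0 mulr1; apply: bp; move: c01; rewrite in_itv.
have HRe := mv _ _ dRe (fun t t01 => le_trans (ler_abs_Re _) (KE _ (lr t t01))).
have HIm := mv _ _ dIm (fun t t01 => le_trans (ler_abs_Im _) (KE _ (lr t t01))).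
apply: le_trans (normc_ReIm _) _; rewrite ReD ImD.
move: HRe HIm; rewrite l0 l1 => HRe HIm; apply: le_trans (lerD HRe HIm) _.
by rewrite /K le_eqVlt; apply/orP; left; apply/eqP; ring.
Qed.

End CauchyLipschitz.

(** * Strict differentiability of holomorphic maps *)

Section TwoVariables.
Import ComplexField.Normc.
Local Open Scope complex_scope.
Variable R : realType.
Local Notation C := (Cplx R).
Implicit Types (a b e r : R) (x y z w c d m : C) (p : C * C) (f g : C * C -> C).

Lemma nbhs_pair_normcP p (A : set (C * C)) :
  nbhs p A <-> exists2 r : R, 0 < r & forall q : C * C,
    normc (q.1 - p.1) < r -> normc (q.2 - p.2) < r -> A q.
Proof.
split=> [/nbhs_ballP[e /= /posC[r r0 ->] rA]|[r r0 rA]].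
  exists r => // q q1 q2; apply: rA.
  by split; rewrite -ball_normE /ball_ /= distrC ltcR.
apply/nbhs_ballP; exists (r%:C : C); first by rewrite /= ltcR.
move=> q [q1 q2]; apply: rA; rewrite -ltcR.
  by move: q1; rewrite -ball_normE /ball_ /= distrC.
by move: q2; rewrite -ball_normE /ball_ /= distrC.
Qed.

Lemma differentiable_normc f p : differentiable f p -> forall e, 0 < e ->
  exists2 r : R, 0 < r & forall x y, normc x < r -> normc y < r ->
    normc (f (p.1 + x, p.2 + y) - f p
           - ('d f p (1, 0) * x + 'd f p (0, 1) * y)) <= e * (normc x + normc y).
Proof.
move=> df e e0.
have /eqaddoP /(_ e%:C) := diff_locally df.
rewrite ltcR => /(_ e0).
move=> /nbhs_pair_normcP[r r0 H].
exists r => // x y xr yr.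
have := H (x, y); rewrite /= !subr0 => /(_ xr yr).
rewrite (_ : (f \o _ - _) (x, y) =
    f (p.1 + x, p.2 + y) - f p - ('d f p (1, 0) * x + 'd f p (0, 1) * y)); last first.
  have xyE : (x, y) = x *: (1, 0) + y *: (0, 1) :> C * C.
    transitivity ((x * 1 + y * 0, x * 0 + y * 1) : C * C); last by [].
    by rewrite !mulr0 !mulr1 addr0 add0r.
  rewrite !fctE /= opprD addrA; congr (f _ - _ - _).
    by case: (p) => u v; rewrite [u + x]addrC [v + y]addrC.
  by rewrite [in LHS]xyE linearD !linearZ /GRing.scale /= mulrC [X in _ + X]mulrC.
rewrite -lecR => /le_trans -> //.
rewrite rmorphM ler_wpM2l ?lecR ?(ltW e0) //.
rewrite prod_normE /= rmorphD /= /Num.max; case: ifP => _.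
  by rewrite lerDr lecR normc_ge0.
by rewrite lerDl lecR normc_ge0.
Qed.

Lemma strict_differentiable f (U : set (C * C)) : nbhs (0 : C * C) U ->
  (forall p, U p -> differentiable f p) ->
  forall e, 0 < e -> exists2 r : R, 0 < r & forall x y y' : C,
    normc x < r -> normc y < r -> normc y' < r ->
    normc (f (x, y) - f (x, y') - 'd f 0 (0, 1) * (y - y')) <= e * normc (y - y').
Proof.
move=> U0 df e e0.
have U0' := nbhs_singleton U0.
have [r1 r10 H1] := (nbhs_pair_normcP _ _).1 U0.
(* 128 is the 64 of [cauchy_lipschitz] times the 2 of |x| + |z| <= 2 r. *)
have e'0 : 0 < e / 128 by rewrite divr_gt0.
have [r2 r20 H2] := differentiable_normc (df 0 U0') e'0.
pose r := Num.min r1 r2 / 2.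
have r0 : 0 < r by rewrite divr_gt0 // lt_min r10.
have rr1 : r < r1.
  by rewrite /r ltr_pdivrMr // gt_min; apply/orP; left; lra.
have rr2 : r < r2.
  by rewrite /r ltr_pdivrMr // gt_min; apply/orP; right; lra.
exists (r / 2) => [|x y y' xr yr yr']; first by rewrite divr_gt0.
set A := 'd f 0 (1, 0); set B := 'd f 0 (0, 1).
(* The remainder as a function of the second variable alone; x is a parameter and the bound on E is
   uniform in it. *)
pose E z := f (x, z) - f 0 - (A * x + B * z).
have xr' : normc x < r by apply: lt_trans xr _; rewrite ltr_pdivrMr //; lra.
have dE z : normc z <= r -> derivable E z 1.
  move=> zr; have dfz : differentiable f (x, z).
    apply: df; apply: H1 => /=; rewrite subr0; first exact: lt_trans rr1.
    exact: le_lt_trans rr1.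
  apply/derivable1_diffP; apply: differentiableB.
    apply: differentiableB; last exact: differentiable_cst.
    apply: (@differentiable_comp _ _ _ _ (fun z => (x, z)) f) => //.
  apply: differentiableD; first exact: differentiable_cst.
  by apply: differentiableM => //; exact: differentiable_cst.
have EM z : normc z <= r -> normc (E z) <= e / 128 * (2 * r).
  move=> zr; have := H2 x z (lt_trans xr' rr2) (le_lt_trans zr rr2).
  rewrite !add0r => /le_trans; apply.
  by rewrite ler_pM2l // mulr2n mulrDl mul1r lerD // ltW.
have := cauchy_lipschitz r0 dE EM (ltW yr) (ltW yr').
rewrite (_ : 64 * _ = e); last by field; rewrite gt_eqF.
by rewrite (_ : E y - E y' = f (x, y) - f (x, y') - B * (y - y')) //; rewrite /E; ring.
Qed.

End TwoVariables.

(** * Analytic equivalence *)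

Section AnalyticEquivalence.
Import ComplexField.Normc.
Local Open Scope complex_scope.
Variable R : realType.
Local Notation C := (Cplx R).
Implicit Types (e r : R) (x y a b c d : C) (p : C * C).
Implicit Types (A B D U V : set (C * C)) (Phi Psi : C * C -> C * C).

Definition linear_fst : {linear (C * C)%type -> C} := @fst C C.
Definition linear_snd : {linear (C * C)%type -> C} := @snd C C.

Lemma continuous_linear_fst : continuous linear_fst.
Proof. by move=> p; exact: cvg_fst. Qed.

Lemma continuous_linear_snd : continuous linear_snd.
Proof. by move=> p; exact: cvg_snd. Qed.

Lemma differentiable_fst p : differentiable (fun q : C * C => q.1) p.
Proof. exact: (linear_differentiable (f := linear_fst) p continuous_linear_fst). Qed.

Lemma differentiable_snd p : differentiable (fun q : C * C => q.2) p.
Proof. exact: (linear_differentiable (f := linear_snd) p continuous_linear_snd). Qed.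

Lemma diff_fst_comp Phi p v : differentiable Phi p ->
  'd (fun q => (Phi q).1) p v = ('d Phi p v).1.
Proof.
move=> dP; have -> := diff_comp dP (differentiable_fst (Phi p)).
by have /= -> := @diff_lin C _ _ linear_fst (Phi p) continuous_linear_fst.
Qed.

Lemma diff_snd_comp Phi p v : differentiable Phi p ->
  'd (fun q => (Phi q).2) p v = ('d Phi p v).2.
Proof.
move=> dP; have -> := diff_comp dP (differentiable_snd (Phi p)).
by have /= -> := @diff_lin C _ _ linear_snd (Phi p) continuous_linear_snd.
Qed.

Lemma diff_pairE Phi p x y :
  'd Phi p (x, y) = x *: 'd Phi p (1, 0) + y *: 'd Phi p (0, 1).
Proof.
rewrite -!linearZ -linearD; congr ('d Phi p _).
transitivity ((x * 1 + y * 0, x * 0 + y * 1) : C * C); last by [].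
by rewrite !mulr0 !mulr1 addr0 add0r.
Qed.

Definition first_order (f : C * C -> C) a b := forall e, 0 < e ->
  exists2 r : R, 0 < r & forall x y, normc x < r -> normc y < r ->
    normc (f (x, y) - (a * x + b * y)) <= e * (normc x + normc y).

(** Only the second variable moves, as the branches to be compared lie over the same x. *)
Definition strict_order (f : C * C -> C) b := forall e, 0 < e ->
  exists2 r : R, 0 < r & forall x y y' : C,
    normc x < r -> normc y < r -> normc y' < r ->
    normc (f (x, y) - f (x, y') - b * (y - y')) <= e * normc (y - y').

(** Everything that the classification extracts from an equivalence: an invertible differential,
    strict differentiability in y, and the inclusion of the image of A in B near 0. The converse
    inclusion is reached through [an_equiv_sym]. *)
Lemma an_equiv_local A B : an_equiv A B -> exists (X Y : C * C -> C) a b c d,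
  [/\ a * d - b * c != 0,
      first_order X a b /\ first_order Y c d,
      strict_order X b /\ strict_order Y d
    & exists2 r : R, 0 < r & forall x y, normc x < r -> normc y < r ->
        A (x, y) -> B (X (x, y), Y (x, y))].
Proof.
move=> [U [V [Phi [U0 [[oU dPhi] bij [Psi [[oV dPsi] PsiPhi]]] Phi0 AB]]]].
have nU : nbhs (0 : C * C) U by exact: open_nbhs_nbhs.
have dP0 : differentiable Phi 0 := dPhi _ U0.
pose X q := (Phi q).1; pose Y q := (Phi q).2.
have dX p : U p -> differentiable X p.
  by move=> /dPhi dp; exact: (differentiable_comp dp (differentiable_fst _)).
have dY p : U p -> differentiable Y p.
  by move=> /dPhi dp; exact: (differentiable_comp dp (differentiable_snd _)).
have V0 : V (Phi 0).
  by case: bij => fPhi _ _; apply: fPhi.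
(* Psi o Phi is the identity near 0, so the chain rule makes the differential of Phi injective. *)
have key v : 'd Phi 0 v = 0 -> v = 0.
  have dPs := dPsi _ V0.
  have dPP : differentiable (Psi \o Phi) 0 := differentiable_comp dP0 dPs.
  have idE : 'd (Psi \o Phi) 0 v = v.
    rewrite -(deriveE v dPP).
    have nid : \forall q \near (0 : C * C), (Psi \o Phi) q = id q.
      by apply: filterS nU => q; exact: PsiPhi.
    rewrite (near_eq_derive v nid).
    exact: derive_id.
  move=> v0.
  have E : 'd (Psi \o Phi) 0 v = 'd Psi (Phi 0) ('d Phi 0 v) :=
    congr1 (fun h => h v) (diff_comp dP0 dPs).
  etransitivity; [exact: (esym idE)|]; etransitivity; [exact: E|].
  etransitivity; [exact: (congr1 ('d Psi (Phi 0)) v0)|].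
  exact: (linear0 ('d Psi (Phi 0))).
have X0 : X 0 = 0 by rewrite /X Phi0.
have Y0 : Y 0 = 0 by rewrite /Y Phi0.
have coef (f : C * C -> C) : f 0 = 0 -> (forall p, U p -> differentiable f p) ->
    exists a b, [/\ a = 'd f 0 (1, 0), b = 'd f 0 (0, 1),
      first_order f a b & strict_order f b].
  move=> f0 df; exists ('d f 0 (1, 0)), ('d f 0 (0, 1)); split=> // e e0.
    have [r r0 H] := differentiable_normc (df _ U0) e0.
    by exists r => // x y xr yr; have := H x y xr yr; rewrite /= !add0r f0 subr0.
  exact: (strict_differentiable nU).
have [a [b [aE bE foX soX]]] := coef X X0 dX.
have [c [d [cE dE foY soY]]] := coef Y Y0 dY.
exists X, Y, a, b, c, d; split.
- have XE v : 'd X 0 v = ('d Phi 0 v).1 := diff_fst_comp v dP0.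
  have YE v : 'd Y 0 v = ('d Phi 0 v).2 := diff_snd_comp v dP0.
  have {}aE := etrans aE (XE _); have {}bE := etrans bE (XE _).
  have {}cE := etrans cE (YE _); have {}dE := etrans dE (YE _).
  clear XE YE.
  rewrite aE bE cE dE; clear coef a b c d aE bE cE dE foX foY soX soY.
  case E1 : ('d Phi 0 (1, 0)) => [a c]; case E2 : ('d Phi 0 (0, 1)) => [b d] /=.
  apply/eqP => det0.
  have K x y : a * x + b * y = 0 -> c * x + d * y = 0 -> x = 0 /\ y = 0.
    move=> h1 h2; have := key (x, y); rewrite diff_pairE E1 E2.
    rewrite (_ : _ + _ = (a * x + b * y, c * x + d * y) :> C * C); last first.
      by rewrite [a * x]mulrC [b * y]mulrC [c * x]mulrC [d * y]mulrC.
    by rewrite h1 h2 => /(_ erefl)[-> ->].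
  (* If the determinant vanished, (d, -c) and (b, -a) would be in the kernel, so all entries would
     be 0 and (0, 1) would be in it too. *)
  have [||d0 /eqP] := K d (- c); [by rewrite -det0; ring|by ring|].
  rewrite oppr_eq0 => /eqP c0.
  have [||_ a0] := K 0 1; rewrite ?mulr0 ?mulr1 ?add0r ?d0 //.
    have [||b0 /eqP] := K b (- a).
    + by ring.
    + by rewrite -oppr0 -det0; ring.
    + by [].
  by move/eqP: a0; rewrite oner_eq0.
- by [].
- by [].
have [r r0 H] := (nbhs_pair_normcP _ _).1 nU.
exists r => // x y xr yr Axy.
have Uxy : U (x, y) by apply: H; rewrite /= subr0.
have : (B `&` V) (Phi (x, y)) by rewrite -AB; exists (x, y).
by move=> []; rewrite /X /Y -surjective_pairing.
Qed.

Lemma an_equiv_refl A : an_equiv A A.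
Proof.
exists setT, setT, id; split=> //; last by rewrite image_id.
split.
- by split; [exact: openT|].
- by split=> // x _; exists x.
- by exists id; split=> //; split; [exact: openT|].
Qed.

Lemma an_equiv_sym A B : an_equiv A B -> an_equiv B A.
Proof.
move=> [U [V [Phi [U0 [hPhi bij [Psi [hPsi PsiPhi]]] Phi0 AB]]]].
have [fPhi iPhi sPhi] := bij.
have PhiPsi z : V z -> Phi (Psi z) = z.
  by move=> /sPhi[u Uu <-]; rewrite PsiPhi.
have UPsi z : V z -> U (Psi z).
  by move=> /sPhi[u Uu <-]; rewrite PsiPhi.
exists V, U, Psi; split.
- by rewrite -Phi0; exact: fPhi.
- split=> //.
  + split=> //.
    * by move=> z w; rewrite !inE => Vz Vw e; rewrite -(PhiPsi z) // e PhiPsi.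
    * by move=> u Uu; exists (Phi u); [exact: fPhi|exact: PsiPhi].
  + by exists Phi.
- by rewrite -[in LHS]Phi0 PsiPhi.
- apply/seteqP; split=> [_ [z [Bz Vz] <-]|u [Au Uu]].
    have : (Phi @` (A `&` U)) z by rewrite AB.
    by move=> [u [Au Uu] <-]; rewrite PsiPhi.
  have : (B `&` V) (Phi u) by rewrite -AB; exists u.
  by move=> BV; exists (Phi u) => //; rewrite PsiPhi.
Qed.

Lemma an_equiv_trans A B D : an_equiv A B -> an_equiv B D -> an_equiv A D.
Proof.
move=> [U [V [Phi [U0 [[oU dPhi] bij [Psi [[oV dPsi] PsiPhi]]] Phi0 AB]]]].
move=> [U' [V' [Phi' [U'0 [[oU' dPhi'] bij' [Psi' [[oV' dPsi'] PsiPhi']]] Phi'0 BD]]]].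
have [fPhi iPhi sPhi] := bij.
have [fPhi' iPhi' sPhi'] := bij'.
have PhiPsi z : V z -> Phi (Psi z) = z.
  by move=> /sPhi[u Uu <-]; rewrite PsiPhi.
have PhiPsi' z : V' z -> Phi' (Psi' z) = z.
  by move=> /sPhi'[u Uu <-]; rewrite PsiPhi'.
have opre (G : set (C * C)) (f : C * C -> C * C) (W : set (C * C)) :
    open G -> (forall z, G z -> differentiable f z) -> open W -> open (G `&` f @^-1` W).
  rewrite !openE => oG df oW z [Gz Wz]; apply: filterI; first exact: oG.
  by have /differentiable_continuous := df z Gz; apply; exact: oW.
exists (U `&` Phi @^-1` U'), (V' `&` Psi' @^-1` V), (Phi' \o Phi); split.
- by split=> //=; rewrite Phi0.
- split.
  + split; first exact: opre.
    by move=> z [Uz U'z]; apply: differentiable_comp; [exact: dPhi|exact: dPhi'].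
  + split.
    * move=> z [Uz U'z]; split; first exact: fPhi'.
      by rewrite /= PsiPhi' //; exact: fPhi.
    * move=> z w; rewrite !inE => -[Uz U'z] [Uw U'w] /= e.
      apply: iPhi; rewrite ?inE //.
      by apply: iPhi'; rewrite ?inE.
    * move=> z [V'z Vz]; have [u' U'u' e'] := sPhi' z V'z.
      have : V u' by move: Vz; rewrite /= -e' PsiPhi'.
      by move=> /sPhi[u Uu e]; exists u; rewrite /= ?e //; split=> //=; rewrite e.
  + exists (Psi \o Psi'); split; first split; first exact: opre.
      by move=> z [V'z Vz]; apply: differentiable_comp; [exact: dPsi'|exact: dPsi].
    by move=> z [Uz U'z]; rewrite /= PsiPhi' // PsiPhi.
- by rewrite /= Phi0.
- apply/seteqP; split=> [_ [z [Az [Uz U'z]] <-]|w [Dw [V'w Vw]]].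
    have [Bz Vz] : (B `&` V) (Phi z) by rewrite -AB; exists z.
    have [Dz V'z] : (D `&` V') (Phi' (Phi z)) by rewrite -BD; exists (Phi z).
    by split=> //; split=> //=; rewrite PsiPhi'.
  have : (Phi' @` (B `&` U')) w by rewrite BD.
  move=> [v [Bv U'v] e]; move: Vw; rewrite /= -e PsiPhi' // => Vv.
  have : (Phi @` (A `&` U)) v by rewrite AB.
  move=> [u [Au Uu] e']; exists u; last by rewrite /= e'.
  by split=> //; split=> //=; rewrite e'.
Qed.

Lemma an_equiv_global A B Phi Psi : Phi (0, 0) = (0, 0) ->
  (forall p, differentiable Phi p) -> (forall p, differentiable Psi p) ->
  cancel Phi Psi -> cancel Psi Phi -> (forall p, A p <-> B (Phi p)) ->
  an_equiv A B.
Proof.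
move=> Phi0 dPhi dPsi PK KP AB; exists setT, setT, Phi; split=> //.
- split.
  + by split; [exact: openT|].
  + split=> //; first by move=> x y _ _ /(can_inj PK).
    by move=> z _; exists (Psi z).
  + by exists Psi; split=> //; split; [exact: openT|].
- rewrite !setIT; apply/seteqP; split=> [_ [z /AB ? <-] //|w Bw].
  by exists (Psi w) => //; apply/AB; rewrite KP.
Qed.

(** [curve_germ B] places B in its own class, from which the equivalence is read off. *)
Lemma an_classP A B : curve_germ B ->
  an_class A = an_class B <-> an_equiv A B.
Proof.
move=> cB; split=> [E|AB].
  have : an_class B B by split=> //; exact: an_equiv_refl.
  by rewrite -E => -[].
apply/seteqP; split=> D [cD h]; split=> //.
  exact: an_equiv_trans (an_equiv_sym AB) h.
exact: an_equiv_trans AB h.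
Qed.

End AnalyticEquivalence.

(** * Limits along filters *)

Section Limits.
Import ComplexField.Normc.
Local Open Scope complex_scope.
Variable R : realType.
Local Notation C := (Cplx R).
Implicit Types (e r : R) (x y z w a b c d : C).

Section LimitAlgebra.
Context {T : Type} {F : set_system T} {FF : Filter F}.
Implicit Types (f g : T -> C).

Lemma lim_normc f a e : f @ F --> a -> 0 < e -> F [set t | normc (f t - a) < e].
Proof. by move=> fa e0; exact: ((cvg_normcP FF f a).1 fa e e0). Qed.

Lemma normc_lim f a : (forall e, 0 < e -> F [set t | normc (f t - a) < e]) -> f @ F --> a.
Proof. exact: (cvg_normcP FF f a).2. Qed.

Lemma limC c : (fun=> c) @ F --> c.
Proof. exact: cvg_cst. Qed.

Lemma limD f g a b : f @ F --> a -> g @ F --> b -> (fun t => f t + g t) @ F --> a + b.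
Proof. by move=> fa gb; exact: (cvgD fa gb). Qed.

Lemma limB f g a b : f @ F --> a -> g @ F --> b -> (fun t => f t - g t) @ F --> a - b.
Proof. by move=> fa gb; exact: (cvgB fa gb). Qed.

Lemma limM f g a b : f @ F --> a -> g @ F --> b -> (fun t => f t * g t) @ F --> a * b.
Proof. by move=> fa gb; exact: (cvgM fa gb). Qed.

Lemma lim_eq f g a : f =1 g -> f @ F --> a -> g @ F --> a.
Proof. by move=> /funext ->. Qed.

Lemma limX f a n : f @ F --> a -> (fun t => f t ^+ n) @ F --> a ^+ n.
Proof.
move=> fa; elim: n => [|n IH].
  by rewrite expr0; apply: (lim_eq _ (limC (c := 1))) => t; rewrite expr0.
by rewrite exprS; apply: (lim_eq _ (limM fa IH)) => t; rewrite exprS.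
Qed.

Lemma lim_prod (I : Type) (s : seq I) (f : I -> T -> C) (a : I -> C) :
  (forall i, f i @ F --> a i) ->
  (fun t => \prod_(i <- s) f i t) @ F --> \prod_(i <- s) a i.
Proof.
move=> fa; elim: s => [|i s IH].
  by rewrite big_nil; apply: (lim_eq _ (limC (c := 1))) => t; rewrite big_nil.
by rewrite big_cons; apply: (lim_eq _ (limM (fa i) IH)) => t; rewrite big_cons.
Qed.

Lemma lim_near f g a : F [set t | f t = g t] -> f @ F --> a -> g @ F --> a.
Proof.
move=> fg fa; apply: normc_lim => e e0.
by apply: filterS (filterI fg (lim_normc fa e0)) => t [/= ->].
Qed.

Lemma lim_sub0 f a : (fun t => f t - a) @ F --> (0 : C) -> f @ F --> a.
Proof.
move=> fa; apply: normc_lim => e e0; apply: (@filterS _ F FF _ _ _ (lim_normc fa e0)) => t /=.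
by rewrite subr0.
Qed.

End LimitAlgebra.

Lemma lim_unique (T : Type) (F : set_system T) {FF : ProperFilter F} (f : T -> C) a b :
  f @ F --> a -> f @ F --> b -> a = b.
Proof.
move=> fa fb; apply/eqP; rewrite -subr_eq0; apply/eqP/normc_eq0/eqP.
rewrite eq_le normc_ge0 andbT; apply/ler_addgt0Pr => e e0; rewrite add0r.
have e2 : 0 < e / 2 by rewrite divr_gt0.
have [t [h1 h2]] := filter_ex (filterI (lim_normc fa e2) (lim_normc fb e2)).
rewrite (_ : a - b = - (f t - a) + (f t - b)); last by ring.
apply: le_trans (normcD _ _) _; rewrite normcNE.
by apply: le_trans (lerD (ltW h1) (ltW h2)) _; rewrite -splitr.
Qed.

Lemma lim_near_neq0 (T : Type) (F : set_system T) {FF : Filter F} (f : T -> C) a :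
  f @ F --> a -> a != 0 -> F [set t | f t != 0].
Proof.
move=> fa a0; apply: (@filterS _ F FF _ _ _ (lim_normc fa (normc_gt0 a0))) => t /=.
apply: contraTneq => ->.
by rewrite sub0r normcNE ltxx.
Qed.

(** With u and v bounded, the expansion error is o(|s|), so division by s leaves the differential at
    (u0, v0). *)
Lemma scaled_limit (T : Type) (F : set_system T) {FF : Filter F}
    (f : C * C -> C) a b (s u v : T -> C) u0 v0 :
  first_order f a b -> s @ F --> (0 : C) -> F [set t | s t != 0] ->
  u @ F --> u0 -> v @ F --> v0 ->
  (fun t => f (s t * u t, s t * v t) / s t) @ F --> a * u0 + b * v0.
Proof.
move=> fo s0 sn0 uu vv.
have lin : (fun t => a * u t + b * v t) @ F --> a * u0 + b * v0.
  exact: limD (limM (limC (c := a)) uu) (limM (limC (c := b)) vv).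
apply: normc_lim => e e0.
(* The 2 allows u and v each to be at distance 1 from their limits. *)
pose K := normc u0 + normc v0 + 2.
have K0 : 0 < K by rewrite ltr_wpDl ?addr_ge0 ?normc_ge0.
have e2 : 0 < e / 2 by rewrite divr_gt0.
have [r r0 H] := fo (e / 2 / K) (divr_gt0 e2 K0).
have N1 := lim_normc (FF := FF) lin e2.
have N2 := lim_normc (FF := FF) s0 (divr_gt0 r0 K0).
have N3 := lim_normc (FF := FF) uu ltr01.
have N4 := lim_normc (FF := FF) vv ltr01.
have NN := @filterI _ F FF _ _ (@filterI _ F FF _ _ N1 N2) (@filterI _ F FF _ _ sn0 (@filterI _ F FF _ _ N3 N4)).
apply: (@filterS _ F FF _ _ _ NN) => t /= -[[n1 n2] [n0 [n3 n4]]].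
rewrite subr0 in n2.
have un : normc (u t) <= normc u0 + 1.
  by have := normcD (u t - u0) u0; rewrite subrK; move: (ltW n3); lra.
have vn : normc (v t) <= normc v0 + 1.
  by have := normcD (v t - v0) v0; rewrite subrK; move: (ltW n4); lra.
have uvK : normc (u t) + normc (v t) <= K by rewrite /K; move: un vn; lra.
have sK : normc (s t) * K < r by rewrite -ltr_pdivlMr.
have s1 : 0 < normc (s t) := normc_gt0 n0.
have H1 := H (s t * u t) (s t * v t).
rewrite !normcME in H1.
have {}H1 := H1 (le_lt_trans (ler_wpM2l (ltW s1) (le_trans _ uvK)) sK)
  (le_lt_trans (ler_wpM2l (ltW s1) (le_trans _ uvK)) sK).
have {}H1 := H1 (ler_wpDr (normc_ge0 _) (lexx _)) (ler_wpDl (normc_ge0 _) (lexx _)).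
rewrite (_ : _ - _ = (f (s t * u t, s t * v t) - (a * (s t * u t) + b * (s t * v t))) / s t
    + (a * u t + b * v t - (a * u0 + b * v0))); last by field.
apply: le_lt_trans (normcD _ _) _.
rewrite [ltRHS](_ : e = e / 2 + e / 2); last by field.
apply: ler_ltD => //.
rewrite normcME normcVE ler_pdivrMr //; apply: le_trans H1 _.
rewrite -mulrDr mulrCA [leRHS]mulrC ler_pM2l //.
rewrite -[leRHS](@divfK _ K) ?gt_eqF // ler_pM2l ?divr_gt0 //.
Qed.

(** Two points over the same x are resolved at the scale s of their vertical distance, however large
    x is compared with s. *)
Lemma strict_limit (T : Type) (F : set_system T) {FF : Filter F}
    (f : C * C -> C) b (x s : T -> C) y y' :
  strict_order f b -> x @ F --> (0 : C) -> s @ F --> (0 : C) ->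
  F [set t | s t != 0] ->
  (fun t => f (x t, s t * y) / s t - f (x t, s t * y') / s t) @ F --> b * (y - y').
Proof.
move=> so x0 s0 sn0.
apply: normc_lim => e e0.
have n1 : 0 < normc (y - y') + 1 by rewrite ltr_wpDl ?normc_ge0.
have [r r0 H] := so (e / (normc (y - y') + 1)) (divr_gt0 e0 n1).
have K0 : 0 < normc y + normc y' + 1 by rewrite ltr_wpDl ?addr_ge0 ?normc_ge0.
have N1 := lim_normc (FF := FF) x0 r0.
have N2 := lim_normc (FF := FF) s0 (divr_gt0 r0 K0).
have NN := @filterI _ F FF _ _ N1 (@filterI _ F FF _ _ N2 sn0).
apply: (@filterS _ F FF _ _ _ NN) => t /=; rewrite !subr0 => -[h1 [h2 h3]].
have s1 : 0 < normc (s t) := normc_gt0 h3.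
have sK : normc (s t) * (normc y + normc y' + 1) < r by rewrite -ltr_pdivlMr.
have Y1 : normc (s t * y) < r.
  rewrite normcME; apply: le_lt_trans sK; rewrite ler_pM2l // -addrA lerDl.
  by rewrite addr_ge0 // normc_ge0.
have Y2 : normc (s t * y') < r.
  rewrite normcME; apply: le_lt_trans sK; rewrite ler_pM2l // [normc y + _]addrC -addrA lerDl.
  by rewrite addr_ge0 // normc_ge0.
have := H _ _ _ h1 Y1 Y2; rewrite -mulrBr normcME => h.
rewrite (_ : _ - _ = (f (x t, s t * y) - f (x t, s t * y') - b * (s t * (y - y'))) / s t);
  last by field.
rewrite normcME normcVE ltr_pdivrMr //; apply: le_lt_trans h _.
rewrite mulrCA mulrC ltr_pM2r // mulrAC ltr_pdivrMr // ltr_pM2l //.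
by rewrite ltrDl.
Qed.

(** Along an ultrafilter, a function that does not tend to 0 is bounded away from 0 on a member of
    it; two such factors would bound the product away from 0. *)
Lemma ultra_mul0 (T : Type) (U : set_system T) {UU : UltraFilter U} (f g : T -> C) :
  (fun t => f t * g t) @ U --> (0 : C) -> f @ U --> (0 : C) \/ g @ U --> (0 : C).
Proof.
move=> fg0; apply: contrapT => /not_orP[nf ng].
have PU : ProperFilter U by exact: ultra_proper.
have FU : Filter U by exact _.
have far (h : T -> C) : ~ (h @ U --> (0 : C)) ->
    exists2 e : R, 0 < e & U [set t | e <= normc (h t)].
  move=> nh; apply: contrapT => nex; refine (nh (@normc_lim _ U FU h 0 _)) => e e0.
  have [h1|h1] := in_ultra_setVsetC [set t | normc (h t - 0) < e] UU; first exact: h1.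
  exfalso; apply: nex; exists e; first by [].
  apply: (@filterS _ U FU _ _ _ h1) => t /=.
  by rewrite subr0 => /negP; rewrite -leNgt.
have [e1 e10 H1] := far f nf; have [e2 e20 H2] := far g ng.
have H3 := lim_normc (FF := FU) fg0 (mulr_gt0 e10 e20).
have [t [h1 [h2 h3]]] := @filter_ex _ U PU _ (@filterI _ U FU _ _ H1 (@filterI _ U FU _ _ H2 H3)).
move: h3; rewrite /= subr0 normcME ltNge => /negP; apply.
by apply: ler_pM => //; exact: ltW.
Qed.

Lemma ultra_prod0 (T I : Type) (U : set_system T) {UU : UltraFilter U} (s : seq I)
    (P : pred I) (f : I -> T -> C) :
  (fun t => \prod_(i <- s | P i) f i t) @ U --> (0 : C) ->
  exists2 i, P i & f i @ U --> (0 : C).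
Proof.
elim: s => [|i s IH].
  move=> H; have [t] := filter_ex (lim_normc H ltr01).
  by rewrite /= big_nil subr0 normc1 ltxx.
have [Pi|nPi] := boolP (P i); last first.
  rewrite (_ : (fun t => _) = (fun t => \prod_(i <- s | P i) f i t)) //.
  by apply: funext => t; rewrite big_cons (negPf nPi).
rewrite (_ : (fun t => _) = (fun t => f i t * \prod_(i <- s | P i) f i t)); last first.
  by apply: funext => t; rewrite big_cons Pi.
by move=> /ultra_mul0[|/IH//]; exists i.
Qed.

(** In the factorization of w^p - a into linear factors, one factor w - r must tend to 0; w need not
    be known to be bounded. *)
Lemma ultra_root (T : Type) (U : set_system T) {UU : UltraFilter U} (w : T -> C) (p : nat) a :
  (0 < p)%N -> (fun t => w t ^+ p) @ U --> a ->
  exists2 r : C, r ^+ p = a & w @ U --> r.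
Proof.
move=> p0 wa.
have FU : Filter U by exact _.
have [rs rsE] := closed_field_poly_normal ('X^p - a%:P : {poly C}).
have lc : lead_coef ('X^p - a%:P : {poly C}) = 1.
  by apply/eqP; rewrite -monicE monicXnsubC.
rewrite lc scale1r in rsE.
have E (z : C) : z ^+ p - a = \prod_(r <- rs) (z - r).
  have := congr1 (horner^~ z) rsE; rewrite !hornerE horner_prod => ->.
  by apply: eq_bigr => r _; rewrite !hornerE.
have H : (fun t => \prod_(i <- rs | i \in rs) (w t - i)) @ U --> (0 : C).
  apply: normc_lim => e e0; apply: (@filterS _ U FU _ _ _ (lim_normc wa e0)) => t /=.
  by rewrite E subr0 -big_seq.
have [r rrs wr] := ultra_prod0 H.
exists r.
  apply/eqP; rewrite -subr_eq0 E prodf_seq_eq0; apply/hasP; exists r => //.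
  by rewrite /= subrr.
exact: lim_sub0.
Qed.

End Limits.

(** * Branches and their images *)

Section Tangent.
Import ComplexField.Normc.
Local Open Scope complex_scope.
Variable R : realType.
Local Notation C := (Cplx R).
Implicit Types (e r : R) (x y z w a b c d : C).

Lemma punctured_proper : ProperFilter ((0 : C)^').
Proof. exact: Proper_dnbhs_numFieldType. Qed.

Lemma punctured_filter : Filter ((0 : C)^').
Proof. by have h := punctured_proper; exact _. Qed.

Lemma punctured_neq0 : (0 : C)^' [set t | t != 0].
Proof. by apply/(nbhs_normcP (0 : C)); exists 1. Qed.

Lemma punctured_lim : (fun t : C => t) @ (0 : C)^' --> (0 : C).
Proof.
refine (@normc_lim R _ _ punctured_filter _ _ _) => e e0.
apply: (nbhs_normcP (0 : C) _).2; exists e; first exact: e0.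
by move=> w.
Qed.

Lemma punctured_limX n : (0 < n)%N -> (fun t : C => t ^+ n) @ (0 : C)^' --> (0 : C).
Proof.
move=> n0; have := @limX _ _ _ punctured_filter _ _ n punctured_lim.
by rewrite expr0n gtn_eqF.
Qed.

Lemma punctured_neq0X n : (0 : C)^' [set t | t ^+ n != 0].
Proof.
apply: (@filterS _ _ punctured_filter _ _ _ punctured_neq0) => t /= t0.
exact: expf_neq0.
Qed.

(** At (t^p, t^q w) the equation of the curve, without its factor x^m, is t^(q k + p q n) times this
    value. *)
Definition pq_poly (p n : nat) (k : nat) (l : 'I_n -> C) w : C :=
  w ^+ k * \prod_(j < n) (w ^+ p - l j).

Lemma pq_poly_eq0 p n k (l : 'I_n -> C) w :
  (pq_poly p k l w == 0) = ((0 < k)%N && (w == 0)) || [exists j, w ^+ p == l j].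
Proof.
rewrite mulf_eq0 expf_eq0; congr (_ || _).
apply/prodf_eq0/existsP => [[j _]|[j /eqP wj]].
  by rewrite subr_eq0 => ?; exists j.
by exists j => //; rewrite wj subrr.
Qed.

(* The points (t^p, t^q z), z a root of [pq_poly], parametrize the branches of
   the curve other than x = 0. *)
Lemma branch_mem p q n (m k : 'I_2) (l : 'I_n -> C) t z :
  pq_poly p k l z = 0 -> curve_pq p q m k l (t ^+ p, t ^+ q * z).
Proof.
move=> /eqP; rewrite pq_poly_eq0 => H; apply/eqP; rewrite /= !mulf_eq0.
case/orP: H => [/andP[k0 /eqP ->]|/existsP[j zj]].
  by rewrite mulr0 expr0n (gtn_eqF k0) eqxx orbT.
apply/orP; right; apply/prodf_eq0; exists j => //.
by rewrite exprMn (eqP zj) -!exprM mulnC mulrC subrr.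
Qed.

Section Images.
Variables (p q n : nat) (m k m' k' : 'I_2) (l l' : 'I_n -> C).
Hypotheses (p0 : (0 < p)%N) (pq : (p < q)%N) (n0 : (0 < n)%N).
Variables (X Y : C * C -> C) (a b c d : C).
Hypotheses (det0 : a * d - b * c != 0).
Hypotheses (foX : first_order X a b) (foY : first_order Y c d).
Hypotheses (soX : strict_order X b) (soY : strict_order Y d).
Hypothesis XYl' : exists2 r : R, 0 < r & forall x y, normc x < r -> normc y < r ->
  curve_pq p q m k l (x, y) -> curve_pq p q m' k' l' (X (x, y), Y (x, y)).

Let F := (0 : C)^'.
Let FF : Filter F := punctured_filter.
Let FP : ProperFilter F := punctured_proper.

(** The equation in the coordinates x / s and y / s. As [p < q], a positive power of s is left in
    front of x^q, and for s -> 0 each factor degenerates to (y / s)^p. *)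
Lemma curve_pq_scaled (s x y : C) : s != 0 ->
  curve_pq p q m' k' l' (x, y) ->
  (x / s) ^+ m' * (y / s) ^+ k' *
    \prod_(j < n) ((y / s) ^+ p - l' j * (s ^+ (q - p) * (x / s) ^+ q)) = 0.
Proof.
move=> s0 /eqP; rewrite !mulf_eq0 => H; apply/eqP; rewrite !mulf_eq0 !expf_eq0 !mulf_eq0.
move: H; rewrite !expf_eq0 => /orP[/orP[/andP[-> ->]//|/andP[-> ->]]|].
  by rewrite orbT.
move=> /prodf_eq0[j _ /eqP xj]; apply/orP; right; apply/prodf_eq0; exists j => //.
have -> : (y / s) ^+ p - l' j * (s ^+ (q - p) * (x / s) ^+ q) =
    (y ^+ p - l' j * x ^+ q) / s ^+ p.
  have sq : s ^+ q = s ^+ (q - p) * s ^+ p by rewrite -exprD subnK // ltnW.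
  rewrite !expr_div_n sq.
  by field; rewrite !expf_neq0.
by rewrite xj mul0r.
Qed.

(** The image of an arc with direction (u0, v0) has the direction given by the differential, and
    this lies in the tangent cone of the target curve, contained in x^m' y = 0 because [p < q]. *)
Lemma tangent_image (s u v : C -> C) (u0 v0 : C) :
  s @ F --> (0 : C) -> F [set t | s t != 0] -> u @ F --> u0 -> v @ F --> v0 ->
  (forall t, curve_pq p q m k l (s t * u t, s t * v t)) ->
  [/\ (fun t => X (s t * u t, s t * v t) / s t) @ F --> a * u0 + b * v0,
      (fun t => Y (s t * u t, s t * v t) / s t) @ F --> c * u0 + d * v0,
      F [set t | curve_pq p q m' k' l' (X (s t * u t, s t * v t), Y (s t * u t, s t * v t))]
    & (a * u0 + b * v0) ^+ m' * (c * u0 + d * v0) = 0].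
Proof.
move=> s0 sn0 uu vv mem.
have limX' := scaled_limit (FF := FF) foX s0 sn0 uu vv.
have limY' := scaled_limit (FF := FF) foY s0 sn0 uu vv.
have N : F [set t | curve_pq p q m' k' l' (X (s t * u t, s t * v t), Y (s t * u t, s t * v t))].
  have [r r0 H] := XYl'.
  have su := limM (FF := FF) s0 uu; have sv := limM (FF := FF) s0 vv.
  rewrite mul0r in su; rewrite mul0r in sv.
  have N1 := lim_normc (FF := FF) su r0; have N2 := lim_normc (FF := FF) sv r0.
  apply: (@filterS _ _ FF _ _ _ (@filterI _ _ FF _ _ N1 N2)) => t /=.
  by rewrite !subr0 => -[h1 h2]; apply: H.
split; [exact: limX'|exact: limY'|exact: N|].
pose f t := (X (s t * u t, s t * v t) / s t) ^+ m' * (Y (s t * u t, s t * v t) / s t) ^+ k' *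
  \prod_(j < n) ((Y (s t * u t, s t * v t) / s t) ^+ p -
    l' j * (s t ^+ (q - p) * (X (s t * u t, s t * v t) / s t) ^+ q)).
have f0 : f @ F --> (0 : C).
  have NN := @filterI _ _ FF _ _ sn0 N.
  refine (lim_near (FF := FF) _ (limC (FF := FF) (c := 0))).
  refine (@filterS _ _ FF _ _ _ NN) => t [st0 mt].
  exact: (esym (curve_pq_scaled st0 mt)).
have fl : f @ F --> (a * u0 + b * v0) ^+ m' * (c * u0 + d * v0) ^+ k' *
    \prod_(j < n) ((c * u0 + d * v0) ^+ p - l' j * (0 ^+ (q - p) * (a * u0 + b * v0) ^+ q)).
  refine (limM (FF := FF) (limM (FF := FF) (limX (FF := FF) limX') (limX (FF := FF) limY')) _).
  refine (lim_prod (FF := FF) _) => j.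
  refine (limB (FF := FF) (limX (FF := FF) limY') _).
  refine (limM (FF := FF) (limC (FF := FF) (c := l' j)) _).
  exact: (limM (FF := FF) (limX (FF := FF) s0) (limX (FF := FF) limX')).
have := lim_unique (FF := FP) fl f0.
rewrite expr0n subn_eq0 leqNgt pq /=.
move=> /eqP; rewrite !mulf_eq0 => H; apply/eqP; rewrite !mulf_eq0.
case/orP: H => [/orP[->//|]|]; first by rewrite expf_eq0 => /andP[_ ->]; rewrite orbT.
move=> /prodf_eq0[j _]; rewrite mul0r mulr0 subr0 expf_eq0 => /andP[_ ->].
by rewrite orbT.
Qed.

(** At the scale t^p a branch is the arc (1, t^(q - p) z), of direction (1, 0), whose image under
    the differential is (a, c). *)
Lemma branch_limits z : pq_poly p k l z = 0 ->
  [/\ (fun t => X (t ^+ p, t ^+ q * z) / t ^+ p) @ F --> a,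
      (fun t => Y (t ^+ p, t ^+ q * z) / t ^+ p) @ F --> c,
      F [set t | curve_pq p q m' k' l' (X (t ^+ p, t ^+ q * z), Y (t ^+ p, t ^+ q * z))]
    & a ^+ m' * c = 0].
Proof.
move=> z0.
have E t : t ^+ q * z = t ^+ p * (t ^+ (q - p) * z).
  by rewrite mulrA -exprD subnKC // ltnW.
have vl : (fun t => t ^+ (q - p) * z) @ F --> (0 : C).
  have := limM (FF := FF) (punctured_limX (n := q - p) _) (limC (FF := FF) (c := z)).
  by rewrite mul0r subn_gt0; apply.
have mem t : curve_pq p q m k l (t ^+ p * 1, t ^+ p * (t ^+ (q - p) * z)).
  by rewrite mulr1 -E; exact: branch_mem.
have [h1 h2 h3 h4] := tangent_image (punctured_limX p0) (punctured_neq0X p)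
  (limC (FF := FF) (c := 1)) vl mem.
rewrite !mulr1 !mulr0 !addr0 in h1 h2 h4.
split; last exact: h4.
- by refine (lim_eq _ h1) => t; rewrite mulr1 E.
- by refine (lim_eq _ h2) => t; rewrite mulr1 E.
- by refine (@filterS _ _ FF _ _ _ h3) => t /=; rewrite mulr1 -E.
Qed.

Lemma pq_poly_root : exists z, pq_poly p k l z = 0.
Proof.
exists (p.-root (l (Ordinal n0))); apply/eqP; rewrite pq_poly_eq0.
by apply/orP; right; apply/existsP; exists (Ordinal n0); rewrite rootCK.
Qed.

(** If m = 1 and m' = 0, the directions (1, 0) and (0, 1) are both sent into the line y = 0, so c =
    d = 0, against the determinant. *)
Lemma vertical_le : (m <= m')%N.
Proof.
case: (posnP m) => [-> //|m1]; case: (posnP m') => [m'0|m'1]; last first.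
  by apply: leq_trans m'1; rewrite -ltnS ltn_ord.
exfalso; have [z zr] := pq_poly_root.
have [_ _ _ /eqP] := branch_limits zr; rewrite m'0 expr0 mul1r => /eqP c0.
have mem t : curve_pq p q m k l (t * 0, t * 1).
  by rewrite /curve_pq /= mulr0 expr0n (gtn_eqF m1) !mul0r.
have [_ _ _ /eqP] := tangent_image punctured_lim punctured_neq0
  (limC (FF := FF) (c := 0)) (limC (FF := FF) (c := 1)) mem.
rewrite m'0 expr0 mul1r mulr0 add0r mulr1 => /eqP d0.
by move: det0; rewrite c0 d0 !mulr0 subrr eqxx.
Qed.

(** Here the image of the branch is not tangent to y = 0, so all rescaled factors of the target
    equation except x^m' have nonzero limits, and x^m' must vanish. *)
Lemma vertical_image z : c != 0 -> pq_poly p k l z = 0 ->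
  F [set t | X (t ^+ p, t ^+ q * z) = 0].
Proof.
move=> c0 zr; have [limX' limY' N _] := branch_limits zr.
pose f t := (Y (t ^+ p, t ^+ q * z) / t ^+ p) ^+ k' *
  \prod_(j < n) ((Y (t ^+ p, t ^+ q * z) / t ^+ p) ^+ p -
    l' j * ((t ^+ p) ^+ (q - p) * (X (t ^+ p, t ^+ q * z) / t ^+ p) ^+ q)).
have fl : f @ F --> c ^+ k' * \prod_(j < n) (c ^+ p - l' j * (0 ^+ (q - p) * a ^+ q)).
  refine (limM (FF := FF) (limX (FF := FF) limY') _).
  refine (lim_prod (FF := FF) _) => j.
  refine (limB (FF := FF) (limX (FF := FF) limY') _).
  refine (limM (FF := FF) (limC (FF := FF) (c := l' j)) _).
  exact: (limM (FF := FF) (limX (FF := FF) (punctured_limX p0)) (limX (FF := FF) limX')).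
have fl0 : c ^+ k' * \prod_(j < n) (c ^+ p - l' j * (0 ^+ (q - p) * a ^+ q)) != 0.
  rewrite mulf_neq0 ?expf_neq0 //; apply/prodf_neq0 => j _.
  by rewrite expr0n subn_eq0 leqNgt pq mul0r mulr0 subr0 expf_neq0.
have fn0 := lim_near_neq0 (FF := FF) fl fl0.
have NN := @filterI _ _ FF _ _ (@filterI _ _ FF _ _ fn0 (punctured_neq0X p)) N.
refine (@filterS _ _ FF _ _ _ NN) => t [[/= ft t0] mt]; apply/eqP.
have := curve_pq_scaled t0 mt; rewrite -mulrA -/(f t) => /eqP.
rewrite mulf_eq0 (negPf ft) orbF expf_eq0 => /andP[_].
by rewrite mulf_eq0 invr_eq0 (negPf t0) orbF.
Qed.

(** X vanishes along both branches, while strict differentiability gives b (z - z') as the limit of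
    its rescaled difference; the cone forces a = 0, hence b <> 0. *)
Lemma vertical_unique : c != 0 ->
  forall z z', pq_poly p k l z = 0 -> pq_poly p k l z' = 0 -> z = z'.
Proof.
move=> c0 z z' zr zr'.
have [_ _ _ /eqP] := branch_limits zr.
rewrite mulf_eq0 (negPf c0) orbF expf_eq0 => /andP[_ /eqP a0].
have b0 : b != 0.
  by apply: contra_neq det0 => ->; rewrite a0 mul0r mul0r subrr.
have q0 : (0 < q)%N := leq_ltn_trans (leq0n p) pq.
have h := strict_limit (FF := FF) (y := z) (y' := z') soX (punctured_limX p0) (punctured_limX q0)
  (punctured_neq0X q).
have NN := @filterI _ _ FF _ _ (vertical_image c0 zr) (vertical_image c0 zr').
have h0 : (fun t => X (t ^+ p, t ^+ q * z) / t ^+ q - X (t ^+ p, t ^+ q * z') / t ^+ q)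
    @ F --> (0 : C).
  refine (lim_near (FF := FF) _ (limC (FF := FF) (c := 0))).
  by refine (@filterS _ _ FF _ _ _ NN) => t [/= -> ->]; rewrite mul0r subrr.
have /eqP := lim_unique (FF := FP) h h0.
by rewrite mulf_eq0 (negPf b0) subr_eq0 => /eqP.
Qed.

(** X / t^p tends to a <> 0, so the factor x^m' can be cancelled; dividing the rest by the power of
    t of its weight gives a product of factors in Y / t^q that tends to 0 along [U]. *)
Lemma horizontal_image z (U : set_system C) (UU : UltraFilter U) : F `<=` U ->
  c = 0 -> pq_poly p k l z = 0 ->
  exists2 w, pq_poly p k' (fun j => a ^+ q * l' j) w = 0 &
    (fun t => Y (t ^+ p, t ^+ q * z) / t ^+ q) @ U --> w.
Proof.
move=> FU c0 zr; have [limX' _ N _] := branch_limits zr.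
have UF : Filter U by exact _.
have a0 : a != 0.
  by apply: contra_neq det0 => ->; rewrite c0 mul0r mulr0 subrr.
have xn0 := lim_near_neq0 (FF := FF) limX' a0.
set w := fun t => Y (t ^+ p, t ^+ q * z) / t ^+ q.
set x := fun t => X (t ^+ p, t ^+ q * z) / t ^+ p.
have xU : x @ U --> a by move=> A /limX'; exact: FU.
pose f t := w t ^+ k' * \prod_(j < n) (w t ^+ p - l' j * x t ^+ q).
have fU : f @ U --> (0 : C).
  refine (lim_near (FF := UF) _ (limC (FF := UF) (c := 0))); apply: FU.
  have NN := @filterI _ _ FF _ _ (@filterI _ _ FF _ _ xn0 punctured_neq0) N.
  refine (@filterS _ _ FF _ _ _ NN) => t [[/= xt t0] mt]; apply/esym/eqP.
  have X0 : X (t ^+ p, t ^+ q * z) != 0.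
    by apply: contra_neq xt => ->; rewrite mul0r.
  have H : (Y (t ^+ p, t ^+ q * z) ^+ k' == 0) ||
      (\prod_(j < n) (Y (t ^+ p, t ^+ q * z) ^+ p - l' j * X (t ^+ p, t ^+ q * z) ^+ q) == 0).
    by move/eqP: mt; rewrite !mulf_eq0 (negPf (expf_neq0 m' X0)).
  rewrite expf_eq0 in H; rewrite /f mulf_eq0 expf_eq0 mulf_eq0.
  case/orP: H => [/andP[-> ->]//|/prodf_eq0[j _ /eqP e]].
  apply/orP; right; apply/prodf_eq0; exists j => //; apply/eqP.
  transitivity ((Y (t ^+ p, t ^+ q * z) ^+ p - l' j * X (t ^+ p, t ^+ q * z) ^+ q)
      / t ^+ (p * q)); last by rewrite e mul0r.
  rewrite /w /x !expr_div_n -!exprM [(q * p)%N]mulnC.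
  by field; rewrite expf_neq0.
have UP : ProperFilter U by exact: ultra_proper.
case: (ultra_mul0 fU) => [wk|/ultra_prod0[j _ wj]].
  (* For k' = 0 the factor w^k' is constantly 1 and cannot tend to 0. *)
  have k'1 : k' = 1%N :> nat.
    have : (k' <= 1)%N by rewrite -ltnS ltn_ord.
    rewrite leq_eqVlt => /predU1P[//|]; rewrite ltnS leqn0 => /eqP k'0.
    exfalso; rewrite k'0 in wk.
    have := lim_unique (FF := UP) wk (limX (FF := UF) (n := 0) xU).
    by rewrite expr0 => /eqP; rewrite eq_sym oner_eq0.
  exists 0; first by apply/eqP; rewrite pq_poly_eq0 eqxx k'1.
  by rewrite k'1 in wk; exact: (lim_eq _ wk).
have wj' : (fun t => w t ^+ p) @ U --> a ^+ q * l' j.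
  have := limD (FF := UF) wj (limM (FF := UF) (limC (FF := UF) (c := l' j)) (limX (FF := UF) (n := q) xU)).
  rewrite add0r mulrC => h; refine (lim_eq _ h) => t.
  by rewrite subrK.
have [r rE wr] := ultra_root p0 wj'.
exists r; last exact: wr.
apply/eqP; rewrite pq_poly_eq0; apply/orP; right; apply/existsP; exists j.
by apply/eqP.
Qed.

Lemma horizontal_affine : c = 0 -> [/\ a != 0, d != 0 & exists g0,
  forall z, pq_poly p k l z = 0 -> pq_poly p k' (fun j => a ^+ q * l' j) (g0 + d * z) = 0].
Proof.
move=> c0.
have a0 : a != 0.
  by apply: contra_neq det0 => ->; rewrite c0 mul0r mulr0 subrr.
have d0 : d != 0.
  by apply: contra_neq det0 => ->; rewrite c0 !mulr0 subrr.
(* The ultrafilter is fixed before z, so that the limits for z and for the reference root z0 can be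
   subtracted; z0 then determines g0. *)
split=> //; have [U [UU FU]] := ultraFilterLemma FP.
have [z0 z0r] := pq_poly_root.
have [w0 w0r w0l] := horizontal_image UU FU c0 z0r.
exists (w0 - d * z0) => z zr.
have [w wr wl] := horizontal_image UU FU c0 zr.
have q0 : (0 < q)%N := leq_ltn_trans (leq0n p) pq.
have h := strict_limit (FF := FF) (y := z) (y' := z0) soY (punctured_limX p0)
  (punctured_limX q0) (punctured_neq0X q).
have UP : ProperFilter U by exact: ultra_proper.
have UF : Filter U by exact _.
have hU : (fun t => Y (t ^+ p, t ^+ q * z) / t ^+ q - Y (t ^+ p, t ^+ q * z0) / t ^+ q)
    @ U --> d * (z - z0) by move=> A /h; exact: FU.
have E := lim_unique (FF := UP) (limB (FF := UF) wl w0l) hU.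
have -> : w0 - d * z0 + d * z = w.
  transitivity (w0 + d * (z - z0)); first by ring.
  by rewrite -E addrC subrK.
exact: wr.
Qed.

End Images.

Lemma an_equiv_pq p q n (m k m' k' : 'I_2) (l l' : 'I_n -> C) :
  (0 < p)%N -> (p < q)%N -> (0 < n)%N ->
  an_equiv (curve_pq p q m k l) (curve_pq p q m' k' l') ->
  (m <= m')%N /\
  ((forall z z', pq_poly p k l z = 0 -> pq_poly p k l z' = 0 -> z = z') \/
   exists a d g0, [/\ a != 0, d != 0 & forall z, pq_poly p k l z = 0 ->
     pq_poly p k' (fun j => a ^+ q * l' j) (g0 + d * z) = 0]).
Proof.
move=> p0 pq n0 /an_equiv_local[X [Y [a [b [c [d [det0 [foX foY] [soX soY] H]]]]]]].
split; first exact: (vertical_le p0 pq n0 det0 foX foY H).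
have [c0|c0] := eqVneq c 0; last first.
  by left; exact: (vertical_unique p0 pq det0 foX foY soX H c0).
have [a0 d0 [g0 h]] := horizontal_affine p0 pq n0 det0 foX foY soY H c0.
by right; exists a, d, g0.
Qed.

End Tangent.

(** * Configurations and roots *)

Section Groups.
Variables (T : Type) (n : nat) (G : set (T -> T)).
Hypothesis G1 : G id.
Hypothesis GM : forall g h, G g -> G h -> G (g \o h).
Hypothesis GV : forall g, G g -> exists h, [/\ G h, cancel g h & cancel h g].
Implicit Types (l : 'I_n -> T).

(** A class is a set of S_n-orbits containing the orbit of its representative by [G1]. Equality of
    classes thus gives l = g o l' o s, and the inverse of g is the element sought. *)
Lemma conf_classP l l' :
  conf_class G l = conf_class G l' <->
  exists2 g, G g & exists s : {perm 'I_n}, l' \o s = g \o l.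
Proof.
split=> [E|[g Gg [s ls]]].
  have : conf_class G l (sym_orbit l).
    exists id => //; rewrite /diag_act; apply/seteqP; split=> [_ [x xl <-]|x xl] //.
    by exists x.
  rewrite E => -[g Gg gE].
  have : sym_orbit l l by exists 1%g => //; apply: funext => i /=; rewrite perm1.
  rewrite -gE => -[_ [s _ <-] e].
  have [h [Gh gh hg]] := GV Gg.
  exists h => //; exists s; apply: funext => i /=.
  by rewrite -e /= gh.
have orb : diag_act g (sym_orbit l) = sym_orbit l'.
  apply/seteqP; split=> [_ [_ [t _ <-] <-]|_ [t _ <-]].
    exists (t * s)%g => //; apply: funext => i /=; rewrite permM.
    exact: (congr1 (fun f => f (t i)) ls).
  exists (l \o (t * s^-1)%g); first by exists (t * s^-1)%g.
  apply: funext => i /=; rewrite permM.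
  by have := congr1 (fun f => f ((s^-1)%g (t i))) ls; rewrite /= permKV => <-.
rewrite /conf_class -orb.
have dd (f h : T -> T) O : diag_act f (diag_act h O) = diag_act (f \o h) O :> set ('I_n -> T).
  apply/seteqP; split=> [_ [_ [x xO <-] <-]|_ [x xO <-]]; first by exists x.
  by exists (h \o x) => //; exists x.
apply/seteqP; split=> _ [h Gh <-]; last first.
  by exists (h \o g); [exact: GM|rewrite dd].
have [g' [Gg' gg' g'g]] := GV Gg.
exists (h \o g'); first exact: GM.
rewrite dd; congr diag_act; apply: funext => x /=.
by rewrite gg'.
Qed.
End Groups.

(** An injection of ['I_n] into itself is a permutation, so it is enough that g sends each point of
    l to a point of l'. *)
Lemma inj_perm (T : eqType) (n : nat) (l l' : 'I_n -> T) (g : T -> T) :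
  injective l -> injective g -> (forall j, exists i, l' i = g (l j)) ->
  exists s : {perm 'I_n}, l' \o s = g \o l.
Proof.
move=> il ig H; have [f fE] := choice H.
have fi : injective f.
  by move=> i j e; apply/il/ig; rewrite -!fE e.
by exists (perm fi); apply: funext => j /=; rewrite permE fE.
Qed.

(** * Simple roots of w^k prod_j (w^p - l_j) and their symmetry *)

Section Roots.
Variable K : closedFieldType.
Hypothesis K0 : [pchar K] =i pred0.

Lemma separable_XnsubC (p : nat) (c : K) : (0 < p)%N -> (p == 1%N) || (c != 0) ->
  separable_poly ('X^p - c%:P).
Proof.
move=> p0 pc; rewrite separable_poly.unlock; apply/Pdiv.ClosedField.coprimepP => x.
rewrite derivB derivXn derivC subr0 rootE !hornerE subr_eq0 => xp.
rewrite hornerMn hornerXn -mulr_natr mulf_neq0 //; last first.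
  by rewrite (iffLR (pcharf0P K) K0) -lt0n.
case/orP: pc => [/eqP ->|c0]; first by rewrite expr0 oner_neq0.
apply: expf_neq0; apply: contraNneq c0 => x0; move: xp; rewrite x0 expr0n gtn_eqF //.
by rewrite eq_sym.
Qed.

Definition pq_polyX (p n k : nat) (l : 'I_n -> K) : {poly K} :=
  'X^k * \prod_(j < n) ('X^p - (l j)%:P).

Lemma horner_pq_polyX p n k (l : 'I_n -> K) x :
  (pq_polyX p k l).[x] = x ^+ k * \prod_(j < n) (x ^+ p - l j).
Proof.
rewrite /pq_polyX hornerM hornerXn horner_prod; congr (_ * _).
by apply: eq_bigr => j _; rewrite !hornerE.
Qed.

(** The alternative covers both uses. For p = 1 and k = 0 the roots are the l_j themselves, one of
    which may be 0. Otherwise no l_j is 0, which makes the roots of w^p = l_j simple and distinct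
    from the root of w^k. *)
Lemma separable_pq_polyX p n (k : nat) (l : 'I_n -> K) : (0 < p)%N -> (k <= 1)%N ->
  injective l -> ((p == 1%N) && (k == 0%N)) || [forall j, l j != 0] ->
  separable_poly (pq_polyX p k l).
Proof.
move=> p0 k1 il H; rewrite separable_mul.
have lsep j : separable_poly ('X^p - (l j)%:P).
  apply: separable_XnsubC => //; case/orP: H => [/andP[-> //]|/forallP ->].
  by rewrite orbT.
have copr (s : seq 'I_n) x : (forall j, j \in s -> x ^+ p != l j) ->
    (\prod_(j <- s) ('X^p - (l j)%:P)).[x] != 0.
  move=> h; rewrite horner_prod big_seq prodf_seq_neq0; apply/allP => j js.
  by apply/implyP => _; rewrite !hornerE subr_eq0 h.
apply/and3P; split.
- move: k1; case: (k) => [|[|//]] _; first by rewrite expr0 separable_poly.unlock derivC coprimep0 eqpxx.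
  by have := @separable_XnsubC 1 0 isT isT; rewrite subr0.
- have : uniq (index_enum 'I_n) by exact: index_enum_uniq.
  elim: (index_enum _) => [_|j s IH] /=.
    by rewrite big_nil separable_poly.unlock derivC coprimep0 eqpxx.
  move=> /andP[js us]; rewrite big_cons separable_mul lsep IH //=.
  apply/Pdiv.ClosedField.coprimepP => x; rewrite rootE !hornerE subr_eq0 => /eqP xj.
  apply: copr => i is_; rewrite xj; apply: contraNneq js => /il ->; exact: is_.
- apply/Pdiv.ClosedField.coprimepP => x; rewrite rootE hornerXn expf_eq0 => /andP[k0 /eqP ->].
  apply: copr => j _; rewrite expr0n gtn_eqF //= eq_sym.
  case/orP: H => [/andP[_ /eqP kk]|/forallP -> //].
  by rewrite kk in k0.
Qed.

Lemma monic_pq_polyX p n k (l : 'I_n -> K) : (0 < p)%N -> pq_polyX p k l \is monic.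
Proof.
move=> p0; apply: rpredM; first exact: monicXn.
by apply: monic_prod => j _; rewrite monicXnsubC.
Qed.

Lemma size_pq_polyX p n k (l : 'I_n -> K) : (0 < p)%N ->
  size (pq_polyX p k l) = (k + p * n).+1.
Proof.
move=> p0; rewrite size_monicM ?monicXn //; last first.
  by rewrite monic_neq0 //; apply: monic_prod => j _; rewrite monicXnsubC.
rewrite size_polyXn size_prod => [|j _]; last by rewrite monic_neq0 ?monicXnsubC.
under eq_bigr do rewrite size_XnsubC //.
by rewrite sum_nat_const card_ord /= mulnS -addnS addKn addnS mulnC.
Qed.

(** Separability turns the degree k + p n into an exact count of roots, from which k can be
    recovered. *)
Lemma pq_roots p n (k : nat) (l : 'I_n -> K) : (0 < p)%N -> (k <= 1)%N ->
  injective l -> ((p == 1%N) && (k == 0%N)) || [forall j, l j != 0] ->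
  exists rs : seq K, [/\ uniq rs, size rs = (k + p * n)%N &
    forall z, (z \in rs) = (z ^+ k * \prod_(j < n) (z ^+ p - l j) == 0)].
Proof.
move=> p0 k1 il H; have [rs rsE] := closed_field_poly_normal (pq_polyX p k l).
have /eqP lc := monic_pq_polyX k l p0; rewrite lc scale1r in rsE.
exists rs; split.
- by rewrite -separable_prod_XsubC -rsE; exact: separable_pq_polyX.
- by have := size_pq_polyX k l p0; rewrite rsE size_prod_XsubC => -[].
- by move=> z; rewrite -root_prod_XsubC -rsE rootE horner_pq_polyX.
Qed.

(** w^p - 1 is the case n = 1, k = 0, l = 1 of [pq_roots]: it has p >= 2 distinct roots, not all
    equal to 1. *)
Lemma unity_root_neq1 (p : nat) : (1 < p)%N -> exists2 w : K, w ^+ p = 1 & w != 1.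
Proof.
move=> p1; have p0 := ltnW p1.
have [||rs [urs srs rsE]] := @pq_roots p 1 0 (fun=> 1) p0 isT.
- by move=> i j _; rewrite (ord1 i) (ord1 j).
- by apply/orP; right; apply/forallP => j; rewrite oner_neq0.
have rs1 z : z \in rs -> z ^+ p = 1.
  by rewrite rsE big_ord1 expr0 mul1r subr_eq0 => /eqP.
move: rs urs srs rs1 {rsE} => [|x [|y rs]] /=; [by rewrite muln1; case: (p) p0|by rewrite muln1 add0n => _ e; rewrite -e in p1|].
rewrite inE negb_or => /andP[/andP[xy _] _] _ h.
have [x1|x1] := eqVneq x 1; last by exists x => //; apply: h; rewrite !inE eqxx.
exists y; first by apply: h; rewrite !inE eqxx orbT.
by rewrite -x1 eq_sym.
Qed.

Lemma sum_pq_roots p n k (l : 'I_n -> K) (rs : seq K) : (1 < p)%N -> uniq rs ->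
  (forall z, (z \in rs) = (z ^+ k * \prod_(j < n) (z ^+ p - l j) == 0)) ->
  \sum_(z <- rs) z = 0.
Proof.
move=> p1 urs rsE; have [w wp w1] := unity_root_neq1 p1.
have w0 : w != 0.
  by apply: contra_eq_neq wp => ->; rewrite expr0n gtn_eqF 1?ltnW // eq_sym oner_neq0.
have rsw z : (w * z \in rs) = (z \in rs).
  rewrite !rsE exprMn mulf_eq0 [_ * _ == 0 in RHS]mulf_eq0 mulf_eq0.
  rewrite (negPf (expf_neq0 k w0)) /=; congr (_ || (_ == _)).
  by apply: eq_bigr => j _; rewrite exprMn wp mul1r.
have P : perm_eq rs [seq w * z | z <- rs].
  apply: uniq_perm => //; first by rewrite map_inj_uniq //; exact: mulfI.
  move=> z; apply/idP/mapP => [zrs|[x xrs ->]]; last by rewrite rsw.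
  by exists (w^-1 * z); rewrite ?mulVKf // -rsw mulVKf.
have : (1 - w) * \sum_(z <- rs) z = 0.
  by rewrite mulrBl mul1r {1}(perm_big _ P) big_map -mulr_sumr subrr.
by move=> /eqP; rewrite mulf_eq0 subr_eq0 eq_sym (negPf w1) => /eqP.
Qed.

End Roots.

(** * From affine maps between root sets to the group actions *)

Section Rigidity.
Variable R : realType.
Local Notation C := (Cplx R).
Implicit Types (a b c d z w : C).

Lemma pchar_Cplx : [pchar C] =i pred0.
Proof. exact: pchar_num. Qed.

Lemma pq_poly_roots p n (k : nat) (l : 'I_n -> C) : (0 < p)%N -> (k <= 1)%N ->
  injective l -> ((p == 1%N) && (k == 0%N)) || [forall j, l j != 0] ->
  exists rs : seq C, [/\ uniq rs, size rs = (k + p * n)%N &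
    forall z, (z \in rs) = (pq_poly p k l z == 0)].
Proof. exact: (@pq_roots C (pchar_Cplx)). Qed.

Lemma injM_conf n (l : 'I_n -> C) a : a != 0 -> injective l ->
  injective (fun j => a * l j).
Proof. by move=> a0 il i j /(mulfI a0)/il. Qed.

Lemma an_equiv_1q q n (m m' : 'I_2) (l l' : 'I_n -> C) :
  (1 < q)%N -> (0 < n)%N -> injective l -> injective l' ->
  an_equiv (curve_pq 1 q m ord0 l) (curve_pq 1 q m' ord0 l') ->
  (m <= m')%N /\ exists2 g, Aff R g & exists s : {perm 'I_n}, l' \o s = g \o l.
Proof.
move=> q1 n0 il il' /(an_equiv_pq (ltn0Sn 0) q1 n0)[mm' H]; split=> //.
have rt n1 (h : 'I_n1 -> C) z : (pq_poly 1 0 h z == 0) = [exists j, z == h j].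
  by rewrite pq_poly_eq0 /= expr1.
case: H => [uniqr|[a [d [g0 [a0 d0 H]]]]].
  (* A single root means n = 1, and two one-point configurations differ by a translation. *)
  have lE i j : l i = l j.
    by apply: uniqr; apply/eqP; rewrite rt; apply/existsP; [exists i|exists j].
  pose i0 := Ordinal n0.
  have iE i : i = i0 by apply/il/lE.
  exists (fun z => 1 * z + (l' i0 - l i0)); first by exists 1, (l' i0 - l i0); rewrite oner_neq0.
  exists 1%g; apply: funext => i /=; rewrite perm1 (iE i); ring.
(* For p = 1 the roots of Q_(a^q l') are the a^q l'_i, so g is z |-> g0 + d z followed by division
   by a^q. *)
pose g z := d / a ^+ q * z + g0 / a ^+ q.
have aq : a ^+ q != 0 by rewrite expf_neq0.
have dq : d / a ^+ q != 0 by rewrite mulf_neq0 ?invr_eq0.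
exists g; first by exists (d / a ^+ q), (g0 / a ^+ q).
apply: inj_perm => // [x y /addIr/(mulfI dq) //|j].
have lr : pq_poly 1 0 l (l j) = 0 by apply/eqP; rewrite rt; apply/existsP; exists j.
have /eqP := H _ lr; rewrite rt => /existsP[i /eqP e]; exists i.
by apply: (mulfI aq); rewrite -e /g; field.
Qed.

Lemma an_equiv_pq_rigid p q n (m k m' k' : 'I_2) (l l' : 'I_n -> C) :
  (1 < p)%N -> (p < q)%N -> (0 < n)%N -> conf (Cstar R) n l -> conf (Cstar R) n l' ->
  an_equiv (curve_pq p q m k l) (curve_pq p q m' k' l') ->
  [/\ (m <= m')%N, (k <= k')%N & k = k' ->
   exists2 g, GL1 R g & exists s : {perm 'I_n}, l' \o s = g \o l].
Proof.
move=> p1 pq n0 [il l0] [il' l'0] E.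
have p0 := ltnW p1.
have [mm' H] := an_equiv_pq p0 pq n0 E.
have le1 (i : 'I_2) : (i <= 1)%N by rewrite -ltnS ltn_ord.
have c0 : (p == 1%N) && (k == 0%N :> nat) || [forall j, l j != 0].
  by apply/orP; right; apply/forallP => j; exact: l0.
have [rs [urs srs rsE]] := pq_poly_roots p0 (le1 k) il c0.
case: H => [uniqr|[a [d [g0 [a0 d0 H]]]]].
  (* There are k + p n >= 2 distinct roots, which excludes this case. *)
  exfalso; have : (2 <= size rs)%N.
    rewrite srs; apply: leq_trans (leq_addl _ _).
    by apply: leq_trans p1 _; rewrite leq_pmulr.
  move: rs urs {srs} rsE => [|x [|y rs]] //=; rewrite inE negb_or => /andP[/andP[xy _] _] h _.
  move/eqP: xy; apply; apply: uniqr; apply/eqP; rewrite -h !inE eqxx //.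
  by rewrite orbT.
have aq : a ^+ q != 0 by rewrite expf_neq0.
have c1 : (p == 1%N) && (k' == 0%N :> nat) || [forall j, a ^+ q * l' j != 0].
  by apply/orP; right; apply/forallP => j; rewrite mulf_neq0 //; exact: l'0.
have [rs' [urs' srs' rsE']] := pq_poly_roots p0 (le1 k') (injM_conf aq il') c1.
pose h z := g0 + d * z.
have ih : injective h by move=> x y /addrI/(mulfI d0).
have hs : {subset map h rs <= rs'}.
  by move=> _ /mapP[z + ->]; rewrite rsE rsE' => /eqP zr; apply/eqP; exact: H.
have umap : uniq (map h rs) by rewrite map_inj_uniq.
have szle := uniq_leq_size umap hs.
(* The injection of roots reads k + p n <= k' + p n. *)
split=> //; first by move: szle; rewrite size_map srs srs' leq_add2r.
move=> kk; have pe : perm_eq (map h rs) rs'.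
  apply: uniq_perm => //; apply: (uniq_min_size umap hs _).2.
  by rewrite size_map srs srs' kk.
have s0 := sum_pq_roots pchar_Cplx p1 urs rsE.
have s0' := sum_pq_roots pchar_Cplx p1 urs' rsE'.
(* Both root sums vanish, and they differ by g0 times the number of roots, which is nonzero. *)
have g00 : g0 = 0.
  move: s0'; rewrite -(perm_big _ pe) big_map big_split /= -mulr_sumr s0 mulr0 addr0.
  rewrite big_const_seq count_predT iter_addr_0 srs => /eqP.
  rewrite -mulr_natr mulf_eq0 pnatr_eq0 addn_eq0 muln_eq0.
  by rewrite (gtn_eqF p0) (gtn_eqF n0) /= andbF orbF => /eqP.
pose g z := d ^+ p / a ^+ q * z.
have dp : d ^+ p / a ^+ q != 0 by rewrite mulf_neq0 ?invr_eq0 ?expf_neq0.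
exists g; first by exists (d ^+ p / a ^+ q).
apply: inj_perm => // [x y /(mulfI dp) //|j].
(* A root z <> 0 with z^p = l_j goes to d z <> 0, which is not the root of w^k'; hence (d z)^p = a^q
   l'_i for some i, and l_j is multiplied by d^p / a^q. *)
pose z := p.-root (l j).
have zp : z ^+ p = l j by rewrite rootCK.
have z0 : z != 0.
  apply: contraTneq (l0 j : l j != 0) => z0; rewrite -zp z0 expr0n gtn_eqF //.
  by rewrite eqxx.
have zr : pq_poly p k l z = 0.
  by apply/eqP; rewrite pq_poly_eq0; apply/orP; right; apply/existsP; exists j; rewrite zp.
have /eqP := H _ zr; rewrite g00 add0r pq_poly_eq0 mulf_eq0 (negPf d0) (negPf z0) andbF /=.
move=> /existsP[i /eqP e]; exists i.
by apply: (mulfI aq); rewrite -e exprMn zp /g; field.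
Qed.

End Rigidity.

(** * Moebius transformations and lines *)

Section Mobius.
Import ComplexField.Normc.
Local Open Scope complex_scope.
Variable R : realType.
Local Notation C := (Cplx R).
Implicit Types (a b c d x y z w : C) (t : P1 R).

(** In homogeneous coordinates [Some t] is [t : 1] and [None] is [1 : 0], and the claim is the
    matrix product; a nonzero inner determinant keeps the intermediate vector (u, v) from
    vanishing. *)
Lemma mobius_comp a b c d a' b' c' d' : a' * d' - b' * c' != 0 ->
  mobius a b c d \o mobius a' b' c' d' =
  mobius (a * a' + b * c') (a * b' + b * d') (c * a' + d * c') (c * b' + d * d').
Proof.
move=> det0; apply: funext => -[t|] /=.
  pose u := a' * t + b'; pose v := c' * t + d'.
  have -> : (a * a' + b * c') * t + (a * b' + b * d') = a * u + b * v by rewrite /u /v; ring.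
  have -> : (c * a' + d * c') * t + (c * b' + d * d') = c * u + d * v by rewrite /u /v; ring.
  rewrite -/u -/v; have [v0|v0] := eqVneq v 0 => /=.
    have u0 : u != 0.
      apply: contra_neq det0 => u0.
      transitivity (a' * v - c' * u); first by rewrite /u /v; ring.
      by rewrite u0 v0 !mulr0 subrr.
    rewrite v0 !mulr0 !addr0 mulf_eq0 (negPf u0) orbF.
    by case: eqVneq => // c0; congr Some; field; do ?[apply/andP; split].
  have E : c * (u / v) + d = (c * u + d * v) / v by field.
  rewrite E mulf_eq0 invr_eq0 (negPf v0) orbF.
  by case: eqVneq => // n0; congr Some; field; do ?[apply/andP; split].
have [c'0|c'0] := eqVneq c' 0 => /=.
  have a'0 : a' != 0.
    by apply: contra_neq det0 => ->; rewrite c'0 mul0r mulr0 subrr.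
  rewrite c'0 !mulr0 !addr0 mulf_eq0 (negPf a'0) orbF.
  by case: eqVneq => // c0; congr Some; field; do ?[apply/andP; split].
have E : c * (a' / c') + d = (c * a' + d * c') / c' by field.
rewrite E mulf_eq0 invr_eq0 (negPf c'0) orbF.
by case: eqVneq => // n0; congr Some; field; do ?[apply/andP; split].
Qed.

Lemma mobius_scale e a b c d : e != 0 ->
  mobius (e * a) (e * b) (e * c) (e * d) = mobius a b c d.
Proof.
move=> e0; apply: funext => -[t|] /=.
  have -> : e * c * t + e * d = e * (c * t + d) by ring.
  rewrite mulf_eq0 (negPf e0) /=; case: eqVneq => // n0.
  by congr Some; field; do ?[apply/andP; split].
rewrite mulf_eq0 (negPf e0) /=; case: eqVneq => // n0.
by congr Some; field; do ?[apply/andP; split].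
Qed.

Lemma mobius_id : mobius 1 0 0 1 = id :> (P1 R -> P1 R).
Proof.
apply: funext => -[t|] /=; last by rewrite eqxx.
by rewrite mul0r add0r oner_eq0 mul1r addr0 divr1.
Qed.

(** Dividing the matrix by a square root of its determinant makes the determinant 1 and leaves the
    transformation unchanged. *)
Lemma mobius_PSL2 a b c d : a * d - b * c != 0 -> PSL2 R (mobius a b c d).
Proof.
move=> det0; pose e := sqrtC (a * d - b * c).
have e0 : e != 0 by rewrite sqrtC_eq0.
have e2 : e ^+ 2 = a * d - b * c by rewrite sqrtCK.
exists (e^-1 * a), (e^-1 * b), (e^-1 * c), (e^-1 * d); split.
  rewrite (_ : _ - _ = (a * d - b * c) / e ^+ 2); last by field.
  by rewrite e2 mulfV.
by rewrite mobius_scale ?invr_eq0.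
Qed.

Lemma PSL2_id : PSL2 R id.
Proof. by exists 1, 0, 0, 1; rewrite mobius_id mulr1 mulr0 subr0. Qed.

Lemma PSL2_comp g h : PSL2 R g -> PSL2 R h -> PSL2 R (g \o h).
Proof.
move=> [a [b [c [d [e ->]]]]] [a' [b' [c' [d' [e' ->]]]]].
rewrite mobius_comp ?e' ?oner_neq0 //; apply: mobius_PSL2.
rewrite (_ : _ - _ = (a * d - b * c) * (a' * d' - b' * c')); last by ring.
by rewrite e e' mulr1 oner_neq0.
Qed.

Lemma PSL2_inv g : PSL2 R g -> exists h, [/\ PSL2 R h, cancel g h & cancel h g].
Proof.
move=> [a [b [c [d [e ->]]]]]; exists (mobius d (- b) (- c) a).
have e' : d * a - - b * - c = 1 by rewrite -e; ring.
have E1 : mobius d (- b) (- c) a \o mobius a b c d = id.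
  rewrite mobius_comp ?e ?oner_neq0 // -mobius_id -e; congr mobius; ring.
have E2 : mobius a b c d \o mobius d (- b) (- c) a = id.
  rewrite mobius_comp ?e' ?oner_neq0 // -mobius_id -e; congr mobius; ring.
split; first by exists d, (- b), (- c), a.
  by move=> t; exact: (congr1 (fun f => f t) E1).
by move=> t; exact: (congr1 (fun f => f t) E2).
Qed.

Lemma Aff_id : Aff R id.
Proof. by exists 1, 0; rewrite oner_neq0; split=> //; apply: funext => z; rewrite mul1r addr0. Qed.

Lemma Aff_comp g h : Aff R g -> Aff R h -> Aff R (g \o h).
Proof.
move=> [a [b [a0 ->]]] [a' [b' [a'0 ->]]]; exists (a * a'), (a * b' + b).
by rewrite mulf_neq0 //; split=> //; apply: funext => z /=; ring.
Qed.

Lemma Aff_inv g : Aff R g -> exists h, [/\ Aff R h, cancel g h & cancel h g].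
Proof.
move=> [a [b [a0 ->]]]; exists (fun z => a^-1 * z + - b / a); split.
- by exists a^-1, (- b / a); rewrite invr_eq0.
- by move=> z; field.
- by move=> z; field.
Qed.

Lemma GL1_id : GL1 R id.
Proof. by exists 1; rewrite oner_neq0; split=> //; apply: funext => z; rewrite mul1r. Qed.

Lemma GL1_comp g h : GL1 R g -> GL1 R h -> GL1 R (g \o h).
Proof.
move=> [a [a0 ->]] [b [b0 ->]]; exists (a * b).
by rewrite mulf_neq0 //; split=> //; apply: funext => z /=; ring.
Qed.

Lemma GL1_inv g : GL1 R g -> exists h, [/\ GL1 R h, cancel g h & cancel h g].
Proof.
move=> [a [a0 ->]]; exists (fun z => a^-1 * z); split.
- by exists a^-1; rewrite invr_eq0.
- by move=> z; field.
- by move=> z; field.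
Qed.

Lemma line_factorM t (s x y : C) : line_factor t (s * x, s * y) = s * line_factor t (x, y).
Proof. by case: t => [t|] //=; ring. Qed.

Lemma line_factor_prod n (l : 'I_n -> P1 R) p :
  curve_11 l p <-> exists j, line_factor (l j) p = 0.
Proof.
split=> [/eqP/prodf_eq0[j _ /eqP e]|[j e]]; first by exists j.
by apply/eqP/prodf_eq0; exists j => //; apply/eqP.
Qed.

(** A line is labelled by its slope t = y / x, so t |-> (a t + b) / (c t + d) comes from the linear
    map (x, y) |-> (d x + c y, b x + a y): both coordinates are interchanged. *)
Lemma line_factor_mobius a b c d t x y : a * d - b * c != 0 ->
  (line_factor (mobius a b c d t) (d * x + c * y, b * x + a * y) == 0) =
  (line_factor t (x, y) == 0).
Proof.
move=> det0; case: t => [t|] /=.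
  have [v0|v0] := eqVneq (c * t + d) 0 => /=.
    have dE : d = - (c * t) by apply/eqP; rewrite -addr_eq0 addrC v0.
    have c0 : c != 0.
      by apply: contra_neq det0 => c0; rewrite dE c0 mul0r oppr0 !mulr0 subrr.
    rewrite dE (_ : _ + _ = c * (y - t * x)); last by ring.
    by rewrite mulf_eq0 (negPf c0).
  rewrite (_ : _ - _ = (a * d - b * c) / (c * t + d) * (y - t * x)); last by field.
  by rewrite mulf_eq0 mulf_eq0 invr_eq0 (negPf det0) (negPf v0).
have [c0|c0] := eqVneq c 0 => /=.
  have d0 : d != 0.
    by apply: contra_neq det0 => d0; rewrite c0 d0 !mulr0 subrr.
  by rewrite c0 mul0r addr0 mulf_eq0 (negPf d0).
rewrite (_ : _ - _ = - ((a * d - b * c) / c) * x); last by field.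
by rewrite mulf_eq0 oppr_eq0 mulf_eq0 invr_eq0 (negPf det0) (negPf c0).
Qed.

(** The image of a nonzero vector is nonzero and so lies on only one line, the one found by
    [line_factor_mobius]. *)
Lemma line_factor_eq_mobius a b c d t t' : a * d - b * c != 0 ->
  forall x y, (x, y) != (0, 0) -> line_factor t (x, y) = 0 ->
  line_factor t' (d * x + c * y, b * x + a * y) = 0 -> t' = mobius a b c d t.
Proof.
move=> det0 x y xy0 /eqP tx; rewrite -(line_factor_mobius t x y det0) in tx.
set u := d * x + c * y in tx *; set v := b * x + a * y in tx * => /eqP.
have uv : (u, v) != (0, 0).
  apply: contra_neq xy0 => -[u0 v0].
  have dx : (a * d - b * c) * x = 0.
    by transitivity (a * u - c * v); [rewrite /u /v; ring|rewrite u0 v0 !mulr0 subrr].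
  have dy : (a * d - b * c) * y = 0.
    by transitivity (d * v - b * u); [rewrite /u /v; ring|rewrite u0 v0 !mulr0 subrr].
  move/eqP: dx; move/eqP: dy; rewrite !mulf_eq0 (negPf det0) /=.
  by move=> /eqP -> /eqP ->.
move: tx; case: (mobius _ _ _ _ _) => [r|] /=; case: t' => [s|] //=.
- move=> /eqP vr /eqP vs; congr Some; apply/eqP; rewrite -subr_eq0; apply/eqP.
  have : (s - r) * u = 0 by transitivity ((v - r * u) - (v - s * u)); [ring|rewrite vr vs subrr].
  move/eqP; rewrite mulf_eq0 => /orP[/eqP //|/eqP u0].
  by move: uv vr; rewrite u0 mulr0 subr0 => /eqP + v0; rewrite v0.
- move=> /eqP vr /eqP u0; exfalso; move: uv vr; rewrite u0 mulr0 subr0.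
  by move=> /eqP + v0; rewrite v0.
- move=> /eqP u0 /eqP vs; exfalso; move: uv vs; rewrite u0 mulr0 subr0.
  by move=> /eqP + v0; rewrite v0.
Qed.

End Mobius.

(** * Lines under equivalences, and explicit linear and shear equivalences *)

Section Equivalences.
Import ComplexField.Normc.
Local Open Scope complex_scope.
Variable R : realType.
Local Notation C := (Cplx R).
Implicit Types (a b c d x y z w : C).

Lemma lim_line_factor (T : Type) (F : set_system T) {FF : Filter F}
    (u v : T -> C) u0 v0 (t : P1 R) : u @ F --> u0 -> v @ F --> v0 ->
  (fun s => line_factor t (u s, v s)) @ F --> line_factor t (u0, v0).
Proof.
move=> uu vv; case: t => [t|]; last exact: uu.
exact: (limB (FF := FF) vv (limM (FF := FF) (limC (FF := FF) (c := t)) uu)).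
Qed.

Lemma an_equiv_11 n (l l' : 'I_n -> P1 R) : injective l ->
  an_equiv (curve_11 l) (curve_11 l') ->
  exists2 g, PSL2 R g & exists s : {perm 'I_n}, l' \o s = g \o l.
Proof.
move=> il /an_equiv_local[X [Y [a [b [c [d [det0 [foX foY] _ [r r0 H]]]]]]]].
have FF := @punctured_filter R; have FP := @punctured_proper R.
have img u v : (exists i, line_factor (l i) (u, v) = 0) ->
    exists j, line_factor (l' j) (a * u + b * v, c * u + d * v) = 0.
  move=> [i lu].
  have lu' := limC (FF := FF) (c := u); have lv' := limC (FF := FF) (c := v).
  have limX' := scaled_limit (FF := FF) foX (@punctured_lim R) (@punctured_neq0 R) lu' lv'.
  have limY' := scaled_limit (FF := FF) foY (@punctured_lim R) (@punctured_neq0 R) lu' lv'.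
  have su := limM (FF := FF) (@punctured_lim R) lu'.
  have sv := limM (FF := FF) (@punctured_lim R) lv'.
  rewrite mul0r in su; rewrite mul0r in sv.
  have N1 := lim_normc (FF := FF) su r0; have N2 := lim_normc (FF := FF) sv r0.
  have N3 := @filterI _ _ FF _ _ (@punctured_neq0 R) (@filterI _ _ FF _ _ N1 N2).
  have fl := lim_prod (FF := FF) (s := index_enum 'I_n)
    (fun j => lim_line_factor (FF := FF) (t := l' j) limX' limY').
  have f0 : (fun t => \prod_(j < n) line_factor (l' j)
      (X (t * u, t * v) / t, Y (t * u, t * v) / t)) @ (0 : C)^' --> (0 : C).
    refine (lim_near (FF := FF) _ (limC (FF := FF) (c := 0))).
    refine (@filterS _ _ FF _ _ _ N3) => t [/= t0]; rewrite !subr0 => -[h1 h2].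
    have := H _ _ h1 h2; rewrite !line_factor_prod => -[|j e].
      by exists i; rewrite line_factorM lu mulr0.
    apply/esym/eqP/prodf_eq0; exists j => //.
    by rewrite [_ / t]mulrC [X in (_, X)]mulrC line_factorM e mulr0.
  have /eqP/prodf_eq0[j _ /eqP e] := lim_unique (FF := FP) fl f0.
  by exists j.
have det' : d * a - c * b != 0 by rewrite [d * a]mulrC [c * b]mulrC.
(* The differential (x, y) |-> (a x + b y, c x + d y) sends the slope t to (d t + c) / (b t + a). *)
exists (mobius d c b a); first exact: mobius_PSL2.
apply: inj_perm => //.
  have [h [_ gh _]] := PSL2_inv (mobius_PSL2 det').
  exact: can_inj gh.
move=> i.
have key x y : (x, y) != (0, 0) -> line_factor (l i) (x, y) = 0 ->
    exists j, l' j = mobius d c b a (l i).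
  move=> xy0 lxy; have [|j e] := img x y; first by exists i.
  by exists j; exact: (line_factor_eq_mobius det' xy0 lxy e).
(* One nonzero point on each line suffices: (1, t) for slope t, (0, 1) for slope oo. *)
case E : (l i) key => [t|] key.
  by apply: (key 1 t); rewrite /= ?mulr1 ?subrr // xpair_eqE oner_eq0.
by apply: (key 0 1); rewrite //= xpair_eqE oner_eq0 andbF.
Qed.

Lemma differentiable_lin (f g : C * C -> C) (a b : C) p :
  differentiable f p -> differentiable g p ->
  differentiable (fun q => a * f q + b * g q) p.
Proof.
move=> df dg.
have da := differentiable_cst a p; have db := differentiable_cst b p.
exact: (differentiableD (differentiableM da df) (differentiableM db dg)).
Qed.

Lemma differentiable_pow (f : C * C -> C) n p :
  differentiable f p -> differentiable (fun q => f q ^+ n) p.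
Proof.
move=> df; elim: n => [|n IH].
  rewrite (_ : (fun q => f q ^+ 0) = cst 1); first exact: differentiable_cst.
  by apply: funext => q; rewrite expr0.
rewrite (_ : (fun q => f q ^+ n.+1) = f * (fun q => f q ^+ n)).
  exact: (differentiableM df IH).
by apply: funext => q; rewrite exprS.
Qed.

Lemma an_equiv_linear (A B : set (C * C)) a b c d : a * d - b * c = 1 ->
  (forall x y, A (x, y) <-> B (a * x + b * y, c * x + d * y)) -> an_equiv A B.
Proof.
move=> e AB.
have dlin (a1 b1 c1 d1 : C) p : differentiable
    (fun q : C * C => (a1 * q.1 + b1 * q.2, c1 * q.1 + d1 * q.2)) p.
  have df := differentiable_fst p; have ds := differentiable_snd p.
  exact: (differentiable_pair (differentiable_lin a1 b1 df ds) (differentiable_lin c1 d1 df ds)).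
apply: (an_equiv_global (Phi := fun q => (a * q.1 + b * q.2, c * q.1 + d * q.2))
                        (Psi := fun q => (d * q.1 + - b * q.2, - c * q.1 + a * q.2))).
- by rewrite /= !mulr0 !addr0.
- exact: dlin.
- exact: dlin.
- move=> [x y] /=; congr pair.
    by transitivity ((a * d - b * c) * x); [ring|rewrite e mul1r].
  by transitivity ((a * d - b * c) * y); [ring|rewrite e mul1r].
- move=> [x y] /=; congr pair.
    by transitivity ((a * d - b * c) * x); [ring|rewrite e mul1r].
  by transitivity ((a * d - b * c) * y); [ring|rewrite e mul1r].
- by case.
Qed.

(** These maps realize the whole group actions: y = l x^q goes to y = (a l + b) x^q, and with b = 0,
    y^p = l x^q goes to y^p = a^p l x^q. *)
Lemma an_equiv_shear (A B : set (C * C)) a b q : (0 < q)%N -> a != 0 ->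
  (forall x y, A (x, y) <-> B (x, a * y + b * x ^+ q)) -> an_equiv A B.
Proof.
move=> q0 a0 AB.
have dsh (a1 b1 : C) p : differentiable
    (fun r : C * C => (r.1, a1 * r.2 + b1 * r.1 ^+ q)) p.
  have d1 := differentiable_fst p; have d2 := differentiable_snd p.
  exact: (differentiable_pair d1 (differentiable_lin a1 b1 d2 (differentiable_pow q d1))).
apply: (an_equiv_global (Phi := fun r => (r.1, a * r.2 + b * r.1 ^+ q))
                        (Psi := fun r => (r.1, a^-1 * r.2 + - (b / a) * r.1 ^+ q))).
- by rewrite /= mulr0 add0r expr0n gtn_eqF // mulr0.
- exact: dsh.
- exact: dsh.
- by move=> [x y] /=; congr pair; field.
- by move=> [x y] /=; congr pair; field.
- by case.
Qed.

Lemma an_equiv_mobius n (l l' : 'I_n -> P1 R) g (s : {perm 'I_n}) :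
  PSL2 R g -> l' \o s = g \o l -> an_equiv (curve_11 l) (curve_11 l').
Proof.
move=> [a [b [c [d [e ->]]]]] ls.
have lsi i : l' (s i) = mobius a b c d (l i) by exact: (congr1 (fun f => f i) ls).
have det0 : a * d - b * c != 0 by rewrite e oner_neq0.
have e' : d * a - c * b = 1 by rewrite -e; ring.
apply: (an_equiv_linear e') => x y; rewrite !line_factor_prod.
split=> [[i /eqP li]|[j /eqP lj]].
  exists (s i); apply/eqP; rewrite lsi.
  by rewrite line_factor_mobius.
exists ((s^-1)%g j); apply/eqP; rewrite -(line_factor_mobius _ _ _ det0) -lsi.
by rewrite permKV.
Qed.

Lemma curve_pq_factors p q n (m k : 'I_2) (l : 'I_n -> C) x y :
  curve_pq p q m k l (x, y) <->
  [\/ (0 < m)%N /\ x = 0, (0 < k)%N /\ y = 0 | exists j, y ^+ p = l j * x ^+ q].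
Proof.
split=> [/eqP|H].
  rewrite /= !mulf_eq0 !expf_eq0 => /orP[/orP[/andP[? /eqP ?]|/andP[? /eqP ?]]|].
  - by constructor 1.
  - by constructor 2.
  - move=> /prodf_eq0[j _]; rewrite subr_eq0 => /eqP ?.
    by constructor 3; exists j.
apply/eqP; rewrite /= !mulf_eq0 !expf_eq0.
case: H => [[-> ->]|[-> ->]|[j e]]; rewrite ?eqxx ?orbT //.
by apply/orP; right; apply/prodf_eq0; exists j => //; rewrite e subrr.
Qed.

Lemma curve_1q_pq q n (m : 'I_2) (l : 'I_n -> C) :
  curve_1q q m l = curve_pq 1 q m ord0 l.
Proof.
apply: funext => z; rewrite /curve_1q /curve_pq /mkset expr0 mulr1.
by congr (_ * _ = 0); apply: eq_bigr => j _; rewrite expr1.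
Qed.

Lemma an_equiv_aff q n (m : 'I_2) (l l' : 'I_n -> C) g (s : {perm 'I_n}) :
  (0 < q)%N -> Aff R g -> l' \o s = g \o l ->
  an_equiv (curve_pq 1 q m ord0 l) (curve_pq 1 q m ord0 l').
Proof.
move=> q0 [a [b [a0 ->]]] ls.
have lsi i : l' (s i) = a * l i + b by exact: (congr1 (fun f => f i) ls).
apply: (an_equiv_shear (b := b) q0 a0) => x y; rewrite !curve_pq_factors /= !expr1.
split=> -[h|[//]|[j e]]; [by constructor 1| |by constructor 1|]; constructor 3.
  by exists (s j); rewrite lsi e; ring.
exists ((s^-1)%g j); apply: (mulfI a0); apply: (addIr (b * x ^+ q)).
rewrite e -{1}(permKV s j) lsi; ring.
Qed.

Lemma an_equiv_gl p q n (m k : 'I_2) (l l' : 'I_n -> C) g (s : {perm 'I_n}) :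
  (0 < p)%N -> (0 < q)%N -> GL1 R g -> l' \o s = g \o l ->
  an_equiv (curve_pq p q m k l) (curve_pq p q m k l').
Proof.
move=> p0 q0 [a [a0 ->]] ls.
have lsi i : l' (s i) = a * l i by exact: (congr1 (fun f => f i) ls).
(* Scaling y by c multiplies each l_j by c^p. *)
pose c := p.-root a; have cp : c ^+ p = a by rewrite rootCK.
have c0 : c != 0 by rewrite rootC_eq0.
apply: (an_equiv_shear (b := 0) q0 c0) => x y; rewrite !curve_pq_factors mul0r addr0.
split=> -[h|[k0 y0]|[j e]].
- by constructor 1.
- by constructor 2; rewrite y0 mulr0.
- by constructor 3; exists (s j); rewrite lsi exprMn cp e mulrA.
- by constructor 1.
- constructor 2; split=> //; apply/eqP; move/eqP: y0.
  by rewrite mulf_eq0 (negPf c0).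
- constructor 3; exists ((s^-1)%g j); apply: (mulfI a0).
  by rewrite mulrA -lsi permKV -e exprMn cp.
Qed.

End Equivalences.

(** * Curve germs and quasi-homogeneous polynomials *)

Section Germs.
Import ComplexField.Normc.
Local Open Scope complex_scope.
Variable R : realType.
Local Notation C := (Cplx R).
Implicit Types (a b c d x y z w : C).

Lemma differentiable_prod (I : Type) (s : seq I) (f : I -> C * C -> C) p :
  (forall i, differentiable (f i) p) ->
  differentiable (fun q => \prod_(i <- s) f i q) p.
Proof.
move=> df; elim: s => [|i s IH].
  rewrite (_ : (fun q => _) = cst 1); first exact: differentiable_cst.
  by apply: funext => q; rewrite big_nil.
rewrite (_ : (fun q => _) = f i * (fun q => \prod_(i <- s) f i q)).
  exact: (differentiableM (df i) IH).
by apply: funext => q; rewrite big_cons.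
Qed.

Lemma exists_notin (s : seq C) : exists z, z \notin s.
Proof.
apply: contrapT => /forallNP H.
have sub : {subset [seq (i%:R : C) | i <- iota 0 (size s).+1] <= s}.
  by move=> z _; apply/negPn/negP; exact: H.
have us : uniq [seq (i%:R : C) | i <- iota 0 (size s).+1].
  rewrite map_inj_uniq ?iota_uniq // => i j /eqP.
  by rewrite eqr_nat => /eqP.
by have := uniq_leq_size us sub; rewrite size_map size_iota ltnn.
Qed.

(** An arc tending to 0 along which f has no zero shows that f does not vanish identically near
    0. *)
Lemma curve_germ_arc (f : C * C -> C) (u v : C -> C) :
  (forall p, differentiable f p) -> f (0, 0) = 0 ->
  u @ (0 : C)^' --> (0 : C) -> v @ (0 : C)^' --> (0 : C) ->
  (forall t, t != 0 -> f (u t, v t) != 0) ->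
  curve_germ [set z | f z = 0].
Proof.
move=> df f0 ul vl fn; exists setT, f; split=> //; first by split=> //; exact: openT.
move=> /nbhs_pair_normcP[r r0 H].
have FF := @punctured_filter R; have FP := @punctured_proper R.
have N1 := lim_normc (FF := FF) ul r0; have N2 := lim_normc (FF := FF) vl r0.
have N3 := @filterI _ _ FF _ _ (@punctured_neq0 R) (@filterI _ _ FF _ _ N1 N2).
have [t [/= t0 [h1 h2]]] := @filter_ex _ _ FP _ N3.
by move: (fn t t0); rewrite (H (u t, v t) h1 h2) eqxx.
Qed.

Lemma curve_germ_11 n (l : 'I_n -> P1 R) : (0 < n)%N -> curve_germ (curve_11 l).
Proof.
move=> n0.
(* A slope different from all those of the curve. For slope oo the default 0 only excludes one more
   value: x = t <> 0 already avoids that line. *)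
have [z zn] := exists_notin [seq odflt 0 (l j) | j <- enum 'I_n].
apply: (curve_germ_arc (u := fun t => t) (v := fun t => t * z)).
- move=> p; apply: differentiable_prod => i.
  have df := differentiable_fst p; have ds := differentiable_snd p.
  case: (l i) => [t|]; last exact: df.
  exact: (differentiableB ds (differentiableM (differentiable_cst t p) df)).
- apply/eqP/prodf_eq0; exists (Ordinal n0) => //=.
  by case: (l _) => [t|] //=; rewrite mulr0 subrr.
- exact: punctured_lim.
- have FF := @punctured_filter R.
  by have := limM (FF := FF) (@punctured_lim R) (limC (FF := FF) (c := z)); rewrite mul0r.
- move=> t t0; apply/prodf_neq0 => j _.
  have : z != odflt 0 (l j).
    by apply: contraNneq zn => ->; apply/mapP; exists j; rewrite ?mem_enum.
  case: (l j) => [w|] //= zw.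
  rewrite (_ : _ - _ = t * (z - w)); last by ring.
  by rewrite mulf_neq0 // subr_eq0.
Qed.

Lemma curve_germ_pq p q n (m k : 'I_2) (l : 'I_n -> C) :
  (0 < p)%N -> (0 < q)%N -> (0 < n)%N -> curve_germ (curve_pq p q m k l).
Proof.
move=> p0 q0 n0.
pose P := pq_polyX p k l.
have [rs rsE] := closed_field_poly_normal P.
have [z0 zn] := exists_notin rs.
have zr : pq_poly p k l z0 != 0.
  apply: contra zn => zr.
  have /eqP lc := monic_pq_polyX k l p0.
  rewrite -/P in lc; rewrite lc scale1r in rsE.
  by rewrite -root_prod_XsubC -rsE rootE horner_pq_polyX.
(* The arc runs between the branches, as z0 is not a root of Q_l. *)
apply: (curve_germ_arc (u := fun t => t ^+ p) (v := fun t => t ^+ q * z0)).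
- move=> r; have df := differentiable_fst r; have ds := differentiable_snd r.
  have dp : differentiable (fun z : C * C => \prod_(j < n) (z.2 ^+ p - l j * z.1 ^+ q)) r.
    apply: differentiable_prod => i.
    exact: (differentiableB (differentiable_pow p ds)
      (differentiableM (differentiable_cst (l i) r) (differentiable_pow q df))).
  exact: (differentiableM (differentiableM (differentiable_pow m df) (differentiable_pow k ds)) dp).
- apply/eqP; rewrite !mulf_eq0; apply/orP; right; apply/prodf_eq0; exists (Ordinal n0) => //=.
  by rewrite !expr0n !gtn_eqF // mulr0 subrr.
- exact: punctured_limX.
- have FF := @punctured_filter R.
  by have := limM (FF := FF) (punctured_limX q0) (limC (FF := FF) (c := z0)); rewrite mul0r.
- move=> t t0 /=.
  have fE j : (t ^+ q * z0) ^+ p - l j * (t ^+ p) ^+ q = t ^+ (p * q) * (z0 ^+ p - l j).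
    by rewrite exprMn -!exprM [(q * p)%N]mulnC; ring.
  move: zr; rewrite mulf_eq0 negb_or => /andP[z0k /prodf_neq0 z0p].
  apply: mulf_neq0.
    apply: mulf_neq0; first by rewrite !expf_neq0.
    by rewrite exprMn mulf_neq0 // !expf_neq0.
  apply/prodf_neq0 => j _; rewrite fE mulf_neq0 ?expf_neq0 //; exact: z0p.
Qed.

End Germs.

(** * Weighted homogeneity and reducedness *)

Section QuasiHomogeneous.
Import ComplexField.Normc.
Local Open Scope complex_scope.
Variable R : realType.
Local Notation C := (Cplx R).
Implicit Types (a b d : nat) (P Q : {poly {poly C}}) (c x y z : C).

(** Unlike in [quasi_homogeneous_poly], the weight d is explicit and may be 0, so that weights add
    under products, the empty one included. *)
Definition wt a b d P := forall i j, P`_j`_i != 0 -> (a * i + b * j = d)%N.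

Lemma wtM a b d d' P Q : wt a b d P -> wt a b d' Q -> wt a b (d + d') (P * Q).
Proof.
move=> wP wQ i j; apply: contra_neq_eq => ne.
rewrite coefM coef_sum big1 // => u _; rewrite coefM big1 // => v _.
have [->|Pn] := eqVneq P`_u`_v 0; first by rewrite mul0r.
have [->|Qn] := eqVneq Q`_(j - u)`_(i - v) 0; first by rewrite mulr0.
move/eqP: ne; case; rewrite -(wP _ _ Pn) -(wQ _ _ Qn).
have := ltn_ord u; have := ltn_ord v; rewrite !ltnS => vi uj.
by rewrite addnACA -!mulnDr !subnKC.
Qed.

Lemma wtB a b d P Q : wt a b d P -> wt a b d Q -> wt a b d (P - Q).
Proof.
move=> wP wQ i j; rewrite !coefB.
have [->|/wP -> //] := eqVneq P`_j`_i 0.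
by rewrite sub0r oppr_eq0 => /wQ.
Qed.

Lemma wt1 a b : wt a b 0 1.
Proof.
move=> i j; rewrite coef1; case: j => [|j] /=; last by rewrite coef0 eqxx.
by rewrite coef1; case: i => [|i] /=; rewrite ?eqxx ?muln0.
Qed.

Lemma wtX a b : wt a b b 'X.
Proof.
move=> i j; rewrite coefX; case: (j =P 1%N) => [->|] /=; last by rewrite coef0 eqxx.
by rewrite coef1; case: i => [|i] /=; rewrite ?eqxx // muln0 muln1.
Qed.

Lemma wtCXn a b n c : wt a b (a * n) (c *: 'X^n)%:P.
Proof.
move=> i j; rewrite coefC; case: (j =P 0%N) => [->|] /=; last by rewrite coef0 eqxx.
rewrite coefZ coefXn; case: (i =P n) => [->|] /=; first by rewrite muln0 addn0.
by rewrite mulr0 eqxx.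
Qed.

Lemma wtXn a b d P n : wt a b d P -> wt a b (d * n) (P ^+ n).
Proof.
move=> wP; elim: n => [|n IH]; first by rewrite muln0 expr0; exact: wt1.
by rewrite exprS mulnS; exact: wtM.
Qed.

Lemma wt_prod a b d n (P : 'I_n -> {poly {poly C}}) :
  (forall i, wt a b d (P i)) -> wt a b (d * n) (\prod_(i < n) P i).
Proof.
elim: n P => [|n IH] P wP; first by rewrite big_ord0 muln0; exact: wt1.
by rewrite big_ord_recl mulnS; apply: wtM => //; exact: IH.
Qed.

(* Specialising the first variable at [c <> 0] detects square factors of positive
   degree in y; the others divide the leading coefficient. *)
Lemma reduced_poly_spec P : (size (lead_coef P) <= 2)%N ->
  (forall c, c != 0 -> separable_poly (map_poly (horner_eval c) P)) ->
  reduced_poly P.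
Proof.
move=> lc sep.
have P0 : P != 0.
  apply: contraTneq (separable_poly_neq0 (sep 1 (oner_neq0 _))) => ->.
  by rewrite rmorph0 eqxx.
split=> // g h PE.
have gs c : c != 0 -> (size (map_poly (horner_eval c) g) <= 1)%N.
  move=> c0; have := sep c c0; rewrite PE rmorphM rmorphXn /= => /separable_polyP[sq _].
  have /sq : map_poly (horner_eval c) g * map_poly (horner_eval c) g %|
     map_poly (horner_eval c) g ^+ 2 * map_poly (horner_eval c) h.
    by rewrite expr2; exact: dvdp_mulr.
  by rewrite coprimepp => /eqP ->.
(* A coefficient of positive index in y vanishes at every c <> 0, hence is zero. *)
have gC : g = (g`_0)%:P.
  apply/size1_polyC/leq_sizeP => j j1; apply/eqP; apply: contraT => gj.
  have [rs rsE] := closed_field_poly_normal (g`_j).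
  have [z zn] := exists_notin (0 :: rs).
  move: zn; rewrite inE negb_or => /andP[z0 zn].
  have := leq_sizeP _ _ (gs z z0) j j1; rewrite coef_map /= /horner_eval => gz.
  move: gz; rewrite rsE hornerZ => /eqP; rewrite mulf_eq0 lead_coef_eq0 (negPf gj) /=.
  by rewrite -rootE root_prod_XsubC (negPf zn).
move: P0 lc; rewrite PE mulf_eq0 negb_or => /andP[g2 h0].
have g00 : g`_0 != 0.
  by apply: contraNneq g2 => e; rewrite gC e polyC0 expr0n.
(* Now the square of g_0 divides a polynomial of degree at most 1 in x, so g_0 is a nonzero
   constant. *)
rewrite lead_coefM lead_coef_exp [g in lead_coef g]gC lead_coefC.
rewrite size_mul ?expf_neq0 ?lead_coef_eq0 // expr2 size_mul // => sz.
have : (0 < size (lead_coef h))%N by rewrite lt0n size_poly_eq0 lead_coef_eq0.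
set g0 := g`_0 in gC g00 sz *.
have : (0 < size g0)%N by rewrite lt0n size_poly_eq0.
move=> s1 s2; have {sz} s3 : size g0 = 1%N.
  move: s1 s2 sz; case: (size g0) => [//|[//|s]]; case: (size (lead_coef h)) => [//|u] _ _.
  by rewrite !addSn !addnS.
have [e eE] := size_poly1P _ (introT eqP s3).
rewrite gC poly_unitE size_polyC g00 coefC eqxx /=.
rewrite poly_unitE s3 eqxx /= unitfE.
by case: eE => // e0 ->; rewrite coefC eqxx.
Qed.

End QuasiHomogeneous.

Section QuasiHomogeneousCurves.
Variable R : realType.
Local Notation C := (Cplx R).
Implicit Types (a b d : nat) (c x y z : C).

Lemma separable_const c : c != 0 -> separable_poly (c%:P : {poly C}).
Proof.
move=> c0; rewrite separable_poly.unlock; apply/Pdiv.ClosedField.coprimepP => x.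
by rewrite rootE hornerC (negPf c0).
Qed.

Lemma separable_prod (I : eqType) (s : seq I) (f : I -> {poly C}) : uniq s ->
  (forall i, separable_poly (f i)) ->
  (forall i j x, i != j -> root (f i) x -> ~~ root (f j) x) ->
  separable_poly (\prod_(i <- s) f i).
Proof.
move=> us sf nf; elim: s us => [_|i s IH /= /andP[is_ us]].
  by rewrite big_nil -polyC1; apply: separable_const; exact: oner_neq0.
rewrite big_cons separable_mul sf IH //=.
apply/Pdiv.ClosedField.coprimepP => x fx.
rewrite horner_prod big_seq prodf_seq_neq0; apply/allP => j js; apply/implyP => _.
apply: (nf i j x _ fx); apply: contraNneq is_ => ->; exact: js.
Qed.

(** The coefficient 1 gives the power of x the shape handled by [wtCXn]. *)
Definition poly_pq p q n (m k : 'I_2) (l : 'I_n -> C) : {poly {poly C}} :=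
  (1 *: 'X^m)%:P * 'X^k * \prod_(j < n) ('X^p - (l j *: 'X^q)%:P).

Lemma zero_set_poly_pq p q n (m k : 'I_2) (l : 'I_n -> C) :
  zero_set (poly_pq p q m k l) = curve_pq p q m k l.
Proof.
apply: funext => z; rewrite /zero_set /curve_pq /mkset /poly_pq.
rewrite !hornerM !horner_prod hornerC hornerXn hornerZ !hornerXn mul1r.
rewrite -polyC_exp hornerC; congr (_ * _ * _ = 0); apply: eq_bigr => j _.
by rewrite !(hornerD, hornerN) hornerXn -polyC_exp !hornerC hornerZ hornerXn.
Qed.

(** At x = c <> 0 the polynomial becomes c^m Q for the configuration c^q l, which is separable; its
    leading coefficient in y is x^m with m <= 1. *)
Lemma reduced_poly_pq p q n (m k : 'I_2) (l : 'I_n -> C) : (0 < p)%N -> injective l ->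
  ((p == 1%N) && (k == 0%N :> nat)) || [forall j, l j != 0] ->
  reduced_poly (poly_pq p q m k l).
Proof.
move=> p0 il H.
have mon : \prod_(j < n) ('X^p - (l j *: 'X^q)%:P) \is @monic {poly C}.
  by apply: monic_prod => j _; rewrite monicXnsubC.
have lt2 (i : 'I_2) : (i < 2)%N by exact: ltn_ord.
apply: reduced_poly_spec => [|c c0].
  rewrite !lead_coefM lead_coefC lead_coefXn (eqP mon) !mulr1 scale1r size_polyXn.
  exact: lt2.
have -> : map_poly (horner_eval c) (poly_pq p q m k l) =
    (c ^+ m)%:P * pq_polyX p k (fun j => l j * c ^+ q).
  rewrite /poly_pq /pq_polyX !rmorphM /= map_polyC /= map_polyXn -mulrA.
  rewrite rmorph_prod /=; congr (_%:P * (_ * _)).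
    by rewrite /horner_eval hornerZ hornerXn mul1r.
  apply: eq_bigr => j _.
  by rewrite rmorphB /= map_polyXn map_polyC /= /horner_eval hornerZ hornerXn.
have cq : c ^+ q != 0 by rewrite expf_neq0.
rewrite separable_mul separable_const ?expf_neq0 //=; apply/andP; split.
  apply: separable_pq_polyX => //.
  - exact: pchar_Cplx.
  - by rewrite -ltnS lt2.
  - by move=> i j /(mulIf cq)/il.
  - case/orP: H => [->//|/forallP H]; apply/orP; right; apply/forallP => j.
    by rewrite mulf_neq0.
apply/Pdiv.ClosedField.coprimepP => x.
by rewrite rootE hornerC (negPf (expf_neq0 _ c0)).
Qed.

Lemma quasi_homogeneous_pq p q n (m k : 'I_2) (l : 'I_n -> C) :
  (0 < p)%N -> (0 < q)%N -> (0 < n)%N -> injective l ->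
  ((p == 1%N) && (k == 0%N :> nat)) || [forall j, l j != 0] ->
  quasi_homogeneous (curve_pq p q m k l).
Proof.
move=> p0 q0 n0 il H; exists (poly_pq p q m k l); split.
- exists p, q, (p * m + q * k + q * p * n)%N; split=> //.
    by rewrite addn_gt0 !muln_gt0 p0 q0 n0 orbT.
  apply: wtM; first by apply: wtM; [exact: wtCXn|exact/wtXn/wtX].
  apply: wt_prod => j; apply: wtB; first exact/wtXn/wtX.
  by rewrite mulnC; exact: wtCXn.
- exact: reduced_poly_pq.
- rewrite zero_set_poly_pq; exact: an_equiv_refl.
Qed.

Definition line_poly (t : P1 R) : {poly {poly C}} :=
  if t is Some s then 'X - (s *: 'X^1)%:P else (1 *: 'X^1)%:P.

Lemma zero_set_line_poly n (l : 'I_n -> P1 R) :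
  zero_set (\prod_(j < n) line_poly (l j)) = curve_11 l.
Proof.
apply: funext => z; rewrite /zero_set /curve_11 /mkset.
rewrite !horner_prod; congr (_ = 0); apply: eq_bigr => j _.
case: (l j) => [s|] /=; last by rewrite !hornerC hornerZ hornerX mul1r.
by rewrite !(hornerD, hornerN) hornerX !hornerC hornerZ hornerX.
Qed.

Lemma spec_line_poly c t : map_poly (horner_eval c) (line_poly t) =
  if t is Some s then 'X - (s * c)%:P else c%:P.
Proof.
case: t => [s|] /=; last by rewrite map_polyC /= /horner_eval hornerZ hornerX mul1r.
by rewrite rmorphB /= map_polyX map_polyC /= /horner_eval hornerZ hornerX.
Qed.

Lemma lead_coef_line_poly t :
  lead_coef (line_poly t) = if t is Some _ then 1 else 'X.
Proof.
case: t => [s|] /=; last by rewrite lead_coefC scale1r.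
by rewrite lead_coefXsubC.
Qed.

(** By injectivity at most one of the lines is x = 0, so the leading coefficient in y is 1 or x. *)
Lemma lead_coef_lines n (l : 'I_n -> P1 R) : injective l ->
  (size (lead_coef (\prod_(j < n) line_poly (l j)))%R <= 2)%N.
Proof.
move=> il; rewrite lead_coef_prod.
under eq_bigr do rewrite lead_coef_line_poly.
have [i0 i0E|noN] := pickP (fun i => l i == None).
  rewrite (bigD1 i0) //= (eqP i0E) big1 ?mulr1 ?size_polyX // => i ii0.
  case E : (l i) => //; exfalso; move/eqP: ii0; apply; apply: il.
  by rewrite E (eqP i0E).
rewrite big1 ?size_poly1 // => i _.
by case E : (l i) => //; have := noN i; rewrite E.
Qed.

Lemma quasi_homogeneous_11 n (l : 'I_n -> P1 R) : (0 < n)%N -> injective l ->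
  quasi_homogeneous (curve_11 l).
Proof.
move=> n0 il; exists (\prod_(j < n) line_poly (l j)); split.
- have h : wt 1 1 (1 * n) (\prod_(j < n) line_poly (l j)).
    apply: wt_prod => j; case: (l j) => [s|]; last exact: (@wtCXn R 1 1 1 1).
    by apply: wtB; [exact: wtX|exact: (@wtCXn R 1 1 1 s)].
  by rewrite mul1n in h; exists 1%N, 1%N, n.
- apply: reduced_poly_spec => [|c c0]; first exact: lead_coef_lines.
  rewrite rmorph_prod /=; under eq_bigr do rewrite spec_line_poly.
  apply: separable_prod.
  + exact: index_enum_uniq.
  + move=> i; case: (l i) => [s|]; last exact: separable_const.
    have := @separable_XnsubC C (@pchar_Cplx R) 1 (s * c) isT isT.
    by rewrite expr1.
  + move=> i j x ij; case E : (l i) => [s|]; last by rewrite rootE hornerC (negPf c0).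
    case E' : (l j) => [s'|]; last by rewrite !rootE hornerC (negPf c0).
    rewrite !rootE !hornerXsubC !subr_eq0 => /eqP ->.
    apply: contra ij => /eqP /(mulIf c0) ss; apply/eqP/il.
    by rewrite E E' ss.
- rewrite zero_set_line_poly; exact: an_equiv_refl.
Qed.

End QuasiHomogeneousCurves.

(** * Moduli spaces *)

Section Moduli.
Variable R : realType.
Local Notation C := (Cplx R).

(** On [dom] the maps [cls] and [cur] have the same fibres, so cur factors injectively through cls.
    [s0] is the value given to F outside the image of [cls]. *)
Lemma ex_class_bij (L K S : Type) (s0 : S) (dom : set L) (cls : L -> K) (cur : L -> S) :
  (forall l l', dom l -> dom l' -> cls l = cls l' <-> cur l = cur l') ->
  exists F : K -> S, set_bij (cls @` dom) (cur @` dom) F /\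
    forall l, dom l -> F (cls l) = cur l.
Proof.
move=> H.
have /choice[F FE] : forall k, exists s, forall l, dom l -> cls l = k -> cur l = s.
  move=> k; have [[l [dl lk]]|nl] := pselect (exists l, dom l /\ cls l = k).
    by exists (cur l) => l' dl' l'k; apply/(H _ _ dl' dl); rewrite l'k.
  by exists s0 => l dl lk; case: nl; exists l.
have FC l : dom l -> F (cls l) = cur l by move=> dl; rewrite -(FE (cls l) l dl erefl).
exists F; split=> //; split.
- by move=> _ [l dl <-]; exists l; rewrite ?FC.
- move=> k k'; rewrite !inE => -[l dl <-] [l' dl' <-]; rewrite !FC //.
  by move=> /(H _ _ dl dl').
- by move=> _ [l dl <-]; exists (cls l); [exists l|rewrite FC].
Qed.

(** [an_class] agrees on equivalent curves, so every class of the given type is already the class of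
    a normal form. *)
Lemma moduliE (L : Type) (dom : set L) (cur : L -> set (C * C)) p q n :
  (forall l, dom l -> curve_germ (cur l)) ->
  (forall l, dom l -> quasi_homogeneous (cur l)) ->
  (forall A, of_type p q n A <-> exists2 l, dom l & an_equiv A (cur l)) ->
  moduli R p q n = (@an_class R \o cur) @` dom.
Proof.
move=> cg qh ty; apply/seteqP; split=> [_ [A [cA qA /ty[l dl Al]] <-]|_ [l dl <-]].
  by exists l => //; apply/esym/an_classP => //; exact: cg.
exists (cur l) => //; split; [exact: cg|exact: qh|].
by apply/ty; exists l => //; exact: an_equiv_refl.
Qed.

Lemma Symm_quotE (T : Type) (M : set T) n (G : set (T -> T)) :
  Symm_quot M n G = conf_class G @` conf M n.
Proof.
apply/seteqP; split=> [_ [_ [l cl <-] <-]|_ [l cl <-]]; first by exists l.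
by exists (sym_orbit l) => //; exists l.
Qed.

Lemma an_equiv_11P n (l l' : 'I_n -> P1 R) : injective l ->
  an_equiv (curve_11 l) (curve_11 l') <->
  conf_class (PSL2 R) l = conf_class (PSL2 R) l'.
Proof.
move=> il; rewrite (conf_classP (@PSL2_id R) (@PSL2_comp R) (@PSL2_inv R)).
split=> [|[g Gg [s e]]]; first exact: an_equiv_11.
exact: an_equiv_mobius Gg e.
Qed.

Lemma an_equiv_1qP q n (m m' : 'I_2) (l l' : 'I_n -> C) : (1 < q)%N -> (0 < n)%N ->
  injective l -> injective l' ->
  an_equiv (curve_1q q m l) (curve_1q q m' l') <->
  (m, conf_class (Aff R) l) = (m', conf_class (Aff R) l').
Proof.
move=> q1 n0 il il'; rewrite !curve_1q_pq; split=> [E|[<-]].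
  have [mm' H] := an_equiv_1q q1 n0 il il' E.
  (* The inverse equivalence gives the opposite inequality. *)
  have [m'm _] := an_equiv_1q q1 n0 il' il (an_equiv_sym E).
  congr pair; first by apply/val_inj/eqP; rewrite eqn_leq mm'.
  exact/(conf_classP (@Aff_id R) (@Aff_comp R) (@Aff_inv R)).
move=> /(conf_classP (@Aff_id R) (@Aff_comp R) (@Aff_inv R))[g Gg [s e]].
exact: an_equiv_aff (ltnW q1) Gg e.
Qed.

Lemma an_equiv_pqP p q n (m k m' k' : 'I_2) (l l' : 'I_n -> C) :
  (1 < p)%N -> (p < q)%N -> (0 < n)%N -> conf (Cstar R) n l -> conf (Cstar R) n l' ->
  an_equiv (curve_pq p q m k l) (curve_pq p q m' k' l') <->
  (m, k, conf_class (GL1 R) l) = (m', k', conf_class (GL1 R) l').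
Proof.
move=> p1 pq n0 cl cl'; split=> [E|[<- <-]].
  have [mm' kk' H] := an_equiv_pq_rigid p1 pq n0 cl cl' E.
  have [m'm k'k _] := an_equiv_pq_rigid p1 pq n0 cl' cl (an_equiv_sym E).
  have mE : m = m' by apply/val_inj/eqP; rewrite eqn_leq mm'.
  have kE : k = k' by apply/val_inj/eqP; rewrite eqn_leq kk'.
  rewrite -mE -kE; congr pair.
  by apply/(conf_classP (@GL1_id R) (@GL1_comp R) (@GL1_inv R)); exact: H.
move=> /(conf_classP (@GL1_id R) (@GL1_comp R) (@GL1_inv R))[g Gg [s e]].
exact: an_equiv_gl (ltnW p1) (ltn_trans (ltnW p1) pq) Gg e.
Qed.

End Moduli.

Theorem theoremA (R : realType) (p q n : nat)
    (hp : (0 < p)%N) (hq : (0 < q)%N) (hn : (0 < n)%N)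
    (hpq : (p <= q)%N) (hcop : coprime p q) :
  [/\ (p = 1%N /\ q = 1%N ->
        [/\ (exists F : set (set ('I_n -> P1 R)) -> set (set (Cplx R * Cplx R)),
               set_bij (Symm_quot setT n (PSL2 R)) (moduli R p q n) F /\
               forall l : 'I_n -> P1 R, conf setT n l ->
                 F (conf_class (PSL2 R) l) = an_class (curve_11 l)),
            (forall A : set (Cplx R * Cplx R),
               curve_germ A -> quasi_homogeneous A -> of_type p q n A ->
               exists2 l : 'I_n -> P1 R,
                 conf setT n l & an_equiv A (curve_11 l))
          & (forall l l' : 'I_n -> P1 R, conf setT n l -> conf setT n l' ->
               (an_equiv (curve_11 l) (curve_11 l') <->
                conf_class (PSL2 R) l = conf_class (PSL2 R) l'))]),
      (p = 1%N /\ (1 < q)%N ->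
        exists F : 'I_2 * set (set ('I_n -> Cplx R)) ->
                   set (set (Cplx R * Cplx R)),
          set_bij ([set: 'I_2] `*` Symm_quot setT n (Aff R))
                  (moduli R p q n) F /\
          forall (m : 'I_2) (l : 'I_n -> Cplx R), conf setT n l ->
            F (m, conf_class (Aff R) l) = an_class (curve_1q q m l))
    & ((1 < p)%N /\ (p < q)%N ->
        exists F : 'I_2 * 'I_2 * set (set ('I_n -> Cplx R)) ->
                   set (set (Cplx R * Cplx R)),
          set_bij ([set: 'I_2] `*` [set: 'I_2] `*`
                   Symm_quot (Cstar R) n (GL1 R))
                  (moduli R p q n) F /\
          forall (m k : 'I_2) (l : 'I_n -> Cplx R), conf (Cstar R) n l ->
            F (m, k, conf_class (GL1 R) l) = an_class (curve_pq p q m k l))].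
Proof.
split.
- move=> [-> ->].
  have cg (l : 'I_n -> P1 R) : curve_germ (curve_11 l) by exact: curve_germ_11.
  split.
  + rewrite Symm_quotE (@moduliE R _ (conf setT n) (@curve_11 R n)).
    * apply: (ex_class_bij set0) => l l' [il _] cl'.
      apply: (iff_trans (iff_sym (an_equiv_11P l' il))).
      exact: iff_sym (@an_classP R (curve_11 l) (curve_11 l') (cg l')).
    * by move=> l _; exact: cg.
    * by move=> l [il _]; exact: quasi_homogeneous_11.
    * by [].
  + by move=> A _ _.
  + by move=> l l' [il _] _; exact: an_equiv_11P.
- move=> [-> q1]; have q0 := ltnW q1.
  (* The discrete index is bundled with the configuration, so that [ex_class_bij] applies to a
     single parameter set. *)
  pose cur (ml : 'I_2 * ('I_n -> Cplx R)) := curve_1q q ml.1 ml.2.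
  pose dom := [set ml : 'I_2 * ('I_n -> Cplx R) | conf setT n ml.2].
  pose cls (ml : 'I_2 * ('I_n -> Cplx R)) := (ml.1, conf_class (Aff R) ml.2).
  have cg ml : curve_germ (cur ml) by rewrite /cur curve_1q_pq; exact: curve_germ_pq.
  have clsP ml ml' : dom ml -> dom ml' ->
      cls ml = cls ml' <-> an_class (cur ml) = an_class (cur ml').
    case: ml ml' => [m l] [m' l'] [/= il _] [/= il' _].
    apply: (iff_trans (iff_sym (an_equiv_1qP m m' q1 hn il il'))).
    exact: iff_sym (@an_classP R (cur (m, l)) (cur (m', l')) (cg (m', l'))).
  have [F [bF FE]] := @ex_class_bij _ _ _ set0 dom cls (@an_class R \o cur) clsP.
  exists F; split; last by move=> m l cl; exact: (FE (m, l) cl).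
  rewrite (@moduliE R _ dom cur).
  + rewrite Symm_quotE (_ : _ `*` _ = cls @` dom) //.
    apply/seteqP; split=> [[m O] [_ [l cl /= lO]]|_ [[m l] cl <-]].
      by exists (m, l) => //; rewrite /cls /= lO.
    by split=> //; exists l.
  + by move=> ml _; exact: cg.
  + move=> [m l] [/= il _]; rewrite /cur curve_1q_pq.
    by apply: quasi_homogeneous_pq.
  + move=> A; rewrite /of_type eqxx gtn_eqF //; split=> [[m [l [cl Al]]]|[[m l] cl Al]].
      by exists (m, l).
    by exists m, l.
- move=> [p1 pq]; have p0 := ltnW p1; have q0 := ltn_trans p0 pq.
  pose cur (ml : 'I_2 * 'I_2 * ('I_n -> Cplx R)) := curve_pq p q ml.1.1 ml.1.2 ml.2.
  pose dom := [set ml : 'I_2 * 'I_2 * ('I_n -> Cplx R) | conf (Cstar R) n ml.2].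
  pose cls (ml : 'I_2 * 'I_2 * ('I_n -> Cplx R)) := (ml.1, conf_class (GL1 R) ml.2).
  have cg ml : curve_germ (cur ml) by exact: curve_germ_pq.
  have clsP ml ml' : dom ml -> dom ml' ->
      cls ml = cls ml' <-> an_class (cur ml) = an_class (cur ml').
    case: ml ml' => [[m k] l] [[m' k'] l'] cl cl'.
    apply: (iff_trans (iff_sym (an_equiv_pqP m k m' k' p1 pq hn cl cl'))).
    exact: iff_sym (@an_classP R (cur (m, k, l)) (cur (m', k', l')) (cg (m', k', l'))).
  have [F [bF FE]] := @ex_class_bij _ _ _ set0 dom cls (@an_class R \o cur) clsP.
  exists F; split; last by move=> m k l cl; exact: (FE (m, k, l) cl).
  rewrite (@moduliE R _ dom cur).
  + rewrite Symm_quotE (_ : _ `*` _ = cls @` dom) //.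
    apply/seteqP; split=> [[[m k] O] [_ [l cl /= lO]]|_ [[[m k] l] cl <-]].
      by exists (m, k, l) => //; rewrite /cls /= lO.
    by split=> //; exists l.
  + by move=> ml _; exact: cg.
  + move=> [[m k] l] [/= il l0]; apply: quasi_homogeneous_pq => //.
    by apply/orP; right; apply/forallP => j; exact: l0.
  + move=> A; rewrite /of_type gtn_eqF //; split=> [[m [k [l [cl Al]]]]|[[[m k] l] cl Al]].
      by exists (m, k, l).
    by exists m, k, l.
Qed.
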